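(* Let $\mathbf{k}$ be a field, let $\mathsf{C}$ be a $\mathbf{k}$-linear abelian category and let $A\in\mathsf{C}$ be an object such that $\mathrm{Hom}(A,A)\simeq\mathrm{Ext}^2(A,A)\simeq\mathbf{k}$ and $\mathrm{Ext}^i(A,A)\simeq0$ for $i\ne0,2$. Let $\mathsf{D}^b(\mathsf{C})\langle A\rangle$ be the full subcategory of $\mathsf{D}^b(\mathsf{C})$ formed by the complexes $X$ such that for every $i\in\mathbb{Z}$ one has $H^iX\simeq A^{d_i}$ for some $d_i\in\mathbb{N}$. Then for any $B\in\mathsf{D}^b(\mathsf{C})\langle A\rangle$ there exists a finite family of triples of integers $\{(n_i,d_i,s_i)\}_{i\in I}$ with $n_i\in\mathbb{N}$, $d_i\in\mathbb{N}\setminus\{0\}$ and $s_i\in\mathbb{Z}$ such that $B\simeq\bigoplus_{i\in I}A_{n_i}^{d_i}[s_i]$. In particular $\mathsf{D}^b(\mathsf{C})\langle A\rangle$ contains countably many isomorphism classes.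
   Context: ''$\mathbf{k}$-linear'' means that the $\mathrm{Hom}$ groups are $\mathbf{k}$-vector spaces and composition is $\mathbf{k}$-bilinear. $\mathbb{N}=\{0,1,2,\dots\}$. For $n\in\mathbb{N}$, $A_n$ denotes the object of $\mathsf{D}^b(\mathsf{C})$, which exists and is unique up to isomorphism, with $H^i(A_n)\simeq A$ for $0\le i\le n$, $H^i(A_n)\simeq0$ for $i\notin[0,n]$, and $\mathrm{RHom}(A,A_n)\simeq\mathbf{k}\oplus\mathbf{k}[-n-2]$. In particular $A_0\simeq A$. *)

(* Defs.v *)
From HB Require Import structures.
From mathcomp Require Import all_boot all_order all_algebra generic_quotient.
From mathcomp Require Import boolp classical_sets cardinality.

Set Implicit Arguments.
Unset Strict Implicit.
Unset Printing Implicit Defensive.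

Import GRing.Theory.
Local Open Scope ring_scope.
Local Open Scope quotient_scope.

(** * k-linear categories *)

Record klin_cat (k : fieldType) := KlinCat {
  obj :> Type;
  mor : obj -> obj -> lmodType k;
  idm : forall X, mor X X;
  mcomp : forall X Y Z, mor Y Z -> mor X Y -> mor X Z;
  compA : forall X Y Z T (h : mor Z T) (g : mor Y Z) (f : mor X Y),
    mcomp h (mcomp g f) = mcomp (mcomp h g) f;
  comp1m : forall X Y (f : mor X Y), mcomp (idm Y) f = f;
  compm1 : forall X Y (f : mor X Y), mcomp f (idm X) = f;
  compDl : forall X Y Z (g g' : mor Y Z) (f : mor X Y),
    mcomp (g + g') f = mcomp g f + mcomp g' f;
  compDr : forall X Y Z (g : mor Y Z) (f f' : mor X Y),
    mcomp g (f + f') = mcomp g f + mcomp g f';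
  compZl : forall X Y Z (a : k) (g : mor Y Z) (f : mor X Y),
    mcomp (a *: g) f = a *: mcomp g f;
  compZr : forall X Y Z (a : k) (g : mor Y Z) (f : mor X Y),
    mcomp g (a *: f) = a *: mcomp g f
}.

Arguments mor {k k0} X Y : rename.
Arguments idm {k k0} X : rename.
Arguments mcomp {k k0 X Y Z} g f : rename.

Notation "g @o f" := (mcomp g f) (at level 40, left associativity).

Section KlinTheory.
Variables (k : fieldType) (C : klin_cat k).

Lemma comp0m (X Y Z : C) (f : mor X Y) : (0 : mor Y Z) @o f = 0.
Proof. by rewrite -[X in X @o f](scale0r 0) compZl scale0r. Qed.

Lemma compm0 (X Y Z : C) (g : mor Y Z) : g @o (0 : mor X Y) = 0.
Proof. by rewrite -[X in g @o X](scale0r 0) compZr scale0r. Qed.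

Definition is_iso (X Y : C) (f : mor X Y) : Prop :=
  exists g : mor Y X, g @o f = idm X /\ f @o g = idm Y.

Definition isomorphic (X Y : C) : Prop := exists f : mor X Y, is_iso f.

Definition is_mono (X Y : C) (f : mor X Y) : Prop :=
  forall (Z : C) (u v : mor Z X), f @o u = f @o v -> u = v.

Definition is_epi (X Y : C) (f : mor X Y) : Prop :=
  forall (Z : C) (u v : mor Y Z), u @o f = v @o f -> u = v.

Definition is_zero_ob (Z : C) : Prop :=
  (forall (X : C) (f : mor X Z), f = 0) /\
  (forall (X : C) (f : mor Z X), f = 0).

Definition is_kernel (X Y K : C) (f : mor X Y) (i : mor K X) : Prop :=
  f @o i = 0 /\
  forall (Z : C) (g : mor Z X), f @o g = 0 -> exists! u : mor Z K, i @o u = g.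

Definition is_cokernel (X Y Q : C) (f : mor X Y) (p : mor Y Q) : Prop :=
  p @o f = 0 /\
  forall (Z : C) (g : mor Y Z), g @o f = 0 -> exists! u : mor Q Z, u @o p = g.

(* [P] is a direct sum (biproduct) of the finite family [F]; for an empty
   family this says that [P] is a zero object. *)
Definition is_dsum (I : finType) (F : I -> C) (P : C) : Prop :=
  exists (inj : forall i, mor (F i) P) (prj : forall i, mor P (F i)),
    [/\ forall i, prj i @o inj i = idm (F i),
        forall i j, i <> j -> prj j @o inj i = 0
      & \sum_i inj i @o prj i = idm P].

(* [P] is isomorphic to the direct sum of [d] copies of [X] *)
Definition is_power (X : C) (d : nat) (P : C) : Prop :=
  is_dsum (fun _ : 'I_d => X) P.

End KlinTheory.

(** [V] is isomorphic, as a vector space, to k^r *)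
Definition iso_kpow (k : fieldType) (V : lmodType k) (r : nat) : Prop :=
  exists f : {linear V -> 'rV[k]_r}, bijective f.

(** * k-linear abelian categories *)

Record abelian_cat (k : fieldType) := AbelianCat {
  abcat :> klin_cat k;
  zob : abcat;
  zobP : is_zero_ob zob;
  dsum_ex : forall X Y : abcat, exists P : abcat,
    is_dsum (fun b : bool => if b then X else Y) P;
  kerob : forall X Y : abcat, mor X Y -> abcat;
  kerm : forall (X Y : abcat) (f : mor X Y), mor (kerob f) X;
  kerP : forall (X Y : abcat) (f : mor X Y), is_kernel f (kerm f);
  cokob : forall X Y : abcat, mor X Y -> abcat;
  cokm : forall (X Y : abcat) (f : mor X Y), mor Y (cokob f);
  cokP : forall (X Y : abcat) (f : mor X Y), is_cokernel f (cokm f);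
  mono_kernel : forall (X Y : abcat) (f : mor X Y), is_mono f ->
    exists (Z : abcat) (g : mor Y Z), is_kernel g f;
  epi_cokernel : forall (X Y : abcat) (f : mor X Y), is_epi f ->
    exists (Z : abcat) (g : mor Z X), is_cokernel g f
}.

Arguments zob {k} C : rename.
Arguments kerob {k C X Y} f : rename.
Arguments kerm {k C X Y} f : rename.
Arguments cokob {k C X Y} f : rename.
Arguments cokm {k C X Y} f : rename.

Section Factor.
Variables (k : fieldType) (C : abelian_cat k).

Definition ker_lift (X Y Z : C) (f : mor X Y) (g : mor Z X)
    (fg0 : f @o g = 0) : mor Z (kerob f) :=
  projT1 (cid ((kerP f).2 Z g fg0)).

Lemma ker_liftK (X Y Z : C) (f : mor X Y) (g : mor Z X) (fg0 : f @o g = 0) :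
  kerm f @o ker_lift fg0 = g.
Proof. by rewrite /ker_lift; case: cid => u []. Qed.

Definition cok_desc (X Y Z : C) (f : mor X Y) (g : mor Y Z)
    (gf0 : g @o f = 0) : mor (cokob f) Z :=
  projT1 (cid ((cokP f).2 Z g gf0)).

Lemma cok_descK (X Y Z : C) (f : mor X Y) (g : mor Y Z) (gf0 : g @o f = 0) :
  cok_desc gf0 @o cokm f = g.
Proof. by rewrite /cok_desc; case: cid => u []. Qed.

Lemma kerm_mono (X Y : C) (f : mor X Y) : is_mono (kerm f).
Proof.
move=> Z u v uv.
have fu : f @o (kerm f @o v) = 0 by rewrite compA (kerP f).1 comp0m.
by have [w [_ wP]] := (kerP f).2 Z _ fu; rewrite -(wP u uv) -(wP v erefl).
Qed.

End Factor.

(** * Bounded cochain complexes *)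

(* The differentials are indexed by all pairs of degrees and vanish off the
   pairs (i, i + 1); this avoids transport along equalities of degrees. *)
Record bcomplex (k : fieldType) (C : klin_cat k) := BComplex {
  cob :> int -> C;
  dif : forall i j : int, mor (cob i) (cob j);
  diff_shape : forall i j, j <> i + 1 -> dif i j = 0;
  diffK : forall i j l, dif j l @o dif i j = 0;
  cbounded : exists a b : int, forall i : int,
    (i < a) || (b < i) -> is_zero_ob (cob i)
}.

Arguments dif {k C} X i j : rename.

Record chain_map (k : fieldType) (C : klin_cat k) (X Y : bcomplex C) :=
  ChainMap {
    cmap :> forall i : int, mor (X i) (Y i);
    cmapP : forall i j, cmap j @o dif X i j = dif Y i j @o cmap i
  }.

Section ChainMaps.
Variables (k : fieldType) (C : klin_cat k).
Implicit Types X Y Z : bcomplex C.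

Lemma chain_mapP X Y (f g : chain_map X Y) : (forall i, f i = g i) -> f = g.
Proof.
case: f g => [f fP] [g gP] /= fg.
have {}fg : f = g by apply: functional_extensionality_dep.
by subst g; rewrite (Prop_irrelevance fP gP).
Qed.

HB.instance Definition _ X Y := gen_eqMixin (chain_map X Y).
HB.instance Definition _ X Y := gen_choiceMixin (chain_map X Y).

Lemma chain_zero_subproof X Y i j :
  (0 : mor (X j) (Y j)) @o dif X i j = dif Y i j @o 0.
Proof. by rewrite comp0m compm0. Qed.
Definition chain_zero X Y : chain_map X Y :=
  ChainMap (@chain_zero_subproof X Y).

Lemma chain_scale_subproof X Y (a : k) (f : chain_map X Y) i j :
  (a *: f j) @o dif X i j = dif Y i j @o (a *: f i).
Proof. by rewrite compZl compZr cmapP. Qed.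
Definition chain_scale X Y a (f : chain_map X Y) :=
  ChainMap (chain_scale_subproof a f).

Lemma chain_add_subproof X Y (f g : chain_map X Y) i j :
  (f j + g j) @o dif X i j = dif Y i j @o (f i + g i).
Proof. by rewrite compDl compDr !cmapP. Qed.
Definition chain_add X Y (f g : chain_map X Y) :=
  ChainMap (chain_add_subproof f g).

Lemma chain_addA X Y : associative (@chain_add X Y).
Proof. by move=> f g h; apply: chain_mapP => i /=; rewrite addrA. Qed.
Lemma chain_addC X Y : commutative (@chain_add X Y).
Proof. by move=> f g; apply: chain_mapP => i /=; rewrite addrC. Qed.
Lemma chain_add0 X Y : left_id (chain_zero X Y) (@chain_add X Y).
Proof. by move=> f; apply: chain_mapP => i /=; rewrite add0r. Qed.
Lemma chain_addN X Y :
  left_inverse (chain_zero X Y) (chain_scale (-1)) (@chain_add X Y).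
Proof. by move=> f; apply: chain_mapP => i /=; rewrite scaleN1r addNr. Qed.

HB.instance Definition _ X Y := GRing.isZmodule.Build (chain_map X Y)
  (@chain_addA X Y) (@chain_addC X Y) (@chain_add0 X Y) (@chain_addN X Y).

Lemma chain_scaleA X Y a b (f : chain_map X Y) :
  chain_scale a (chain_scale b f) = chain_scale (a * b) f.
Proof. by apply: chain_mapP => i /=; rewrite scalerA. Qed.
Lemma chain_scale1 X Y : left_id 1 (@chain_scale X Y).
Proof. by move=> f; apply: chain_mapP => i /=; rewrite scale1r. Qed.
Lemma chain_scaleDr X Y : right_distributive (@chain_scale X Y) +%R.
Proof. by move=> a f g; apply: chain_mapP => i /=; rewrite scalerDr. Qed.
Lemma chain_scaleDl X Y (f : chain_map X Y) :
  {morph (@chain_scale X Y)^~ f : a b / a + b}.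
Proof. by move=> a b; apply: chain_mapP => i /=; rewrite scalerDl. Qed.

HB.instance Definition _ X Y :=
  GRing.Zmodule_isLmodule.Build k (chain_map X Y)
    (@chain_scaleA X Y) (@chain_scale1 X Y)
    (@chain_scaleDr X Y) (@chain_scaleDl X Y).

Lemma chain_id_subproof X i j :
  idm (X j) @o dif X i j = dif X i j @o idm (X i).
Proof. by rewrite comp1m compm1. Qed.
Definition chain_id X : chain_map X X := ChainMap (@chain_id_subproof X).

Lemma chain_comp_subproof X Y Z (g : chain_map Y Z) (f : chain_map X Y) i j :
  (g j @o f j) @o dif X i j = dif Z i j @o (g i @o f i).
Proof. by rewrite -compA cmapP compA cmapP compA. Qed.
Definition chain_comp X Y Z (g : chain_map Y Z) (f : chain_map X Y) :=
  ChainMap (chain_comp_subproof g f).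

Definition chain_cat : klin_cat k.
Proof.
refine (@KlinCat k (bcomplex C) (fun X Y => chain_map X Y)
          chain_id chain_comp _ _ _ _ _ _ _).
- by move=> X Y Z T h g f; apply: chain_mapP => i /=; rewrite compA.
- by move=> X Y f; apply: chain_mapP => i /=; rewrite comp1m.
- by move=> X Y f; apply: chain_mapP => i /=; rewrite compm1.
- by move=> X Y Z g g' f; apply: chain_mapP => i /=; rewrite compDl.
- by move=> X Y Z g f f'; apply: chain_mapP => i /=; rewrite compDr.
- by move=> X Y Z a g f; apply: chain_mapP => i /=; rewrite compZl.
- by move=> X Y Z a g f; apply: chain_mapP => i /=; rewrite compZr.
Defined.

End ChainMaps.

(* X[s]^i = X^(i+s), with differential multiplied by (-1)^s *)
Section Shift.
Variables (k : fieldType) (C : klin_cat k) (X : bcomplex C) (s : int).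

Definition shift_diff (i j : int) : mor (X (i + s)) (X (j + s)) :=
  ((-1 : k) ^ s) *: dif X (i + s) (j + s).

Lemma shift_shape i j : j <> i + 1 -> shift_diff i j = 0.
Proof.
move=> ne; rewrite /shift_diff diff_shape ?scaler0 // => e; apply: ne.
by apply: (addIr s); rewrite e addrAC.
Qed.

Lemma shift_diffK i j l : shift_diff j l @o shift_diff i j = 0.
Proof. by rewrite /shift_diff compZl compZr diffK !scaler0. Qed.

Lemma shift_bounded : exists a b : int, forall i : int,
  (i < a) || (b < i) -> is_zero_ob (X (i + s)).
Proof.
have [a [b abP]] := cbounded X; exists (a - s), (b - s) => i ib.
by apply: abP; rewrite -Num.Theory.ltrBrDr -[b < _]Num.Theory.ltrBlDr.
Qed.

Definition cshift : bcomplex C :=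
  @BComplex k C (fun i => X (i + s)) shift_diff
    shift_shape shift_diffK shift_bounded.

End Shift.

(** * Cohomology and quasi-isomorphisms *)

Section Cohomology.
Variables (k : fieldType) (C : abelian_cat k).
Implicit Types X Y : bcomplex C.

Definition cocycle X (i : int) : C := kerob (dif X i (i + 1)).

Definition coboundary X (i : int) : mor (X (i - 1)) (cocycle X i) :=
  ker_lift (diffK X (i - 1) i (i + 1)).

Definition coh X (i : int) : C := cokob (coboundary X i).

Lemma cocycle_map_subproof X Y (f : chain_map X Y) i :
  dif Y i (i + 1) @o (f i @o kerm (dif X i (i + 1))) = 0.
Proof. by rewrite compA -cmapP -compA (kerP _).1 compm0. Qed.

Definition cocycle_map X Y (f : chain_map X Y) i :
  mor (cocycle X i) (cocycle Y i) := ker_lift (cocycle_map_subproof f i).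

Lemma coh_map_subproof X Y (f : chain_map X Y) i :
  (cokm (coboundary Y i) @o cocycle_map f i) @o coboundary X i = 0.
Proof.
suff -> : cokm (coboundary Y i) @o cocycle_map f i @o coboundary X i
        = cokm (coboundary Y i) @o coboundary Y i @o f (i - 1).
  by rewrite (cokP _).1 comp0m.
rewrite -!compA; congr (_ @o _); apply: kerm_mono.
by rewrite !compA !ker_liftK -compA ker_liftK cmapP.
Qed.

Definition coh_map X Y (f : chain_map X Y) i : mor (coh X i) (coh Y i) :=
  cok_desc (coh_map_subproof f i).

Definition quasi_iso X Y (f : chain_map X Y) : Prop :=
  forall i, is_iso (coh_map f i).

End Cohomology.

(** * Localization of a k-linear category *)

(* The k-linear category obtained from [D] by formally inverting the morphisms
   in [W]: morphisms are k-linear expressions in the morphisms of [D] and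
   formal inverses of the elements of [W], modulo the congruence [weq]
   generated by the axioms of a k-linear category, the k-linear functoriality
   of D -> D[W^-1] and the inverse laws.  When [W] is the class of
   quasi-isomorphisms, which admits a calculus of fractions up to homotopy,
   the ordinary localization is already k-linear and agrees with this one. *)
Section Localization.
Variables (k : fieldType) (D : klin_cat k).
Variable W : forall X Y : D, mor X Y -> Prop.

Inductive word : D -> D -> Type :=
| wmap X Y (f : mor X Y) : word X Y
| winv X Y (f : mor X Y) (fW : W f) : word Y X
| wcomp X Y Z (u : word Y Z) (v : word X Y) : word X Z
| wadd X Y (u v : word X Y) : word X Y
| wscale X Y (a : k) (u : word X Y) : word X Y.

Inductive weq : forall X Y : D, word X Y -> word X Y -> Prop :=
| weq_refl X Y (u : word X Y) : weq u u
| weq_sym X Y (u v : word X Y) : weq u v -> weq v u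
| weq_trans X Y (u v w : word X Y) : weq u v -> weq v w -> weq u w
| weq_comp X Y Z (u u' : word Y Z) (v v' : word X Y) :
    weq u u' -> weq v v' -> weq (wcomp u v) (wcomp u' v')
| weq_add X Y (u u' v v' : word X Y) :
    weq u u' -> weq v v' -> weq (wadd u v) (wadd u' v')
| weq_scale X Y a (u u' : word X Y) :
    weq u u' -> weq (wscale a u) (wscale a u')
| weq_compA X Y Z T (u : word Z T) (v : word Y Z) (w : word X Y) :
    weq (wcomp u (wcomp v w)) (wcomp (wcomp u v) w)
| weq_comp1m X Y (u : word X Y) : weq (wcomp (wmap (idm Y)) u) u
| weq_compm1 X Y (u : word X Y) : weq (wcomp u (wmap (idm X))) u
| weq_compDl X Y Z (u u' : word Y Z) (v : word X Y) :
    weq (wcomp (wadd u u') v) (wadd (wcomp u v) (wcomp u' v))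
| weq_compDr X Y Z (u : word Y Z) (v v' : word X Y) :
    weq (wcomp u (wadd v v')) (wadd (wcomp u v) (wcomp u v'))
| weq_compZl X Y Z a (u : word Y Z) (v : word X Y) :
    weq (wcomp (wscale a u) v) (wscale a (wcomp u v))
| weq_compZr X Y Z a (u : word Y Z) (v : word X Y) :
    weq (wcomp u (wscale a v)) (wscale a (wcomp u v))
| weq_addA X Y (u v w : word X Y) :
    weq (wadd u (wadd v w)) (wadd (wadd u v) w)
| weq_addC X Y (u v : word X Y) : weq (wadd u v) (wadd v u)
| weq_add0 X Y (u : word X Y) : weq (wadd (wmap 0) u) u
| weq_addN X Y (u : word X Y) : weq (wadd (wscale (-1) u) u) (wmap 0)
| weq_scaleA X Y a b (u : word X Y) :
    weq (wscale a (wscale b u)) (wscale (a * b) u)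
| weq_scale1 X Y (u : word X Y) : weq (wscale 1 u) u
| weq_scaleDr X Y a (u v : word X Y) :
    weq (wscale a (wadd u v)) (wadd (wscale a u) (wscale a v))
| weq_scaleDl X Y a b (u : word X Y) :
    weq (wscale (a + b) u) (wadd (wscale a u) (wscale b u))
| weq_mapM X Y Z (g : mor Y Z) (f : mor X Y) :
    weq (wmap (g @o f)) (wcomp (wmap g) (wmap f))
| weq_mapD X Y (f g : mor X Y) :
    weq (wmap (f + g)) (wadd (wmap f) (wmap g))
| weq_mapZ X Y a (f : mor X Y) : weq (wmap (a *: f)) (wscale a (wmap f))
| weq_invl X Y (f : mor X Y) (fW : W f) :
    weq (wcomp (winv fW) (wmap f)) (wmap (idm X))
| weq_invr X Y (f : mor X Y) (fW : W f) :
    weq (wcomp (wmap f) (winv fW)) (wmap (idm Y)).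

HB.instance Definition _ X Y := gen_eqMixin (word X Y).
HB.instance Definition _ X Y := gen_choiceMixin (word X Y).

Definition weqb X Y (u v : word X Y) : bool := `[< weq u v >].

Lemma weqb_refl X Y : reflexive (@weqb X Y).
Proof. by move=> u; apply/asboolP; exact: weq_refl. Qed.
Lemma weqb_sym X Y : symmetric (@weqb X Y).
Proof. by move=> u v; apply/asboolP/asboolP; exact: weq_sym. Qed.
Lemma weqb_trans X Y : transitive (@weqb X Y).
Proof.
move=> v u w /asboolP uv /asboolP vw; apply/asboolP.
exact: weq_trans uv vw.
Qed.

Canonical weq_equiv X Y :=
  EquivRel (@weqb X Y) (@weqb_refl X Y) (@weqb_sym X Y) (@weqb_trans X Y).

Definition lmor (X Y : D) := {eq_quot (@weqb X Y)}.
HB.instance Definition _ X Y := Choice.on (lmor X Y).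

Definition lclass X Y (u : word X Y) : lmor X Y := \pi u.

Lemma lclassP X Y (u v : word X Y) : lclass u = lclass v <-> weq u v.
Proof.
split=> [/eqP|uv]; last by apply/eqP; rewrite eqmodE /=; apply/asboolP.
by rewrite eqmodE /= => /asboolP.
Qed.

Lemma reprP X Y (u : word X Y) : weq (repr (lclass u)) u.
Proof. by apply/lclassP; rewrite /lclass reprK. Qed.

Lemma lclassW X Y (P : lmor X Y -> Prop) : (forall u, P (lclass u)) ->
  forall x, P x.
Proof. by move=> h x; rewrite -[x]reprK; exact: h. Qed.

Definition ladd X Y (x y : lmor X Y) : lmor X Y :=
  lclass (wadd (repr x) (repr y)).
Definition lscale X Y a (x : lmor X Y) : lmor X Y :=
  lclass (wscale a (repr x)).
Definition lcomp X Y Z (x : lmor Y Z) (y : lmor X Y) : lmor X Z :=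
  lclass (wcomp (repr x) (repr y)).
Definition lmap X Y (f : mor X Y) : lmor X Y := lclass (wmap f).

Lemma laddE X Y (u v : word X Y) :
  ladd (lclass u) (lclass v) = lclass (wadd u v).
Proof. by apply/lclassP; apply: weq_add; exact: reprP. Qed.
Lemma lscaleE X Y a (u : word X Y) :
  lscale a (lclass u) = lclass (wscale a u).
Proof. by apply/lclassP; apply: weq_scale; exact: reprP. Qed.
Lemma lcompE X Y Z (u : word Y Z) (v : word X Y) :
  lcomp (lclass u) (lclass v) = lclass (wcomp u v).
Proof. by apply/lclassP; apply: weq_comp; exact: reprP. Qed.

Lemma laddA X Y : associative (@ladd X Y).
Proof.
elim/lclassW=> u; elim/lclassW=> v; elim/lclassW=> w.
by rewrite !laddE; apply/lclassP; exact: weq_addA.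
Qed.
Lemma laddC X Y : commutative (@ladd X Y).
Proof.
elim/lclassW=> u; elim/lclassW=> v.
by rewrite !laddE; apply/lclassP; exact: weq_addC.
Qed.
Lemma ladd0 X Y : left_id (lmap (0 : mor X Y)) (@ladd X Y).
Proof.
by elim/lclassW=> u; rewrite laddE; apply/lclassP; exact: weq_add0.
Qed.
Lemma laddN X Y : left_inverse (lmap (0 : mor X Y)) (lscale (-1)) (@ladd X Y).
Proof.
elim/lclassW=> u; rewrite lscaleE laddE.
by apply/lclassP; exact: weq_addN.
Qed.

HB.instance Definition _ X Y := GRing.isZmodule.Build (lmor X Y)
  (@laddA X Y) (@laddC X Y) (@ladd0 X Y) (@laddN X Y).

Lemma laddrE X Y (u v : word X Y) :
  lclass u + lclass v = lclass (wadd u v).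
Proof. exact: laddE. Qed.

Lemma lscaleA X Y a b (x : lmor X Y) :
  lscale a (lscale b x) = lscale (a * b) x.
Proof.
elim/lclassW: x => u; rewrite !lscaleE.
by apply/lclassP; exact: weq_scaleA.
Qed.
Lemma lscale1 X Y : left_id 1 (@lscale X Y).
Proof.
by elim/lclassW=> u; rewrite lscaleE; apply/lclassP; exact: weq_scale1.
Qed.
Lemma lscaleDr X Y : right_distributive (@lscale X Y) +%R.
Proof.
move=> a; elim/lclassW=> u; elim/lclassW=> v.
rewrite (laddrE u v) !lscaleE laddrE.
by apply/lclassP; exact: weq_scaleDr.
Qed.
Lemma lscaleDl X Y (x : lmor X Y) : {morph (@lscale X Y)^~ x : a b / a + b}.
Proof.
move=> a b; elim/lclassW: x => u.
rewrite !lscaleE laddrE.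
by apply/lclassP; exact: weq_scaleDl.
Qed.

HB.instance Definition _ X Y := GRing.Zmodule_isLmodule.Build k (lmor X Y)
  (@lscaleA X Y) (@lscale1 X Y) (@lscaleDr X Y) (@lscaleDl X Y).

Lemma lscalerE X Y a (u : word X Y) :
  a *: lclass u = lclass (wscale a u).
Proof. exact: lscaleE. Qed.

Definition localization : klin_cat k.
Proof.
refine (@KlinCat k (obj D) (fun X Y => lmor X Y)
          (fun X => lmap (idm X)) lcomp _ _ _ _ _ _ _).
- move=> X Y Z T; elim/lclassW=> u; elim/lclassW=> v; elim/lclassW=> w.
  by rewrite !lcompE; apply/lclassP; exact: weq_compA.
- move=> X Y; elim/lclassW=> u.
  by rewrite lcompE; apply/lclassP; exact: weq_comp1m.
- move=> X Y; elim/lclassW=> u.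
  by rewrite lcompE; apply/lclassP; exact: weq_compm1.
- move=> X Y Z; elim/lclassW=> u; elim/lclassW=> u'; elim/lclassW=> v.
  rewrite laddrE !lcompE laddrE.
  by apply/lclassP; exact: weq_compDl.
- move=> X Y Z; elim/lclassW=> u; elim/lclassW=> v; elim/lclassW=> v'.
  rewrite laddrE !lcompE laddrE.
  by apply/lclassP; exact: weq_compDr.
- move=> X Y Z a; elim/lclassW=> u; elim/lclassW=> v.
  rewrite lscalerE !lcompE lscalerE.
  by apply/lclassP; exact: weq_compZl.
- move=> X Y Z a; elim/lclassW=> u; elim/lclassW=> v.
  rewrite lscalerE !lcompE lscalerE.
  by apply/lclassP; exact: weq_compZr.
Defined.

End Localization.

(** * The bounded derived category *)

Section Derived.
Variables (k : fieldType) (C : abelian_cat k).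

(* D^b(C), the localization of bounded complexes at quasi-isomorphisms.
   Homotopic maps become equal in it, so passing through the homotopy category
   first would give the same result. *)
Definition Db : klin_cat k :=
  localization (D := chain_cat C) (@quasi_iso k C).

Lemma conc_shape (A : C) (i j : int) : j <> i + 1 ->
  (0 : mor (if i == 0 then A else zob C) (if j == 0 then A else zob C)) = 0.
Proof. by []. Qed.

Lemma conc_diffK (A : C) (i j l : int) :
  (0 : mor (if j == 0 then A else zob C) (if l == 0 then A else zob C))
    @o (0 : mor (if i == 0 then A else zob C) _) = 0.
Proof. exact: comp0m. Qed.

Lemma conc_bounded (A : C) : exists a b : int, forall i : int,
  (i < a) || (b < i) -> is_zero_ob (if i == 0 then A else zob C).
Proof. by exists 0, 0 => i; case: eqP => [->|_ _] //; exact: zobP. Qed.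

(* [A] as a complex concentrated in degree 0 *)
Definition conc (A : C) : bcomplex C :=
  @BComplex k C (fun i : int => if i == 0 then A else zob C)
    (fun _ _ => 0) (conc_shape A) (conc_diffK A) (conc_bounded A).

Definition Dhom (X Y : bcomplex C) : lmodType k := @mor k Db X Y.

Definition Ext (i : int) (A B : C) : lmodType k :=
  Dhom (conc A) (cshift (conc B) i).

(* RHom(X,Y) is given through its cohomology, the graded vector space
   i |-> Hom(X, Y[i]); over a field this determines it up to isomorphism. *)
Definition RHom (X Y : bcomplex C) (i : int) : lmodType k :=
  Dhom X (cshift Y i).

(* The defining properties of A_n.  In the last clause,
   (k + k[-n-2])^i = k^((i == 0) + (i == n + 2)). *)
Definition is_An (A : C) (n : nat) (X : Db) : Prop :=
  [/\ forall i : int, 0 <= i <= n%:Z -> isomorphic (coh X i) A,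
      forall i : int, ~~ (0 <= i <= n%:Z) -> is_zero_ob (coh X i)
    & forall i : int,
        iso_kpow (RHom (conc A) X i) ((i == 0%Z) + (i == n.+2%:Z))%N].

(* the objects of D^b(C)<A> *)
Definition gen_by (A : C) : set Db :=
  [set X : Db | exists d : int -> nat, forall i, is_power A (d i) (coh X i)].

Definition iso_class (X : Db) : set Db := [set Y : Db | isomorphic X Y].

End Derived.

(* Main.v *)
(** Write [a t] for [A[-t]].  The strings [G n t], with cohomology [A] in
    degrees [t - n], ..., [t], are built by attaching cells at the top:
    [G 0 t = a t], and [G (n + 1) t] is the cone of the essentially unique
    non-zero map [a (t + 1) -> G n (t - 1)].  One computes that
    [RHom (A, G n t)] is one-dimensional in degrees [t - n] and [t + 2] and zero
    elsewhere, so that [G n t] is [A_n] up to a shift; for [m <= n] there is a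
    map [G n t -> G m t] over [a t], which is injective on maps from
    [a (t + 2)].

    An object [B] with top cohomology in degree [m] is the cone of a map
    [phi : a (m + 1) -> B'] where [B'] has one copy of [A] less in its
    cohomology.  By induction [B'] is a direct sum of strings, and [phi] can
    only be non-zero on summands [G n (m - 1)].  Among these choose one with [n]
    maximal: the maps above clear all other components of [phi], and attaching
    the cell to the chosen summand turns it into [G (n + 1) m].  Uniqueness of
    [A_n] follows by comparing [RHom (A, -)] with that of a sum of strings.

    Diagram chases in an abelian category use generalised elements, up to
    epimorphic changes of domain.  In the derived category only the exactness of
    the cone triangles for both variances of [Hom] is used; it rests on the
    calculus of right fractions up to homotopy, in particular on a description
    of the chain maps that vanish in the localization. *)

Require Import Defs.
From HB Require Import structures.
From mathcomp Require Import all_boot all_order all_algebra.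
From mathcomp Require Import boolp classical_sets cardinality.
From mathcomp Require Import zify.
Import Defs.

Set Implicit Arguments.
Unset Strict Implicit.
Unset Printing Implicit Defensive.

Import GRing.Theory.
Local Open Scope ring_scope.
Local Open Scope classical_set_scope.

(** * Linear and abelian categories *)

(** The obstacle is that a cone is functorial only for squares with a chosen homotopy, and no
    completion of morphisms of triangles is set up in the derived category. The one consequence
    required, the comparison of two triangles with the same first vertex [X], survives up to
    non-zero scalars because the endomorphisms of [X = A[-t]] are scalars.

    Numerically, [Hom (a s, a t)] is non-zero only for [s = t] and [s = t + 2]. Attaching the cell
    [a (t + 1)] to [G n (t - 1)] kills the line of maps from [a (t + 1)] and creates one from
    [a (t + 2)]: the degree 2 class of the new cell lifts, as [Hom (a (t + 3), G n (t - 1)) = 0].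
    The bottom class in degree [t - n - 1] is untouched. So each string receives exactly one line of
    maps from [a (t + 2)]; elimination is a comparison of scalars, and no continuous parameters can
    arise.

    The classification is carried out in an abstract category with a shift and cohomology functors;
    the derived category enters it only through a list of exactness properties. *)

Section Klin.
Variables (k : fieldType) (C : klin_cat k).
Implicit Types X Y Z V W : C.

Lemma compNl X Y Z (g : mor Y Z) (f : mor X Y) : (- g) @o f = - (g @o f).
Proof. by rewrite -scaleN1r compZl scaleN1r. Qed.

Lemma compNr X Y Z (g : mor Y Z) (f : mor X Y) : g @o (- f) = - (g @o f).
Proof. by rewrite -scaleN1r compZr scaleN1r. Qed.

Lemma compBl X Y Z (g g' : mor Y Z) (f : mor X Y) :
  (g - g') @o f = g @o f - g' @o f.
Proof. by rewrite compDl compNl. Qed.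

Lemma compBr X Y Z (g : mor Y Z) (f f' : mor X Y) :
  g @o (f - f') = g @o f - g @o f'.
Proof. by rewrite compDr compNr. Qed.

Lemma comp_suml X Y Z (I : finType) (P : pred I) (F : I -> mor Y Z)
    (f : mor X Y) :
  (\sum_(i | P i) F i) @o f = \sum_(i | P i) (F i @o f).
Proof.
by apply: (big_morph (fun g => g @o f)) => [a b|]; rewrite ?compDl ?comp0m.
Qed.

Lemma comp_sumr X Y Z (I : finType) (P : pred I) (g : mor Y Z)
    (F : I -> mor X Y) :
  g @o (\sum_(i | P i) F i) = \sum_(i | P i) (g @o F i).
Proof.
by apply: (big_morph (fun f => g @o f)) => [a b|]; rewrite ?compDr ?compm0.
Qed.

Lemma is_iso_id X : is_iso (idm X).
Proof. by exists (idm X); rewrite comp1m. Qed.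

Lemma is_iso_comp X Y Z (g : mor Y Z) (f : mor X Y) :
  is_iso g -> is_iso f -> is_iso (g @o f).
Proof.
move=> [g' [g'g gg']] [f' [f'f ff']]; exists (f' @o g').
by rewrite !compA -(compA f') g'g compm1 f'f -(compA g) ff' compm1 gg'.
Qed.

Lemma iso_cancell X Y Z (g : mor Y Z) (f f' : mor X Y) :
  is_iso g -> g @o f = g @o f' -> f = f'.
Proof.
move=> [g' [g'g _]] e.
by rewrite -[f]comp1m -[f']comp1m -g'g -!compA e.
Qed.

Lemma iso_cancelr X Y Z (g g' : mor Y Z) (f : mor X Y) :
  is_iso f -> g @o f = g' @o f -> g = g'.
Proof.
move=> [f' [_ ff']] e.
by rewrite -[g]compm1 -[g']compm1 -ff' !compA e.
Qed.

Lemma isomorphic_refl X : isomorphic X X.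
Proof. by exists (idm X); exact: is_iso_id. Qed.

Lemma isomorphic_sym X Y : isomorphic X Y -> isomorphic Y X.
Proof. by move=> [f [g [gf fg]]]; exists g, f. Qed.

Lemma isomorphic_trans X Y Z :
  isomorphic X Y -> isomorphic Y Z -> isomorphic X Z.
Proof.
by move=> [f fi] [g gi]; exists (g @o f); exact: is_iso_comp.
Qed.

Lemma zero_obP X : is_zero_ob X <-> idm X = 0.
Proof.
split=> [[h _]|h]; first exact: h.
by split=> Y f; [rewrite -[f]comp1m h comp0m | rewrite -[f]compm1 h compm0].
Qed.

Lemma zero_ob_retract X Y (i : mor X Y) (p : mor Y X) :
  p @o i = idm X -> is_zero_ob Y -> is_zero_ob X.
Proof. by move=> pi [_ h]; apply/zero_obP; rewrite -pi (h _ p) comp0m. Qed.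

Lemma zero_ob_iso X Y : isomorphic X Y -> is_zero_ob Y -> is_zero_ob X.
Proof. by move=> [f [g [gf _]]]; exact: zero_ob_retract gf. Qed.

Lemma is_iso_scale X Y (f : mor X Y) (a : k) :
  a != 0 -> is_iso f -> is_iso (a *: f).
Proof.
move=> a0 [g [gf fg]]; exists (a^-1 *: g).
by rewrite !compZl !compZr !scalerA mulVf // mulfV // gf fg !scale1r.
Qed.

Section Dsum.
Variable I : finType.
Implicit Types F G : I -> C.

Lemma dsum_transport F G P Q : (forall i, isomorphic (F i) (G i)) ->
  isomorphic P Q -> is_dsum F P -> is_dsum G Q.
Proof.
move=> FG [w [w' [w'w ww']]] [inj [prj [pi pij s]]].
pose u i := projT1 (cid (FG i)).
have ui i : is_iso (u i) by exact: projT2 (cid (FG i)).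
pose v i := projT1 (cid (ui i)).
have [vu uv] : (forall i, v i @o u i = idm (F i)) /\
               (forall i, u i @o v i = idm (G i)).
  by split=> i; have [] := projT2 (cid (ui i)).
exists (fun i => w @o inj i @o v i), (fun i => u i @o prj i @o w'); split.
- move=> i; rewrite !compA -(compA (u i @o prj i)) w'w compm1.
  by rewrite -(compA (u i)) pi compm1 uv.
- move=> i j ij; rewrite !compA -(compA (u j @o prj j)) w'w compm1.
  by rewrite -(compA (u j)) pij // compm0 comp0m.
- rewrite -ww' -[X in _ = X @o w']compm1 -s comp_sumr comp_suml.
  by apply: eq_bigr => i _; rewrite !compA -(compA (w @o inj i)) vu compm1.
Qed.

Lemma dsum_unique F P Q : is_dsum F P -> is_dsum F Q -> isomorphic P Q.
Proof.
move=> [i [p [pi pij s]]] [i' [p' [pi' pij' s']]].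
exists (\sum_x i' x @o p x), (\sum_x i x @o p' x); split.
- rewrite comp_suml -s; apply: eq_bigr => x _.
  rewrite comp_sumr (bigD1 x) //= big1 => [|y /eqP yx].
    by rewrite addr0 !compA -(compA (i x)) pi' compm1.
  by rewrite !compA -(compA (i x)) pij' // compm0 comp0m.
- rewrite comp_suml -s'; apply: eq_bigr => x _.
  rewrite comp_sumr (bigD1 x) //= big1 => [|y /eqP yx].
    by rewrite addr0 !compA -(compA (i' x)) pi compm1.
  by rewrite !compA -(compA (i' x)) pij // compm0 comp0m.
Qed.

Lemma dsum_zero F P : is_dsum F P -> (forall i, is_zero_ob (F i)) ->
  is_zero_ob P.
Proof.
move=> [i [p [_ _ s]]] F0; apply/zero_obP; rewrite -s big1 // => x _.
by rewrite ((F0 x).1 _ (p x)) compm0.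
Qed.

End Dsum.
End Klin.

Section DsumReindex.
Variables (k : fieldType) (C : klin_cat k).
Implicit Types P X : C.

Lemma dsum_reindex (I J : finType) (F : I -> C) (f : J -> I) P :
  bijective f -> is_dsum F P -> is_dsum (fun j => F (f j)) P.
Proof.
move=> fb [i [p [pi pij s]]].
exists (fun j => i (f j)), (fun j => p (f j)); split.
- by move=> j; exact: pi.
- by move=> j j' jj'; apply: pij => /(bij_inj fb).
- by rewrite -s [RHS](reindex f) //; exact: onW_bij.
Qed.

Lemma dsum_card0 (I : finType) (F : I -> C) P :
  #|I| = 0%N -> is_zero_ob P -> is_dsum F P.
Proof.
move=> I0 /zero_obP P0.
have no (i : I) : False by have := card0_eq I0 i; rewrite inE.
exists (fun i => False_rect _ (no i)), (fun i => False_rect _ (no i)).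
by split=> [i|i|]; [case: (no i)..| rewrite P0 big1 // => i; case: (no i)].
Qed.

Lemma dsum_card1 (I : finType) (i0 : I) (F : I -> C) P :
  (forall i, i = i0) -> is_dsum F P -> isomorphic (F i0) P.
Proof.
move=> I1 [i [p [pi _ s]]]; exists (i i0), (p i0); split=> //.
by rewrite -s (bigD1 i0) //= big1 ?addr0 // => j /eqP; rewrite (I1 j).
Qed.

Lemma power0 X P : is_power X 0 P <-> is_zero_ob P.
Proof.
split=> [[i [p [_ _ s]]]|]; last by apply: dsum_card0; rewrite card_ord.
by apply/zero_obP; rewrite -s big_ord0.
Qed.

Lemma power1 X P : isomorphic X P -> is_power X 1 P.
Proof.
move=> [f [g [gf fg]]]; exists (fun=> f), (fun=> g); split=> //.
- by move=> i j; rewrite [i]ord1 [j]ord1.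
- by rewrite big_ord1.
Qed.

Lemma power_iso X d P Q : isomorphic P Q -> is_power X d P -> is_power X d Q.
Proof. by apply: dsum_transport => i; exact: isomorphic_refl. Qed.

Lemma power_gt0_nonzero X d P :
  idm X != 0 -> is_power X d.+1 P -> ~ is_zero_ob P.
Proof.
move=> /eqP X0 [i [p [pi _ _]]] [_ P0]; apply: X0.
by rewrite -(pi ord0) (P0 _ (p ord0)) comp0m.
Qed.

Lemma kernel_power X d P : is_power X d.+1 P ->
  exists2 r : mor P X, (forall x : mor X X, exists y, r @o y = x) &
  forall (K : C) (i : mor K P), is_kernel r i -> is_power X d K.
Proof.
move=> [i [p [pi pij s]]]; exists (p ord0).
  by move=> x; exists (i ord0 @o x); rewrite compA pi comp1m.
move=> K m [rm0 mP].
have mm (V : C) (u v : mor V K) : m @o u = m @o v -> u = v.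
  move=> e; have ru : p ord0 @o (m @o v) = 0 by rewrite compA rm0 comp0m.
  by have [w [_ wP]] := mP V _ ru; rewrite -(wP u e) -(wP v erefl).
have ri j : p ord0 @o i (lift ord0 j) = 0.
  by apply: pij => /eqP; rewrite eq_sym (negbTE (neq_lift _ _)).
have [l lE] : exists l : forall j : 'I_d, mor X K,
    forall j, m @o l j = i (lift ord0 j).
  exists (fun j => projT1 (cid (mP _ _ (ri j)))) => j.
  by case: (cid _) => /= u [].
exists l, (fun j => p (lift ord0 j) @o m); split.
- by move=> j; rewrite -compA lE pi.
- move=> j j' jj'; rewrite -compA lE pij // => /lift_inj; exact: jj'.
- apply: mm; rewrite comp_sumr compm1 -[RHS]comp1m -s big_ord_recl compDl.
  rewrite -compA rm0 compm0 add0r comp_suml.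
  by apply: eq_bigr => j _; rewrite !compA lE.
Qed.

End DsumReindex.

Section Abelian.
Variables (k : fieldType) (C : abelian_cat k).
Implicit Types X Y Z V W : C.

Lemma epiP X Y (p : mor X Y) :
  (forall Z (u : mor Y Z), u @o p = 0 -> u = 0) -> is_epi p.
Proof.
move=> h Z u v e; apply/eqP; rewrite -subr_eq0; apply/eqP/h.
by rewrite compBl e subrr.
Qed.

Lemma monoP X Y (p : mor X Y) :
  (forall Z (u : mor Z X), p @o u = 0 -> u = 0) -> is_mono p.
Proof.
move=> h Z u v e; apply/eqP; rewrite -subr_eq0; apply/eqP/h.
by rewrite compBr e subrr.
Qed.

Lemma epi0 X Y Z (p : mor X Y) (u : mor Y Z) : is_epi p -> u @o p = 0 -> u = 0.
Proof. by move=> pe e; apply: pe; rewrite e comp0m. Qed.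

Lemma mono0 X Y Z (p : mor Y Z) (u : mor X Y) :
  is_mono p -> p @o u = 0 -> u = 0.
Proof. by move=> pm e; apply: pm; rewrite e compm0. Qed.

Lemma epi_id X : is_epi (idm X).
Proof. by move=> Z u v; rewrite !compm1. Qed.

Lemma epi_comp X Y Z (g : mor Y Z) (f : mor X Y) :
  is_epi g -> is_epi f -> is_epi (g @o f).
Proof. by move=> ge fe W u v; rewrite !compA => /fe /ge. Qed.

Lemma epi_compl X Y Z (g : mor Y Z) (f : mor X Y) :
  is_epi (g @o f) -> is_epi g.
Proof. by move=> h W u v e; apply: h; rewrite !compA e. Qed.

Lemma cokm_epi X Y (f : mor X Y) : is_epi (cokm f).
Proof.
move=> Z u v e.
have uf : (v @o cokm f) @o f = 0 by rewrite -compA (cokP f).1 compm0.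
by have [w [_ wP]] := (cokP f).2 Z _ uf; rewrite -(wP u e) -(wP v erefl).
Qed.

Lemma mono_epi_iso X Y (f : mor X Y) : is_mono f -> is_epi f -> is_iso f.
Proof.
move=> fm /epi_cokernel [Z [g [fg0 gP]]].
have g0 : g = 0 by apply: fm; rewrite fg0 compm0.
have [u [uf _]] : exists! u, u @o f = idm X.
  by apply: gP; rewrite g0 compm0.
exists u; split=> //.
have uf' : (f @o u - idm Y) @o f = 0.
  by rewrite compBl -compA uf compm1 comp1m subrr.
have [w [_ wP]] : exists! w : mor Y Y, w @o f = f.
  by apply: gP; rewrite fg0.
rewrite -(wP (idm Y)) ?comp1m //; symmetry; apply: wP.
by rewrite -compA uf compm1.
Qed.

(** [W] is the pullback, the kernel of [t = y qV - p qX] on the biproduct. As [t] is epi, it is a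
    cokernel; a map [u] killing the projection of [W] to [V] gives [u qV = w t]. Restriction to [X]
    yields [w p = 0], so [w] and then [u] vanish. *)
Lemma pullback_epi X Y V (p : mor X Y) (y : mor V Y) : is_epi p ->
  exists W (e : mor W V) (x : mor W X), is_epi e /\ p @o x = y @o e.
Proof.
move=> pe; have [P [i [q [qi qij s]]]] := dsum_ex V X.
pose iV : mor V P := i true; pose iX : mor X P := i false.
pose qV : mor P V := q true; pose qX : mor P X := q false.
have qVV : qV @o iV = idm V by exact: (qi true).
have qXX : qX @o iX = idm X by exact: (qi false).
have qVX : qV @o iX = 0 by exact: (qij false true).
have qXV : qX @o iV = 0 by exact: (qij true false).
pose t := y @o qV - p @o qX.
have tX : t @o iX = - p by rewrite compBl -!compA qVX qXX compm0 compm1 sub0r.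
have tV : t @o iV = y by rewrite compBl -!compA qVV qXV compm0 compm1 subr0.
have te : is_epi t.
  apply: epiP => Z u ut; apply: (epi0 pe).
  by apply/eqP; rewrite -oppr_eq0 -compNr -tX compA ut comp0m.
exists (kerob t), (qV @o kerm t), (qX @o kerm t); split; last first.
  apply/eqP; rewrite eq_sym -subr_eq0 !compA -compBl; apply/eqP.
  exact: (kerP t).1.
apply: epiP => Z u uk.
have [Z' [g [tg0 gP]]] := epi_cokernel te.
have [h [gh _]] := (kerP t).2 _ g tg0.
have [w [wt _]] : exists! w, w @o t = u @o qV.
  by apply: gP; rewrite -gh compA -(compA u) uk comp0m.
have w0 : w = 0.
  apply: (epi0 pe); apply/eqP; rewrite -oppr_eq0 -compNr -tX compA wt.
  by rewrite -compA qVX compm0.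
by rewrite -[u]compm1 -qVV compA -wt w0 !comp0m.
Qed.

(** [y] factors through the image [i = ker (coker f)], and the corestriction [p] of [f] to it is
    epi, so a pullback along [p] gives the lift. If [u p = 0], then [f] factors through the
    subobject [ker u] of the image; this is the kernel of some [g], and [g f = 0] forces [g i = 0],
    so [ker u] is the whole image. *)
Lemma cok_lift X Y V (f : mor X Y) (y : mor V Y) : cokm f @o y = 0 ->
  exists W (e : mor W V) (x : mor W X), is_epi e /\ f @o x = y @o e.
Proof.
move=> y0; pose i := kerm (cokm f).
pose p : mor X _ := ker_lift (cokP f).1.
have ip : i @o p = f by exact: ker_liftK.
have im : is_mono i by exact: kerm_mono.
have [Y' [iy _]] := (kerP (cokm f)).2 _ y y0.
have pe : is_epi p.
  apply: epiP => Z u up; pose kk := kerm u.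
  have [p' [kp' _]] := (kerP u).2 _ p up.
  have ikm : is_mono (i @o kk).
    by move=> T a b; rewrite -!compA => /im /kerm_mono.
  have [Q [g [gik gP]]] := mono_kernel ikm.
  have gf : g @o f = 0 by rewrite -ip -kp' !compA -(compA g) gik comp0m.
  have gi : g @o i = 0.
    by rewrite -(cok_descK gf) -compA (kerP (cokm f)).1 compm0.
  have [r [ikr _]] := gP _ i gi.
  have kr : kk @o r = idm _ by apply: im; rewrite compA ikr compm1.
  by rewrite -[u]compm1 -kr compA (kerP u).1 comp0m.
have [W [e [x [ee px]]]] := pullback_epi Y' pe.
by exists W, e, x; split=> //; rewrite -ip -compA px compA -[y]iy.
Qed.

(** Exactness at [Y] for generalised elements: lifts are asked for only after an epimorphic change
    of domain. *)
Definition lexact X Y Z (f : mor X Y) (g : mor Y Z) : Prop :=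
  g @o f = 0 /\ forall V (y : mor V Y), g @o y = 0 ->
    exists W (e : mor W V) (x : mor W X), is_epi e /\ f @o x = y @o e.

Lemma lexact_mono X Y Z (f : mor X Y) (g : mor Y Z) :
  lexact f g -> f = 0 -> is_mono g.
Proof.
move=> [_ fg] f0; apply: monoP => V y /fg [W [e [x [ee]]]].
by rewrite f0 comp0m => /esym /(epi0 ee).
Qed.

Lemma lexact_epi X Y Z (f : mor X Y) (g : mor Y Z) :
  lexact f g -> g = 0 -> is_epi f.
Proof.
move=> [_ fg] g0; have [|W [e [x [ee fx]]]] := fg _ (idm Y).
  by rewrite g0 comp0m.
by apply: (@epi_compl _ _ _ _ x); rewrite fx comp1m.
Qed.

(** The local lift becomes global because [f], being mono, is a kernel of some [h], and [h y = 0]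
    can be tested after an epimorphism. *)
Lemma lexact_kernel X Y Z (f : mor X Y) (g : mor Y Z) :
  lexact f g -> is_mono f -> is_kernel g f.
Proof.
move=> [gf fg] fm; split=> // V y gy.
have [Q [h [hf hP]]] := mono_kernel fm.
apply: (hP V y); have [W [e [x [ee fx]]]] := fg _ _ gy.
by apply: (epi0 ee); rewrite -compA -fx compA hf comp0m.
Qed.

Lemma is_isoP X Y (f : mor X Y) :
  (forall V (x : mor V X), f @o x = 0 -> x = 0) ->
  (forall V (y : mor V Y), exists W (e : mor W V) (x : mor W X),
     is_epi e /\ f @o x = y @o e) ->
  is_iso f.
Proof.
move=> fi fs; apply: mono_epi_iso; first exact: monoP.
have [W [e [x [ee fx]]]] := fs _ (idm Y).
by apply: (@epi_compl _ _ _ _ x); rewrite fx comp1m.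
Qed.

Lemma iso_epi X Y (f : mor X Y) : is_iso f -> is_epi f.
Proof. by move=> fi Z u v; exact: iso_cancelr. Qed.

Lemma five_iso X1 X2 X3 X4 X5 Y1 Y2 Y3 Y4 Y5
    (f1 : mor X1 X2) (f2 : mor X2 X3) (f3 : mor X3 X4) (f4 : mor X4 X5)
    (g1 : mor Y1 Y2) (g2 : mor Y2 Y3) (g3 : mor Y3 Y4) (g4 : mor Y4 Y5)
    (m1 : mor X1 Y1) (m2 : mor X2 Y2) (m3 : mor X3 Y3) (m4 : mor X4 Y4)
    (m5 : mor X5 Y5) :
  lexact f1 f2 -> lexact f2 f3 -> lexact f3 f4 ->
  lexact g1 g2 -> lexact g2 g3 -> lexact g3 g4 ->
  m2 @o f1 = g1 @o m1 -> m3 @o f2 = g2 @o m2 ->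
  m4 @o f3 = g3 @o m3 -> m5 @o f4 = g4 @o m4 ->
  is_iso m1 -> is_iso m2 -> is_iso m4 -> is_iso m5 -> is_iso m3.
Proof.
move=> [f21 _] [_ ef2] [_ ef3] [_ eg1] [_ eg2] [g43 _] s1 s2 s3 s4.
move=> [n1 [_ mn1]] [n2 [nm2 mn2]] [n4 [nm4 mn4]] i5.
apply: is_isoP => [V x mx|V y].
- have f3x : f3 @o x = 0.
    by rewrite -[LHS]comp1m -nm4 -compA (compA m4) s3 -compA mx !compm0.
  have [W [e [w [ee fw]]]] := ef2 _ _ f3x.
  have gm : g2 @o (m2 @o w) = 0 by rewrite compA -s2 -compA fw compA mx comp0m.
  have [W' [e' [v [ee' gv]]]] := eg1 _ _ gm.
  apply: (epi0 (epi_comp ee ee')); rewrite compA -fw -compA.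
  suff -> : w @o e' = f1 @o (n1 @o v) by rewrite compA f21 comp0m.
  rewrite -[LHS]comp1m -nm2 -compA (compA m2) -gv -[v in LHS]comp1m -mn1.
  by rewrite (compA g1) (compA g1) -s1 -!compA (compA n2) nm2 comp1m.
- have f4z : f4 @o (n4 @o (g3 @o y)) = 0.
    by apply: (iso_cancell i5); rewrite compA s4 -!compA (compA m4) mn4 comp1m
       compA g43 comp0m compm0.
  have [W [e [x [ee fx]]]] := ef3 _ _ f4z.
  have gy : g3 @o (y @o e - m3 @o x) = 0.
    rewrite compBr (compA g3 m3) -s3 -(compA m4) fx -!compA (compA m4) mn4.
    by rewrite comp1m subrr.
  have [W' [e' [w [ee' gw]]]] := eg2 _ _ gy.
  exists W', (e @o e'), (x @o e' + f2 @o (n2 @o w)); split.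
    exact: epi_comp.
  rewrite compDr !compA s2 -(compA g2) mn2 compm1 gw compBl.
  by rewrite addrC subrK.
Qed.

End Abelian.

(** * Complexes, homotopies and cones *)

Section Transport.
Variables (k : fieldType) (C : klin_cat k).
Implicit Types F : int -> C.

(* The identity when [i = j], and the junk value 0 otherwise. *)
Definition tr F (i j : int) : mor (F i) (F j) :=
  match @eqP _ i j with
  | ReflectT e => ecast z (mor (F i) (F z)) e (idm (F i))
  | ReflectF _ => 0
  end.

Lemma tr_id F i : tr F i i = idm (F i).
Proof. by rewrite /tr; case: eqP => // e; rewrite (eq_irrelevance e erefl). Qed.

Lemma tr_neq F i j : i <> j -> tr F i j = 0.
Proof. by rewrite /tr; case: eqP. Qed.

Lemma tr_tr_id F i j : i = j -> tr F j i @o tr F i j = idm _.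
Proof. by move=> ->; rewrite !tr_id comp1m. Qed.

Lemma tr_dif (X : bcomplex C) i j l : j = l -> tr X j l @o dif X i j = dif X i l.
Proof. by move=> ->; rewrite tr_id comp1m. Qed.

Lemma dif_tr (X : bcomplex C) i j l : i = j -> dif X j l @o tr X i j = dif X i l.
Proof. by move=> ->; rewrite tr_id compm1. Qed.

Lemma tr_nat (F G : int -> C) (f : forall i, mor (F i) (G i)) i j :
  f j @o tr F i j = tr G i j @o f i.
Proof.
case: (i =P j) => [<-|ij]; first by rewrite !tr_id compm1 comp1m.
by rewrite !tr_neq // comp0m compm0.
Qed.

End Transport.

Section Homotopy.
Variables (k : fieldType) (C : klin_cat k).
Implicit Types X Y Z W : bcomplex C.

(** Null-homotopy. As for differentials, [h] is indexed by all pairs of degrees; only the components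
    lowering the degree by one enter. Quantifying over [a] and [b] avoids casts along
    [i - 1 + 1 = i]. *)
Definition null X Y (f : chain_map X Y) : Prop :=
  exists h : forall i j : int, mor (X i) (Y j), forall i a b,
    a + 1 = i -> i + 1 = b -> f i = dif Y a i @o h i a + h b i @o dif X i b.

Lemma null0 X Y : null (0 : chain_map X Y).
Proof.
by exists (fun _ _ => 0) => i a b _ _; rewrite comp0m compm0 addr0.
Qed.

Lemma nullD X Y (f g : chain_map X Y) : null f -> null g -> null (f + g).
Proof.
move=> [h hP] [l lP]; exists (fun i j => h i j + l i j) => i a b ai bi /=.
by rewrite (hP i a b) // (lP i a b) // compDl compDr addrACA.
Qed.

Lemma nullZ X Y c (f : chain_map X Y) : null f -> null (c *: f).
Proof.
move=> [h hP]; exists (fun i j => c *: h i j) => i a b ai bi /=.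
by rewrite (hP i a b) // compZl compZr scalerDr.
Qed.

Lemma nullN X Y (f : chain_map X Y) : null f -> null (- f).
Proof. by move=> fn; rewrite -scaleN1r; exact: nullZ. Qed.

Lemma null_compl X Y Z (g : chain_map Y Z) (f : chain_map X Y) :
  null f -> null (chain_comp g f).
Proof.
move=> [h hP]; exists (fun i j => g j @o h i j) => i a b ai bi /=.
by rewrite (hP i a b) // compDr !compA cmapP.
Qed.

Lemma null_compr X Y Z (g : chain_map Y Z) (f : chain_map X Y) :
  null g -> null (chain_comp g f).
Proof.
move=> [h hP]; exists (fun i j => h i j @o f i) => i a b ai bi /=.
by rewrite (hP i a b) // compDl -!compA cmapP.
Qed.

Lemma chain0E X Y i : (0 : chain_map X Y) i = 0.
Proof. by []. Qed.
Lemma chainDE X Y (f g : chain_map X Y) i : (f + g) i = f i + g i.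
Proof. by []. Qed.
Lemma chainNE X Y (f : chain_map X Y) i : (- f) i = - f i.
Proof. exact: scaleN1r. Qed.
Lemma chainBE X Y (f g : chain_map X Y) i : (f - g) i = f i - g i.
Proof. by rewrite chainDE chainNE. Qed.
Lemma chainCE X Y Z (g : chain_map Y Z) (f : chain_map X Y) i :
  chain_comp g f i = g i @o f i.
Proof. by []. Qed.

(* The commutation with the differentials only has content in consecutive
   degrees. *)
Lemma chain_map_ex X Y (f : forall i, mor (X i) (Y i)) :
  (forall i j, i + 1 = j -> f j @o dif X i j = dif Y i j @o f i) ->
  exists g : chain_map X Y, forall i, g i = f i.
Proof.
move=> fP; have gP i j : f j @o dif X i j = dif Y i j @o f i.
  have [/esym/fP //|ne] := eqVneq j (i + 1).
  by rewrite !diff_shape ?comp0m ?compm0 //; apply/eqP.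
by exists (ChainMap gP).
Qed.

End Homotopy.

Section Shift.
Variables (k : fieldType) (C : klin_cat k).
Implicit Types X Y Z W : bcomplex C.

Lemma cshift_map_subproof X Y (f : chain_map X Y) s i j :
  f (j + s) @o dif (cshift X s) i j = dif (cshift Y s) i j @o f (i + s).
Proof. by rewrite /= /shift_diff compZl compZr cmapP. Qed.
Definition cshift_map X Y (f : chain_map X Y) s :
    chain_map (cshift X s) (cshift Y s) :=
  @ChainMap k C (cshift X s) (cshift Y s) (fun i => f (i + s))
    (cshift_map_subproof f s).

Lemma cshift_map_null X Y (f : chain_map X Y) s : null f -> null (cshift_map f s).
Proof.
(* The sign on [h] cancels the sign of the shifted differentials. *)
move=> [h hP]; exists (fun i j => (-1) ^ s *: h (i + s) (j + s)) => i a b ai bi.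
rewrite /= (hP (i + s) (a + s) (b + s)) /shift_diff; [|lia|lia].
rewrite !compZl !compZr !scalerA -expfzMl mulrNN mulr1 exp1rz.
by rewrite !scale1r.
Qed.

Lemma sgn_add (s t : int) : (-1 : k) ^ t * (-1) ^ s = (-1) ^ (s + t).
Proof. by rewrite -expfzDr ?oppr_eq0 ?oner_eq0 // addrC. Qed.

(** The degrees [i + t + s] and [i + (s + t)] are equal but not convertible, so the comparison map
    is a transport rather than an identity. *)
Lemma shift_add_subproof X s t i j :
  tr X (j + t + s) (j + (s + t)) @o dif (cshift (cshift X s) t) i j
    = dif (cshift X (s + t)) i j @o tr X (i + t + s) (i + (s + t)).
Proof.
rewrite /= /shift_diff /= /shift_diff scalerA compZl compZr sgn_add.
by rewrite dif_tr 1?tr_dif //; lia.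
Qed.
Definition shift_add X s t : chain_map (cshift (cshift X s) t) (cshift X (s + t)) :=
  @ChainMap k C (cshift (cshift X s) t) (cshift X (s + t))
    (fun i => tr X (i + t + s) (i + (s + t))) (@shift_add_subproof X s t).

Lemma shift_addV_subproof X s t i j :
  tr X (j + (s + t)) (j + t + s) @o dif (cshift X (s + t)) i j
    = dif (cshift (cshift X s) t) i j @o tr X (i + (s + t)) (i + t + s).
Proof.
rewrite /= /shift_diff /= /shift_diff scalerA compZl compZr sgn_add.
by rewrite dif_tr 1?tr_dif //; lia.
Qed.
Definition shift_addV X s t : chain_map (cshift X (s + t)) (cshift (cshift X s) t) :=
  @ChainMap k C (cshift X (s + t)) (cshift (cshift X s) t)
    (fun i => tr X (i + (s + t)) (i + t + s)) (@shift_addV_subproof X s t).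

Lemma shift_addK X s t : chain_comp (shift_addV X s t) (shift_add X s t) = chain_id _.
Proof. by apply: chain_mapP => i /=; rewrite tr_tr_id //; lia. Qed.
Lemma shift_addVK X s t : chain_comp (shift_add X s t) (shift_addV X s t) = chain_id _.
Proof. by apply: chain_mapP => i /=; rewrite tr_tr_id //; lia. Qed.

Lemma shift_add_nat X Y (f : chain_map X Y) s t :
  chain_comp (cshift_map f (s + t)) (shift_add X s t)
    = chain_comp (shift_add Y s t) (cshift_map (cshift_map f s) t).
Proof. by apply: chain_mapP => i /=; rewrite tr_nat. Qed.

Lemma shift_zero_subproof X i j :
  tr X (j + 0) j @o dif (cshift X 0) i j = dif X i j @o tr X (i + 0) i.
Proof.
by rewrite /= /shift_diff expr0z scale1r dif_tr ?tr_dif // addr0.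
Qed.
Definition shift_zero X : chain_map (cshift X 0) X :=
  @ChainMap k C (cshift X 0) X (fun i => tr X (i + 0) i) (@shift_zero_subproof X).

Lemma shift_zeroV_subproof X i j :
  tr X j (j + 0) @o dif X i j = dif (cshift X 0) i j @o tr X i (i + 0).
Proof.
by rewrite /= /shift_diff expr0z scale1r dif_tr ?tr_dif // addr0.
Qed.
Definition shift_zeroV X : chain_map X (cshift X 0) :=
  @ChainMap k C X (cshift X 0) (fun i => tr X i (i + 0)) (@shift_zeroV_subproof X).

Lemma shift_zeroK X : chain_comp (shift_zeroV X) (shift_zero X) = chain_id _.
Proof. by apply: chain_mapP => i /=; rewrite tr_tr_id //; lia. Qed.
Lemma shift_zeroVK X : chain_comp (shift_zero X) (shift_zeroV X) = chain_id _.
Proof. by apply: chain_mapP => i /=; rewrite tr_tr_id //; lia. Qed.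

Lemma shift_zero_nat X Y (f : chain_map X Y) :
  chain_comp f (shift_zero X) = chain_comp (shift_zero Y) (cshift_map f 0).
Proof. by apply: chain_mapP => i /=; rewrite tr_nat. Qed.

Lemma cshift_mapB X Y (f g : chain_map X Y) s :
  cshift_map (f - g) s = cshift_map f s - cshift_map g s.
Proof. by apply: chain_mapP => i; rewrite chainBE /= scaleN1r. Qed.

Lemma cshift_mapC X Y Z (g : chain_map Y Z) (f : chain_map X Y) s :
  cshift_map (chain_comp g f) s = chain_comp (cshift_map g s) (cshift_map f s).
Proof. exact: chain_mapP. Qed.

End Shift.

Section Biproduct.
Variables (k : fieldType) (C : abelian_cat k).
Implicit Types X Y Z : C.

(** The family over [bool] of [dsum_ex] unfolded into named components, so that one biproduct can be
    chosen for every pair. *)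
Record biproduct X Y := Biproduct {
  bpo : C;
  bpi1 : mor X bpo; bpi2 : mor Y bpo; bpp1 : mor bpo X; bpp2 : mor bpo Y;
  bpP : [/\ bpp1 @o bpi1 = idm X, bpp2 @o bpi2 = idm Y, bpp1 @o bpi2 = 0,
            bpp2 @o bpi1 = 0 & bpi1 @o bpp1 + bpi2 @o bpp2 = idm bpo]
}.

Lemma biproduct_ex X Y : exists _ : biproduct X Y, True.
Proof.
have [P [i [p [pi pij s]]]] := dsum_ex X Y.
suff PP : [/\ p true @o i true = idm X, p false @o i false = idm Y,
    p true @o i false = 0, p false @o i true = 0
    & i true @o p true + i false @o p false = idm P].
  by exists (Biproduct PP).
split.
- exact: (pi true).
- exact: (pi false).
- exact: (pij false true).
- exact: (pij true false).
- by rewrite -s big_bool.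
Qed.

Definition biprod X Y : biproduct X Y := projT1 (cid (biproduct_ex X Y)).
Definition bip X Y : C := bpo (biprod X Y).
Definition bi1 X Y : mor X (bip X Y) := bpi1 (biprod X Y).
Definition bi2 X Y : mor Y (bip X Y) := bpi2 (biprod X Y).
Definition bp1 X Y : mor (bip X Y) X := bpp1 (biprod X Y).
Definition bp2 X Y : mor (bip X Y) Y := bpp2 (biprod X Y).

Lemma bp1i1 X Y : bp1 X Y @o bi1 X Y = idm X.
Proof. by case: (bpP (biprod X Y)). Qed.
Lemma bp2i2 X Y : bp2 X Y @o bi2 X Y = idm Y.
Proof. by case: (bpP (biprod X Y)). Qed.
Lemma bp1i2 X Y : bp1 X Y @o bi2 X Y = 0.
Proof. by case: (bpP (biprod X Y)). Qed.
Lemma bp2i1 X Y : bp2 X Y @o bi1 X Y = 0.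
Proof. by case: (bpP (biprod X Y)). Qed.
Lemma bip_sum X Y : bi1 X Y @o bp1 X Y + bi2 X Y @o bp2 X Y = idm (bip X Y).
Proof. by case: (bpP (biprod X Y)). Qed.

Definition bpair X Y Z (f : mor Z X) (g : mor Z Y) : mor Z (bip X Y) :=
  bi1 X Y @o f + bi2 X Y @o g.
Definition bcopair X Y Z (f : mor X Z) (g : mor Y Z) : mor (bip X Y) Z :=
  f @o bp1 X Y + g @o bp2 X Y.

Lemma bp1_pair X Y Z (f : mor Z X) (g : mor Z Y) : bp1 X Y @o bpair f g = f.
Proof. by rewrite compDr !compA bp1i1 bp1i2 comp1m comp0m addr0. Qed.
Lemma bp2_pair X Y Z (f : mor Z X) (g : mor Z Y) : bp2 X Y @o bpair f g = g.
Proof. by rewrite compDr !compA bp2i1 bp2i2 comp1m comp0m add0r. Qed.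
Lemma bcopair_i1 X Y Z (f : mor X Z) (g : mor Y Z) : bcopair f g @o bi1 X Y = f.
Proof. by rewrite compDl -!compA bp1i1 bp2i1 compm1 compm0 addr0. Qed.
Lemma bcopair_i2 X Y Z (f : mor X Z) (g : mor Y Z) : bcopair f g @o bi2 X Y = g.
Proof. by rewrite compDl -!compA bp2i2 bp1i2 compm1 compm0 add0r. Qed.

Lemma bcopair_pair X Y Z W (f : mor X Z) (g : mor Y Z) (a : mor W X)
  (b : mor W Y) : bcopair f g @o bpair a b = f @o a + g @o b.
Proof. by rewrite compDl -!compA bp1_pair bp2_pair. Qed.

Lemma bpair_ext X Y Z (u v : mor Z (bip X Y)) :
  bp1 X Y @o u = bp1 X Y @o v -> bp2 X Y @o u = bp2 X Y @o v -> u = v.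
Proof.
move=> e1 e2; rewrite -[u]comp1m -[v]comp1m -bip_sum !compDl -!compA.
by rewrite e1 e2.
Qed.

Lemma bcopair_ext X Y Z (u v : mor (bip X Y) Z) :
  u @o bi1 X Y = v @o bi1 X Y -> u @o bi2 X Y = v @o bi2 X Y -> u = v.
Proof.
move=> e1 e2; rewrite -[u]compm1 -[v]compm1 -bip_sum !compDr !compA.
by rewrite e1 e2.
Qed.

Lemma bip_zero X Y : is_zero_ob X -> is_zero_ob Y -> is_zero_ob (bip X Y).
Proof.
move=> [X0 _] [Y0 _]; apply/zero_obP.
by apply: bpair_ext; rewrite ?(X0 _ (_ @o idm _)) ?(Y0 _ (_ @o idm _)) compm0.
Qed.

End Biproduct.

(** * Mapping cones and their rotation *)

Section Cone.
Variables (k : fieldType) (C : abelian_cat k).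
Implicit Types X Y Z W : bcomplex C.

Section ConeDef.
Variables (X Y : bcomplex C) (f : chain_map X Y).

Definition cone_ob (i : int) : C := bip (X (i + 1)) (Y i).

(** The matrix with rows [(-dX, 0)] and [(f, dY)]. The transport vanishes unless [j = i + 1], so
    this formula has the right shape for all pairs of degrees. *)
Definition cone_dif (i j : int) : mor (cone_ob i) (cone_ob j) :=
  bcopair (bpair (- dif X (i + 1) (j + 1)) (f j @o tr X (i + 1) j))
          (bi2 _ _ @o dif Y i j).

Lemma cone_difE1 i j : bp1 _ _ @o cone_dif i j = - dif X (i + 1) (j + 1) @o bp1 _ _.
Proof.
by rewrite compDr !compA bp1_pair bp1i2 !comp0m addr0.
Qed.

Lemma cone_difE2 i j : bp2 _ _ @o cone_dif i j =
  f j @o tr X (i + 1) j @o bp1 _ _ + dif Y i j @o bp2 _ _.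
Proof. by rewrite compDr !compA bp2_pair bp2i2 comp1m. Qed.

Lemma cone_shape i j : j <> i + 1 -> cone_dif i j = 0.
Proof.
move=> ne; apply: bpair_ext; rewrite compm0 ?cone_difE1 ?cone_difE2.
  by rewrite diff_shape ?oppr0 ?comp0m // => e; apply: ne; lia.
by rewrite tr_neq 1?diff_shape ?compm0 ?comp0m ?addr0 // => e; apply: ne.
Qed.

Lemma cone_difK i j l : cone_dif j l @o cone_dif i j = 0.
Proof.
have [ji|/eqP ne] := eqVneq j (i + 1); last by rewrite (cone_shape ne) compm0.
have [lj|/eqP ne] := eqVneq l (j + 1); last by rewrite (cone_shape ne) comp0m.
subst l j; apply: bpair_ext; rewrite compm0 compA.
  by rewrite cone_difE1 -compA cone_difE1 !compNl compNr opprK compA diffK comp0m.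
rewrite cone_difE2 compDl -!compA cone_difE1 cone_difE2 compDr !tr_id.
by rewrite !comp1m !(compA (dif _ _ _)) diffK comp0m addr0 compNl compNr compA
  compm1 cmapP addNr.
Qed.

Lemma cone_bounded : exists a b : int, forall i : int,
  (i < a) || (b < i) -> is_zero_ob (cone_ob i).
Proof.
have [a [b abP]] := cbounded X; have [a' [b' abP']] := cbounded Y.
exists (- (`|a| + `|a'| + 1)), (`|b| + `|b'| + 1) => i ib.
by apply: bip_zero; [apply: abP | apply: abP']; lia.
Qed.

Definition cone : bcomplex C := BComplex cone_shape cone_difK cone_bounded.

Lemma cone_in_subproof i j :
  bi2 (X (j + 1)) (Y j) @o dif Y i j = dif cone i j @o bi2 (X (i + 1)) (Y i).
Proof. by rewrite /= bcopair_i2. Qed.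
Definition cone_in : chain_map Y cone := 
  @ChainMap k C Y cone (fun i => bi2 _ _) cone_in_subproof.

Lemma cone_out_subproof i j :
  bp1 (X (j + 1)) (Y j) @o dif cone i j
    = dif (cshift X 1) i j @o bp1 (X (i + 1)) (Y i).
Proof. by rewrite /= /shift_diff expr1z scaleN1r cone_difE1. Qed.
Definition cone_out : chain_map cone (cshift X 1) := 
  @ChainMap k C cone (cshift X 1) (fun i => bp1 _ _) cone_out_subproof.

End ConeDef.

Lemma cone_out_in X Y (f : chain_map X Y) :
  chain_comp (cone_out f) (cone_in f) = 0.
Proof. by apply: chain_mapP => i; rewrite /= bp1i2. Qed.

(** The homotopy includes [X i] as the first summand of the cone in degree [i - 1]. *)
Lemma cone_in_null X Y (f : chain_map X Y) : null (chain_comp (cone_in f) f).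
Proof.
exists (fun i j => bi1 _ _ @o tr X i (j + 1)) => i a b ai bi /=; subst i b.
rewrite !tr_id !compm1 bcopair_i1 /bpair tr_id compm1 compNr [RHS]addrAC addNr.
by rewrite add0r.
Qed.

(** A null-homotopy with values in the cone has two components: the first is a chain map [x] to [X],
    the second a homotopy from [c] to [f x]. *)
Lemma cone_lift X Y W (f : chain_map X Y) (c : chain_map W Y) :
  null (chain_comp (cone_in f) c) ->
  exists x : chain_map W X, null (c - chain_comp f x).
Proof.
move=> [h hP].
pose p i a : mor (W i) (X (a + 1)) := bp1 _ _ @o h i a.
pose q i a : mor (W i) (Y a) := bp2 _ _ @o h i a.
have e1 i a b : a + 1 = i -> i + 1 = b ->
    p b i @o dif W i b = dif X (a + 1) (i + 1) @o p i a.
  move=> ai bi; have := congr1 (fun z => bp1 _ _ @o z) (hP i a b ai bi).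
  rewrite /= compA bp1i2 comp0m compDr !compA cone_difE1 !compNl -compA.
  by move/esym/eqP; rewrite [X in X == _]addrC subr_eq0 => /eqP.
have e2 i a b : a + 1 = i -> i + 1 = b ->
    c i = f i @o (tr X (a + 1) i @o p i a)
          + (dif Y a i @o q i a + q b i @o dif W i b).
  move=> ai bi; have /= e := congr1 (fun z => bp2 _ _ @o z) (hP i a b ai bi).
  rewrite compA bp2i2 comp1m in e; rewrite e.
  by rewrite compDr !compA cone_difE2 compDl -!compA addrA.
have trp i a : a + 1 = i ->
    tr X (i - 1 + 1) i @o p i (i - 1) = tr X (a + 1) i @o p i a.
  by move=> ai; have -> : a = i - 1 by lia.
have [x xE] : exists x : chain_map W X,
    forall i, x i = tr X (i - 1 + 1) i @o p i (i - 1).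
  apply: chain_map_ex => i j ij; subst j.
  rewrite (trp _ i) // tr_id comp1m (e1 i (i - 1)) //; last by lia.
  by rewrite compA dif_tr //; lia.
exists x, q => i a b ai bi.
by rewrite chainBE chainCE xE (trp i a) // (e2 i a b) // [X in X - _]addrC addrK.
Qed.

Lemma cone_extend X Y W (f : chain_map X Y) (c : chain_map Y W) :
  null (chain_comp c f) ->
  exists x : chain_map (cone f) W, chain_comp x (cone_in f) = c.
Proof.
move=> [h hP].
have [x xE] : exists x : chain_map (cone f) W,
    forall i, x i = bcopair (h (i + 1) i) (c i).
  apply: chain_map_ex => i j ij; subst j; apply: bcopair_ext.
    rewrite -!compA !bcopair_i1 bcopair_pair tr_id compm1 compNr.
    by have /= -> := hP (i + 1) i (i + 1 + 1) erefl erefl; rewrite [LHS]addrC addrK.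
  by rewrite -!compA !bcopair_i2 compA bcopair_i2 cmapP.
by exists x; apply: chain_mapP => i; rewrite /= xE bcopair_i2.
Qed.

Section Rotation.
Variables (X Y : bcomplex C) (f : chain_map X Y).
Let g := cone_in f.

(** Together with [cone_rot_inv], [cone_rot] is a homotopy equivalence from the cone of
    [Y -> cone f] to [X[1]]. Through it, exactness at the later places of the triangle reduces to
    exactness at the first. *)
Lemma cone_rot_subproof i j :
  (bp1 _ _ @o bp2 _ _) @o dif (cone g) i j
    = dif (cshift X 1) i j @o (bp1 (X (i + 1)) (Y i) @o bp2 (Y (i + 1)) (cone f i)).
Proof.
rewrite /= /shift_diff expr1z scaleN1r -compA cone_difE2 compDr !compA.
by rewrite /= bp1i2 !comp0m add0r cone_difE1.
Qed.
Definition cone_rot : chain_map (cone g) (cshift X 1) :=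
  @ChainMap k C (cone g) (cshift X 1) (fun i => bp1 _ _ @o bp2 _ _)
    cone_rot_subproof.

Lemma cone_rot_in : chain_comp cone_rot (cone_in g) = cone_out f.
Proof. by apply: chain_mapP => i /=; rewrite -compA bp2i2 compm1. Qed.

Lemma cone_rot_inv_subproof i j :
  bpair (- f (j + 1)) (bi1 (X (j + 1)) (Y j)) @o dif (cshift X 1) i j
    = dif (cone g) i j @o bpair (- f (i + 1)) (bi1 (X (i + 1)) (Y i)).
Proof.
have [ji|/eqP ne] := eqVneq j (i + 1); last first.
  by rewrite !diff_shape // comp0m compm0.
subst j; rewrite /= /shift_diff expr1z scaleN1r compNr.
apply: bpair_ext.
  rewrite compNr [in LHS]compA bp1_pair [in RHS]compA cone_difE1.
  by rewrite -[in RHS]compA bp1_pair !compNl compNr cmapP.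
rewrite compNr [in LHS]compA bp2_pair [in RHS]compA cone_difE2 compDl.
rewrite -!(compA _ _ (bpair _ _)) bp1_pair bp2_pair tr_id compm1 /=.
rewrite bcopair_i1 /bpair tr_id compm1 !compNr.
by rewrite [X in _ = _ + X]addrC addKr.
Qed.
Definition cone_rot_inv : chain_map (cshift X 1) (cone g) :=
  @ChainMap k C (cshift X 1) (cone g) (fun i => bpair (- f (i + 1)) (bi1 _ _))
    cone_rot_inv_subproof.

Lemma cone_rotK : chain_comp cone_rot cone_rot_inv = chain_id _.
Proof. by apply: chain_mapP => i /=; rewrite -compA bp2_pair bp1i1. Qed.

(** In degree [i] the double cone is [Y (i + 1)], [X (i + 1)] and [Y i]; the homotopy contracts the
    two copies of [Y] against each other. *)
Lemma cone_rotVK : null (chain_comp cone_rot_inv cone_rot - chain_id _).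
Proof.
exists (fun i j => - (bi1 _ _ @o tr Y i (j + 1) @o bp2 _ _ @o bp2 _ _)).
move=> i a b ai bi; subst i b; rewrite chainBE chainCE /= !tr_id !compm1.
rewrite compNl compNr; apply: bpair_ext.
  rewrite [LHS]compBr [in LHS]compA bp1_pair compm1 [RHS]compBr compNr.
  rewrite ![in RHS]compA cone_difE1 bp1i1 comp1m !compNl.
  rewrite -(compA (bp2 _ _)) cone_difE2 /=.
  rewrite -!compA !(compA (bp1 _ _) (bi1 _ _)) bp1i1 !comp1m opprK tr_id comp1m.
  rewrite [in RHS]compDr !(compA (bp2 _ _) (bi2 _ _)) bp2i2 comp1m.
  rewrite (compA (bp2 _ _) (cone_dif _ _ _)) cone_difE2 compDl tr_id compm1.
  rewrite -!compA !opprD [RHS]addrCA [X in _ = _ + X]addrCA subrr addr0.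
  by rewrite [RHS]addrC.
rewrite [LHS]compBr [in LHS]compA bp2_pair compm1 [RHS]compBr compNr.
rewrite -!(compA (bi1 _ _)) ![in RHS]compA bp2i1 !comp0m subr0.
rewrite cone_difE2 -!compA compDl -!compA !(compA (bp1 _ _) (bi1 _ _)) bp1i1 comp1m.

rewrite (compA (bp2 _ _) (bi1 _ _)) bp2i1 comp0m compm0 addr0 tr_id comp1m /=.
rewrite -[X in _ - X = _]comp1m -bip_sum compDl -!compA opprD.
by rewrite addrA subrr sub0r.
Qed.

(** The sign of rotation: under [cone_rot], the third map of the triangle on [cone_in f] becomes [-
    f[1]] up to homotopy. *)
Lemma cone_rot_out :
  null (chain_comp (cshift_map f 1) cone_rot + cone_out g).
Proof.
exists (fun i j => tr Y i (j + 1) @o bp2 _ _ @o bp2 _ _) => i a b ai bi.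
subst i b; rewrite chainDE chainCE /= /shift_diff expr1z scaleN1r !tr_id !comp1m.
rewrite -(compA _ _ (cone_dif _ _ _)) cone_difE2 tr_id compm1 compDr.
rewrite (compA (bp2 _ _) (bi2 _ _)) bp2i2 comp1m /= !compA cone_difE2.
rewrite -!compA compDl tr_id -!compA comp1m compNl.
by rewrite [X in _ = _ + X]addrA [X in _ = _ + X]addrC addKr [LHS]addrC.
Qed.

End Rotation.
End Cone.

(** * Cohomology by generalised elements *)

Section CohElements.
Variables (k : fieldType) (C : abelian_cat k).
Implicit Types (X Y Z : bcomplex C) (V W : C).

(** Quantifying over all [j] avoids fixing a form of the degree [i + 1]; [cocycP] recovers the usual
    condition. *)
Definition cocyc X i V (z : mor V (X i)) : Prop := forall j, dif X i j @o z = 0.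

(* "Locally" means after an epimorphic change of the domain. *)
Definition lbound X i V (z : mor V (X i)) : Prop :=
  exists W (e : mor W V) a (y : mor W (X a)), is_epi e /\ dif X a i @o y = z @o e.

Lemma cocycP X i j V (z : mor V (X i)) : i + 1 = j ->
  dif X i j @o z = 0 -> cocyc z.
Proof.
move=> <- h l; have [->//|/eqP ne] := eqVneq l (i + 1).
by rewrite diff_shape // comp0m.
Qed.

Lemma cocyc_comp X i V W (z : mor V (X i)) (e : mor W V) :
  cocyc z -> cocyc (z @o e).
Proof. by move=> h j; rewrite compA h comp0m. Qed.

Lemma cocycD X i V (z w : mor V (X i)) : cocyc z -> cocyc w -> cocyc (z + w).
Proof. by move=> zc wc j; rewrite compDr zc wc addr0. Qed.

Lemma cocycN X i V (z : mor V (X i)) : cocyc z -> cocyc (- z).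
Proof. by move=> zc j; rewrite compNr zc oppr0. Qed.

Lemma cocycB X i V (z w : mor V (X i)) : cocyc z -> cocyc w -> cocyc (z - w).
Proof. by move=> zc wc; apply: cocycD => //; exact: cocycN. Qed.

Lemma cocyc_dif X a i V (y : mor V (X a)) : cocyc (dif X a i @o y).
Proof. by move=> j; rewrite compA diffK comp0m. Qed.

Lemma cocyc_map X Y (f : chain_map X Y) i V (z : mor V (X i)) :
  cocyc z -> cocyc (f i @o z).
Proof. by move=> h j; rewrite compA -cmapP -compA h compm0. Qed.

(** The cohomology class of a cocycle, made total by the junk value 0 on other elements. *)
Definition cls X i V (z : mor V (X i)) : mor V (coh X i) :=
  match pselect (dif X i (i + 1) @o z = 0) with
  | left e => cokm (coboundary X i) @o ker_lift e
  | right _ => 0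
  end.

(** The universal cocycle: every other one is a pullback of it, so maps out of cohomology are
    determined and defined by their effect on it. *)
Definition ucocyc X i : mor (cocycle X i) (X i) := kerm (dif X i (i + 1)).

Lemma ucocycP X i : cocyc (ucocyc X i).
Proof. exact: cocycP (kerP _).1. Qed.

Lemma cls_lift X i V (z : mor V (cocycle X i)) :
  cls (ucocyc X i @o z) = cokm (coboundary X i) @o z.
Proof.
rewrite /cls; case: pselect => [e|[]]; last by rewrite compA (kerP _).1 comp0m.
by congr (_ @o _); apply: (@kerm_mono _ _ _ _ (dif X i (i + 1))); rewrite ker_liftK.
Qed.

Lemma cocyc_lift X i V (z : mor V (X i)) : cocyc z ->
  exists z' : mor V (cocycle X i), ucocyc X i @o z' = z.
Proof. by move=> zc; exists (ker_lift (zc (i + 1))); exact: ker_liftK. Qed.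

Lemma cls_comp X i V W (z : mor V (X i)) (e : mor W V) :
  cocyc z -> cls (z @o e) = cls z @o e.
Proof. by move=> /cocyc_lift [z' <-]; rewrite -compA !cls_lift compA. Qed.

Lemma clsD X i V (z w : mor V (X i)) : cocyc z -> cocyc w ->
  cls (z + w) = cls z + cls w.
Proof.
by move=> /cocyc_lift [z' <-] /cocyc_lift [w' <-]; rewrite -compDr !cls_lift compDr.
Qed.

Lemma clsZ X i V a (z : mor V (X i)) : cocyc z -> cls (a *: z) = a *: cls z.
Proof. by move=> /cocyc_lift [z' <-]; rewrite -compZr !cls_lift compZr. Qed.

Lemma clsB X i V (z w : mor V (X i)) : cocyc z -> cocyc w ->
  cls (z - w) = cls z - cls w.
Proof.
by move=> zc wc; rewrite -scaleN1r clsD ?clsZ ?scaleN1r //; exact: cocycN.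
Qed.

Lemma cls_dif X a i V (y : mor V (X a)) : cls (dif X a i @o y) = 0.
Proof.
have [ai|/eqP ne] := eqVneq i (a + 1); last first.
  rewrite diff_shape // comp0m -(compm0 _ (ucocyc X i)) cls_lift.
  exact: compm0.
have e : a = i - 1 by lia.
subst a; rewrite -(ker_liftK (diffK X (i - 1) i (i + 1))) -compA cls_lift.
by rewrite compA (cokP (coboundary X i)).1 comp0m.
Qed.

Lemma cls_lbound X i V (z : mor V (X i)) : cocyc z -> lbound z -> cls z = 0.
Proof.
move=> zc [W [e [a [y [ee yz]]]]]; apply: (epi0 ee).
by rewrite -cls_comp // -yz cls_dif.
Qed.

Lemma cls_eq0 X i V (z : mor V (X i)) : cocyc z -> cls z = 0 -> lbound z.
Proof.
move=> /cocyc_lift [z' <-]; rewrite cls_lift => /cok_lift [W [e [y [ee yz]]]].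
exists W, e, (i - 1), y; split=> //.
by rewrite -compA -yz compA -(ker_liftK (diffK X (i - 1) i (i + 1))).
Qed.

Lemma cls_surj X i V (x : mor V (coh X i)) :
  exists W (e : mor W V) (z : mor W (X i)), [/\ is_epi e, cocyc z & cls z = x @o e].
Proof.
have [W [e [z [ee zx]]]] := pullback_epi x (@cokm_epi _ _ _ _ (coboundary X i)).
exists W, e, (ucocyc X i @o z); split=> //; last by rewrite cls_lift.
exact/cocyc_comp/ucocycP.
Qed.

Lemma coh_ext X i V (u v : mor (coh X i) V) :
  (forall W (z : mor W (X i)), cocyc z -> u @o cls z = v @o cls z) -> u = v.
Proof.
move=> uv; apply: (@cokm_epi _ _ _ _ (coboundary X i)).
have := uv _ _ (@ucocycP X i).
by rewrite -[ucocyc X i]compm1 cls_lift compm1.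
Qed.

Lemma coh_map_cls X Y (f : chain_map X Y) i V (z : mor V (X i)) : cocyc z ->
  coh_map f i @o cls z = cls (f i @o z).
Proof.
move=> /cocyc_lift [z' <-]; rewrite cls_lift [in LHS]compA cok_descK -compA.
have -> : f i @o (ucocyc X i @o z') = ucocyc Y i @o (cocycle_map f i @o z').
  by rewrite !compA [in RHS]ker_liftK.
by rewrite cls_lift.
Qed.

Lemma coh_desc X i V (u : forall W, mor W (X i) -> mor W V) :
  (forall W W' (z : mor W (X i)) (e : mor W' W), cocyc z -> u _ (z @o e) = u _ z @o e) ->
  (forall W a (y : mor W (X a)), u _ (dif X a i @o y) = 0) ->
  exists v : mor (coh X i) V, forall W (z : mor W (X i)), cocyc z -> v @o cls z = u _ z.
Proof.
move=> uc ud.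
have ub : u _ (ucocyc X i) @o coboundary X i = 0.
  rewrite -uc; last exact: ucocycP.
  by rewrite ker_liftK -[dif _ _ _]compm1 ud.
exists (cok_desc ub) => W z /cocyc_lift [z' <-].
by rewrite cls_lift compA cok_descK -uc //; exact: ucocycP.
Qed.

Lemma coh_map_id X i : coh_map (chain_id X) i = idm _.
Proof. by apply: coh_ext => W z zc; rewrite coh_map_cls //= !comp1m. Qed.

Lemma coh_map_comp X Y Z (g : chain_map Y Z) (f : chain_map X Y) i :
  coh_map (chain_comp g f) i = coh_map g i @o coh_map f i.
Proof.
apply: coh_ext => W z zc; rewrite -compA !coh_map_cls //=; last exact: cocyc_map.
by rewrite compA.
Qed.

Lemma coh_mapD X Y (f g : chain_map X Y) i :
  coh_map (f + g) i = coh_map f i + coh_map g i.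
Proof.
apply: coh_ext => W z zc; rewrite compDl !coh_map_cls // chainDE compDl clsD //;
  exact: cocyc_map.
Qed.

Lemma coh_mapZ X Y a (f : chain_map X Y) i : coh_map (a *: f) i = a *: coh_map f i.
Proof.
apply: coh_ext => W z zc; rewrite compZl !coh_map_cls //= compZl clsZ //.
exact: cocyc_map.
Qed.

Lemma coh_map_null X Y (f : chain_map X Y) i : null f -> coh_map f i = 0.
Proof.
move=> [h hP]; apply: coh_ext => W z zc; rewrite coh_map_cls // comp0m.
rewrite (hP i (i - 1) (i + 1)) //; last by lia.
by rewrite compDl -!compA zc compm0 addr0 cls_dif.
Qed.

Lemma coh_zeroP X i : is_zero_ob (coh X i) <->
  (forall V (z : mor V (X i)), cocyc z -> lbound z).
Proof.
split=> [[h _] V z zc|h]; first by apply: cls_eq0 => //; exact: h.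
apply/zero_obP/coh_ext => W z zc; rewrite comp1m comp0m.
exact/cls_lbound/h.
Qed.

Definition acyclic X : Prop := forall i, is_zero_ob (coh X i).

Lemma quasi_isoP X Y (f : chain_map X Y) :
  (forall i V (z : mor V (Y i)), cocyc z ->
     exists W (e : mor W V) (x : mor W (X i)),
       [/\ is_epi e, cocyc x & lbound (z @o e - f i @o x)]) ->
  (forall i V (x : mor V (X i)), cocyc x -> lbound (f i @o x) -> lbound x) ->
  quasi_iso f.
Proof.
move=> fs fi i; apply: is_isoP => [V x fx|V y].
  have [W [e [z [ee zc zx]]]] := cls_surj x.
  apply: (epi0 ee); rewrite -zx; apply: cls_lbound => //.
  apply: fi => //; apply: cls_eq0; first exact: cocyc_map.
  by rewrite -coh_map_cls // zx compA fx comp0m.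
have [W [e [z [ee zc zy]]]] := cls_surj y.
have [W' [e' [x [ee' xc zx]]]] := fs i W z zc.
exists W', (e @o e'), (cls x); split; first exact: epi_comp.
rewrite coh_map_cls // compA -zy -cls_comp //; apply/eqP.
rewrite eq_sym -subr_eq0 -clsB; [|exact: cocyc_comp|exact: cocyc_map].
apply/eqP/cls_lbound => //; apply: cocycB; first exact: cocyc_comp.
exact: cocyc_map.
Qed.

Lemma quasi_iso_surj X Y (f : chain_map X Y) i V (z : mor V (Y i)) :
  quasi_iso f -> cocyc z ->
  exists W (e : mor W V) (x : mor W (X i)),
     [/\ is_epi e, cocyc x & lbound (z @o e - f i @o x)].
Proof.
move=> /(_ i) [g [_ fg]] zc.
have [W [e [x [ee xc xz]]]] := cls_surj (g @o cls z).
exists W, e, x; split=> //; apply: cls_eq0.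
  by apply: cocycB; [exact: cocyc_comp|exact: cocyc_map].
rewrite clsB; [|exact: cocyc_comp|exact: cocyc_map].
by rewrite cls_comp // -coh_map_cls // xz !compA fg comp1m subrr.
Qed.

Lemma quasi_iso_inj X Y (f : chain_map X Y) i V (x : mor V (X i)) :
  quasi_iso f -> cocyc x -> lbound (f i @o x) -> lbound x.
Proof.
move=> /(_ i) fi xc fx; apply: cls_eq0 => //; apply: (iso_cancell fi).
by rewrite coh_map_cls // compm0; apply: cls_lbound => //; exact: cocyc_map.
Qed.

Lemma quasi_iso_id X : quasi_iso (chain_id X).
Proof. by move=> i; rewrite coh_map_id; exact: is_iso_id. Qed.

Lemma quasi_iso_comp X Y Z (g : chain_map Y Z) (f : chain_map X Y) :
  quasi_iso g -> quasi_iso f -> quasi_iso (chain_comp g f).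
Proof.
by move=> gq fq i; rewrite coh_map_comp; apply: is_iso_comp; [exact: gq|exact: fq].
Qed.

Lemma acyclic_quasi_iso X Y (f : chain_map X Y) :
  acyclic X -> acyclic Y -> quasi_iso f.
Proof.
move=> X0 Y0 i; exists 0; rewrite !comp0m.
by rewrite (zero_obP _).1 ?(zero_obP _).1 // compm0.
Qed.

Lemma lbound_shift X s i V (z : mor V (X (i + s))) :
  lbound z <-> @lbound (cshift X s) i V z.
Proof.
have sgn_unit : (-1 : k) ^ s != 0 by rewrite expfz_neq0 // oppr_eq0 oner_eq0.
split=> [[W [e [a [y [ee yz]]]]]|[W [e [a [y [ee yz]]]]]].
  exists W, e, (a - s), ((-1) ^ (- s) *: (tr X a (a - s + s) @o y)); split=> //.
  rewrite /= /shift_diff compZl compZr scalerA.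
  rewrite -expfzDr ?oppr_eq0 ?oner_eq0 // subrr expr0z scale1r compA.
  by rewrite dif_tr ?yz //; lia.
exists W, e, (a + s), ((-1) ^ s *: y); split=> //.
by rewrite compZr -compZl.
Qed.

Lemma cocyc_shift X s i V (z : mor V (X (i + s))) :
  cocyc z <-> @cocyc (cshift X s) i V z.
Proof.
have sgn_unit : (-1 : k) ^ s != 0 by rewrite expfz_neq0 // oppr_eq0 oner_eq0.
split=> h j; first by rewrite /= /shift_diff compZl h scaler0.
have := h (j - s); rewrite /= /shift_diff compZl.
move=> /(congr1 (fun u => ((-1) ^ s)^-1 *: u)).
rewrite scaler0 scalerA mulVf // scale1r => e.
have <- : j - s + s = j by lia.
exact: e.
Qed.

Lemma quasi_iso_shift X Y (f : chain_map X Y) s :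
  quasi_iso f -> quasi_iso (cshift_map f s).
Proof.
move=> fq; apply: quasi_isoP => [i V z /cocyc_shift zc|i V x /cocyc_shift xc].
  have [W [e [x [ee xc zx]]]] := quasi_iso_surj fq zc.
  by exists W, e, x; split=> //; [apply/cocyc_shift|apply/lbound_shift].
by move=> /lbound_shift fx; apply/lbound_shift; exact: quasi_iso_inj fx.
Qed.

(** Both sides have the same cocycles and local boundaries, since the sign of the shifted
    differential affects neither; they are still different cokernels, hence a comparison map
    characterised on classes. *)
Lemma coh_shift_ex X s i : exists2 u : mor (coh (cshift X s) i) (coh X (i + s)),
  is_iso u & forall V (z : mor V (X (i + s))), cocyc z -> u @o @cls (cshift X s) i V z = cls z.
Proof.
have [u uE] : exists u : mor (coh (cshift X s) i) (coh X (i + s)),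
    forall W (z : mor W (X (i + s))), @cocyc (cshift X s) i W z ->
    u @o @cls (cshift X s) i W z = cls z.
  apply: coh_desc => [W W' z e /cocyc_shift zc|W a y]; first by rewrite cls_comp.
  by rewrite /= /shift_diff compZl -compZr cls_dif.
exists u; last by move=> V z zc; apply: uE; apply/cocyc_shift.
apply: is_isoP => [V x ux|V y].
  have [W [e [z [ee zc zx]]]] := cls_surj x.
  apply: (epi0 ee); rewrite -zx; apply: cls_lbound => //.
  apply/lbound_shift/cls_eq0; first exact/cocyc_shift.
  by rewrite -uE // zx compA ux comp0m.
have [W [e [z [ee zc zy]]]] := cls_surj y.
exists W, e, (@cls (cshift X s) i W z); split=> //.
by rewrite uE //; apply/cocyc_shift.
Qed.

Definition coh_shift X s i : mor (coh (cshift X s) i) (coh X (i + s)) :=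
  projT1 (cid2 (coh_shift_ex X s i)).

Lemma coh_shift_iso X s i : is_iso (coh_shift X s i).
Proof. by rewrite /coh_shift; case: cid2. Qed.

Lemma coh_shiftE X s i V (z : mor V (X (i + s))) : cocyc z ->
  coh_shift X s i @o @cls (cshift X s) i V z = cls z.
Proof. by rewrite /coh_shift; case: cid2 => u ui uE; exact: uE. Qed.

Lemma coh_shift_nat X Y (f : chain_map X Y) s i :
  coh_shift Y s i @o coh_map (cshift_map f s) i = coh_map f (i + s) @o coh_shift X s i.
Proof.
apply: coh_ext => W z zc; have zc' := (@cocyc_shift X s i W z).2 zc.
rewrite -!compA coh_map_cls // !coh_shiftE //; last exact: cocyc_map.
by rewrite coh_map_cls.
Qed.

End CohElements.

(** * The long exact cohomology sequence of a cone *)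

Section Exactness.
Variables (k : fieldType) (C : abelian_cat k).
Implicit Types X Y Z W : bcomplex C.

Lemma lexact_conj (X Y Z X' Y' Z' : C) (f : mor X Y) (g : mor Y Z)
    (f' : mor X' Y') (g' : mor Y' Z') (a : mor X X') (b : mor Y Y') (c : mor Z Z') :
  is_iso a -> is_iso b -> is_iso c -> b @o f = f' @o a -> c @o g = g' @o b ->
  lexact f g -> lexact f' g'.
Proof.
move=> ai [b' [b'b bb']] ci e1 e2 [gf fg]; split.
  apply: (iso_cancelr ai); rewrite comp0m -compA -e1 compA -e2 -compA gf.
  exact: compm0.
move=> V y g'y.
have gb : g @o (b' @o y) = 0.
  apply: (iso_cancell ci); rewrite compm0 compA e2 -compA (compA b) bb'.
  by rewrite comp1m.
have [W [e [x [ee fx]]]] := fg _ _ gb.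
exists W, e, (a @o x); split=> //.
by rewrite compA -e1 -compA fx !compA bb' comp1m.
Qed.

Lemma quasi_iso_chain_iso X Y (f : chain_map X Y) (g : chain_map Y X) :
  chain_comp g f = chain_id _ -> chain_comp f g = chain_id _ -> quasi_iso f.
Proof.
by move=> gf fg i; exists (coh_map g i); rewrite -!coh_map_comp gf fg !coh_map_id.
Qed.

Lemma coh_map_eq X Y (f g : chain_map X Y) i : null (f - g) -> coh_map f i = coh_map g i.
Proof.
move=> n; have := coh_map_null i n; rewrite -scaleN1r coh_mapD coh_mapZ scaleN1r.
by move/eqP; rewrite subr_eq0 => /eqP.
Qed.

Lemma cone_rot_quasi_iso X Y (f : chain_map X Y) : quasi_iso (cone_rot f).
Proof.
move=> i; exists (coh_map (cone_rot_inv f) i); split.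
  by rewrite -coh_map_comp -coh_map_id; apply: coh_map_eq; exact: cone_rotVK.
by rewrite -coh_map_comp cone_rotK coh_map_id.
Qed.

Lemma cone_lexact X Y (f : chain_map X Y) i :
  lexact (coh_map f i) (coh_map (cone_in f) i).
Proof.
split; first by rewrite -coh_map_comp coh_map_null //; exact: cone_in_null.
move=> V y gy; have [W [e [z [ee zc zy]]]] := cls_surj y.
have : cls (cone_in f i @o z) = 0.
  by rewrite -coh_map_cls // zy compA gy comp0m.
move=> /cls_eq0; case; first exact: cocyc_map.
move=> W' [e' [a [w [ee' we]]]].
(* The two components of the equation in the cone: [e1] makes the [X] part of [w] a cocycle, [e2]
   says that [z] is locally its image under [f] plus a boundary in [Y]. *)
have /= e1 := congr1 (fun u => bp1 _ _ @o u) we.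
rewrite compA cone_difE1 !compA bp1i2 !comp0m !compNl in e1.
have /= e2 := congr1 (fun u => bp2 _ _ @o u) we.
rewrite !compA cone_difE2 bp2i2 comp1m compDl in e2.
(* The degree [a] is arbitrary. If [a + 1 <> i], the transport makes [x] zero, as it should, the
   differential from [a] to [i] being zero as well. *)
pose x := tr X (a + 1) i @o (bp1 _ _ @o w).
have xc : cocyc x.
  rewrite /x; have [ai|/eqP ne] := eqVneq (a + 1) i; last first.
    by move=> j; rewrite tr_neq // comp0m compm0.
  apply: (@cocycP _ _ _ i (i + 1)) => //; rewrite compA dif_tr // compA.
  by apply/eqP; rewrite -oppr_eq0 e1.
exists W', (e @o e'), (cls x); split; first exact: epi_comp.
rewrite coh_map_cls // compA -zy -cls_comp // -e2.
have -> : f i @o x = f i @o tr X (a + 1) i @o bp1 _ _ @o w by rewrite /x !compA.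
rewrite -compA; set q := _ @o (_ @o w); rewrite clsD.
- by rewrite -compA cls_dif addr0.
- rewrite /q (_ : _ @o _ = f i @o x); first exact: cocyc_map.
  by rewrite /x !compA.
- by rewrite -compA; exact: cocyc_dif.
Qed.

Lemma cone_lexact_out X Y (f : chain_map X Y) i :
  lexact (coh_map (cone_in f) i) (coh_map (cone_out f) i).
Proof.
apply: lexact_conj (cone_lexact (cone_in f) i);
  [exact: is_iso_id|exact: is_iso_id|exact: cone_rot_quasi_iso|..].
  by rewrite comp1m compm1.
by rewrite compm1 -coh_map_comp cone_rot_in.
Qed.

Lemma cone_lexact_shift X Y (f : chain_map X Y) i :
  lexact (coh_map (cone_out f) i) (coh_map (cshift_map f 1) i).
Proof.
have m1 : (-1 : k) != 0 by rewrite oppr_eq0 oner_eq0.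
apply: lexact_conj (cone_lexact_out (cone_in f) i);
  [exact: is_iso_id|exact: cone_rot_quasi_iso|exact: is_iso_scale m1 (is_iso_id _)|..].
  by rewrite compm1 -coh_map_comp cone_rot_in.
rewrite compZl comp1m scaleN1r -coh_map_comp; apply/eqP.
by rewrite eq_sym -addr_eq0 -coh_mapD coh_map_null //; exact: cone_rot_out.
Qed.

Lemma cone_acyclic X Y (f : chain_map X Y) : quasi_iso f -> acyclic (cone f).
Proof.
move=> fq i.
have in0 : coh_map (cone_in f) i = 0.
  apply: (iso_cancelr (fq i)); rewrite comp0m; exact: (cone_lexact f i).1.
have out0 : coh_map (cone_out f) i = 0.
  apply: (iso_cancell (quasi_iso_shift 1 fq i)); rewrite compm0.
  exact: (cone_lexact_shift f i).1.
apply/zero_obP; apply: (mono0 (lexact_mono (cone_lexact_out f i) in0)).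
by rewrite compm1.
Qed.

Lemma cone_out_quasi_iso X Y (f : chain_map X Y) : acyclic Y -> quasi_iso (cone_out f).
Proof.
move=> Y0 i; apply: mono_epi_iso.
  apply: lexact_mono (cone_lexact_out f i) _; exact: (Y0 i).2.
apply: lexact_epi (cone_lexact_shift f i) _.
apply: (iso_cancell (coh_shift_iso Y 1 i)); rewrite compm0.
exact: (Y0 (i + 1)).1.
Qed.

Lemma cone_map_quasi_iso X Y X' Y' (f : chain_map X Y) (f' : chain_map X' Y')
    (a : chain_map X X') (b : chain_map Y Y') (m : chain_map (cone f) (cone f')) :
  null (chain_comp b f - chain_comp f' a) ->
  chain_comp m (cone_in f) = chain_comp (cone_in f') b ->
  chain_comp (cone_out f') m = chain_comp (cshift_map a 1) (cone_out f) ->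
  quasi_iso a -> quasi_iso b -> quasi_iso m.
Proof.
move=> n e1 e2 aq bq i.
apply: (five_iso (cone_lexact f i) (cone_lexact_out f i) (cone_lexact_shift f i)
  (cone_lexact f' i) (cone_lexact_out f' i) (cone_lexact_shift f' i)
  _ _ _ _ (aq i) (bq i) (quasi_iso_shift 1 aq i) (quasi_iso_shift 1 bq i)).
- by rewrite -!coh_map_comp; exact: coh_map_eq.
- by rewrite -!coh_map_comp e1.
- by rewrite -!coh_map_comp e2.
- rewrite -!coh_map_comp -!cshift_mapC; apply: coh_map_eq.
  by rewrite -cshift_mapB; exact: cshift_map_null.
Qed.

(** The homotopy of the square is the off-diagonal entry of the map of cones. *)
Lemma cone_map_ex X Y X' Y' (f : chain_map X Y) (f' : chain_map X' Y')
    (a : chain_map X X') (b : chain_map Y Y') :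
  null (chain_comp b f - chain_comp f' a) ->
  exists m : chain_map (cone f) (cone f'),
    chain_comp m (cone_in f) = chain_comp (cone_in f') b /\
    chain_comp (cone_out f') m = chain_comp (cshift_map a 1) (cone_out f).
Proof.
move=> [h hP].
have [m mE] : exists m : chain_map (cone f) (cone f'), forall i,
    m i = bcopair (bpair (a (i + 1)) (h (i + 1) i)) (bi2 _ _ @o b i).
  apply: chain_map_ex => i j ij; subst j.
  have := hP (i + 1) i (i + 1 + 1) erefl erefl; rewrite chainBE !chainCE => e.
  apply: bcopair_ext.
    rewrite -!compA !bcopair_i1 bcopair_pair tr_id compm1.
    apply: bpair_ext.
      rewrite compDr !(compA (bp1 _ _)) bp1_pair bp1i2 !comp0m addr0.
      by rewrite cone_difE1 -compA bp1_pair compNl compNr cmapP.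
    rewrite compDr !(compA (bp2 _ _)) bp2_pair bp2i2 comp1m cone_difE2.
    rewrite compDl -!compA bp1_pair bp2_pair tr_id comp1m compNr.
    have -> : b (i + 1) @o f (i + 1) =
      f' (i + 1) @o a (i + 1) + (dif Y' i (i + 1) @o h (i + 1) i +
       h (i + 1 + 1) (i + 1) @o dif X (i + 1) (i + 1 + 1)).
      by rewrite -e [RHS]addrC subrK.
    by rewrite [LHS]addrC addrA addrK.
  rewrite -!compA !bcopair_i2 (compA (bcopair _ _)) bcopair_i2.
  by rewrite (compA (cone_dif _ _ _)) bcopair_i2 -!compA cmapP.
exists m; split; apply: chain_mapP => i; rewrite !chainCE mE /=.
  by rewrite bcopair_i2.
by apply: bcopair_ext; rewrite -!compA ?bcopair_i1 ?bcopair_i2 ?bp1_pair ?bp1i1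
  ?compm1 // !(compA (bp1 _ _)) !bp1i2 comp0m compm0.
Qed.

End Exactness.

(** * The Ore conditions for quasi-isomorphisms *)

Section Ore.
Variables (k : fieldType) (C : abelian_cat k).
Implicit Types X Y Z W : bcomplex C.

Definition unshift X : chain_map (cshift (cshift X 1) (-1)) X :=
  chain_comp (shift_zero X) (shift_add X 1 (-1)).

Lemma chain_compA X Y Z W (h : chain_map Z W) (g : chain_map Y Z) (f : chain_map X Y) :
  chain_comp h (chain_comp g f) = chain_comp (chain_comp h g) f.
Proof. by apply: chain_mapP => i; rewrite !chainCE compA. Qed.

Lemma unshift_nat X Y (f : chain_map X Y) :
  chain_comp f (unshift X) = chain_comp (unshift Y) (cshift_map (cshift_map f 1) (-1)).
Proof.
rewrite /unshift chain_compA shift_zero_nat -!chain_compA.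
exact: (congr1 (chain_comp (shift_zero Y)) (shift_add_nat f 1 (-1))).
Qed.

Lemma unshift_quasi_iso X : quasi_iso (unshift X).
Proof.
apply: quasi_iso_comp.
  exact: quasi_iso_chain_iso (shift_zeroK X) (shift_zeroVK X).
exact: quasi_iso_chain_iso (shift_addK X 1 (-1)) (shift_addVK X 1 (-1)).
Qed.

(** Precompose [cone_rot_out] with the inclusion of [cone f] in the double cone: one term dies and
    [cone_rot] becomes [cone_out f]. *)
Lemma cone_out_null X Y (f : chain_map X Y) :
  null (chain_comp (cshift_map f 1) (cone_out f)).
Proof.
have := null_compr (cone_in (cone_in f)) (cone_rot_out f).
congr null; apply: chain_mapP => i.
rewrite chainCE chainDE !chainCE compDl -!compA (compA (bp1 _ _)).
rewrite -[X in _ + X](chainCE (cone_out (cone_in f)) (cone_in (cone_in f))).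
by rewrite cone_out_in chain0E addr0 -cone_rot_in chainCE compA.
Qed.

(** [P] is the homotopy fibre [cone w [-1]]; it maps to [X] by a quasi-isomorphism because [N] is
    acyclic. *)
Lemma acyclic_fiber X N (w : chain_map X N) : acyclic N ->
  exists P (t : chain_map P X), quasi_iso t /\ null (chain_comp w t).
Proof.
move=> N0; exists (cshift (cone w) (-1)).
exists (chain_comp (unshift X) (cshift_map (cone_out w) (-1))); split.
  apply: quasi_iso_comp; first exact: unshift_quasi_iso.
  exact/quasi_iso_shift/cone_out_quasi_iso.
have := null_compl (unshift N) (cshift_map_null (-1) (cone_out_null w)).
congr null; by rewrite cshift_mapC [LHS]chain_compA -unshift_nat -chain_compA.
Qed.

(** The composite of [f] with [Y -> cone s] has an acyclic target, so it becomes null on some [P]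
    quasi-isomorphic to [X]; there [f] lifts through [s] up to homotopy. *)
Lemma chain_ore X Y Z (f : chain_map X Y) (s : chain_map Z Y) : quasi_iso s ->
  exists P (t : chain_map P X) (g : chain_map P Z),
    quasi_iso t /\ null (chain_comp f t - chain_comp s g).
Proof.
move=> /cone_acyclic /(acyclic_fiber (chain_comp (cone_in s) f)) [P [t [tq n]]].
have [|g gP] := @cone_lift _ _ _ _ _ s (chain_comp f t).
  by move: n; congr null; apply: chain_mapP => i; rewrite !chainCE compA.
by exists P, t, g.
Qed.

(** A null-homotopy [h] of [s f] makes [(f, -h)] a chain map from [X[1]] to the acyclic cone of [s],
    lifting [f[1]]. Killing it on a quasi-isomorphic source kills [f[1]], and a shift back kills
    [f]. *)
Lemma chain_cancel X Y Z (s : chain_map Y Z) (f : chain_map X Y) : quasi_iso s ->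
  null (chain_comp s f) -> exists P (t : chain_map P X), quasi_iso t /\ null (chain_comp f t).
Proof.
move=> sq [h hP].
have [w wE] : exists w : chain_map (cshift X 1) (cone s),
    forall i, w i = bpair (f (i + 1)) (- h (i + 1) i).
  apply: chain_map_ex => i j ij; subst j.
  rewrite /= /shift_diff expr1z scaleN1r compNr; apply: bpair_ext.
    rewrite compNr !compA bp1_pair cone_difE1 -compA bp1_pair cmapP.
    by rewrite compNl.
  have := hP (i + 1) i (i + 1 + 1) erefl erefl; rewrite chainCE => e.
  rewrite compNr !compA bp2_pair cone_difE2 compDl -!compA bp1_pair bp2_pair.
  by rewrite tr_id comp1m e compNl compNr opprK [RHS]addrAC subrr add0r.
have [P [t [tq n]]] := acyclic_fiber w (cone_acyclic sq).
have n1 : null (chain_comp (cshift_map f 1) t).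
  have := null_compl (cone_out s) n; congr null; apply: chain_mapP => i.
  by rewrite !chainCE compA wE /= bp1_pair.
exists (cshift P (-1)), (chain_comp (unshift X) (cshift_map t (-1))); split.
  by apply: quasi_iso_comp; [exact: unshift_quasi_iso|exact: quasi_iso_shift].
have := null_compl (unshift Y) (cshift_map_null (-1) n1).
congr null; by rewrite cshift_mapC [LHS]chain_compA -unshift_nat -chain_compA.
Qed.

End Ore.

(** * Localization and fractions *)

Record lfunctor (k : fieldType) (D E : klin_cat k) := LFunctor {
  fob :> D -> E;
  fmor : forall X Y : D, mor X Y -> mor (fob X) (fob Y);
  fmor_id : forall X, fmor (idm X) = idm (fob X);
  fmor_comp : forall X Y Z (g : mor Y Z) (f : mor X Y),
    fmor (g @o f) = fmor g @o fmor f;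
  fmorD : forall X Y (f g : mor X Y), fmor (f + g) = fmor f + fmor g;
  fmorZ : forall X Y a (f : mor X Y), fmor (a *: f) = a *: fmor f
}.

Arguments fmor {k D E} F {X Y} f : rename.

Section LFunctorTheory.
Variables (k : fieldType) (D E : klin_cat k) (F : lfunctor D E).

Lemma fmor0 (X Y : D) : fmor F (0 : mor X Y) = 0.
Proof. by rewrite -(scale0r 0) fmorZ scale0r. Qed.

Lemma fmorN (X Y : D) (f : mor X Y) : fmor F (- f) = - fmor F f.
Proof. by rewrite -scaleN1r fmorZ scaleN1r. Qed.

Lemma fmorB (X Y : D) (f g : mor X Y) : fmor F (f - g) = fmor F f - fmor F g.
Proof. by rewrite fmorD fmorN. Qed.

Lemma fmor_iso (X Y : D) (f : mor X Y) : is_iso f -> is_iso (fmor F f).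
Proof.
by move=> [g [gf fg]]; exists (fmor F g); rewrite -!fmor_comp gf fg !fmor_id.
Qed.

Lemma fob_zero (X : D) : is_zero_ob X -> is_zero_ob (F X).
Proof. by move=> /zero_obP X0; apply/zero_obP; rewrite -fmor_id X0 fmor0. Qed.

End LFunctorTheory.

Section Extension.
Variables (k : fieldType) (D E : klin_cat k).
Variable W : forall X Y : D, mor X Y -> Prop.
Variable F : lfunctor D E.
Hypothesis FW : forall (X Y : D) (f : mor X Y), W f -> is_iso (fmor F f).

Fixpoint wint X Y (u : word W X Y) : mor (F X) (F Y) :=
  match u in word _ X Y return mor (F X) (F Y) with
  | wmap _ _ f => fmor F f
  | winv _ _ f fW => projT1 (cid (FW fW))
  | wcomp _ _ _ u v => wint u @o wint v
  | wadd _ _ u v => wint u + wint v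
  | wscale _ _ a u => a *: wint u
  end.

Lemma wint_eq X Y (u v : word W X Y) : weq u v -> wint u = wint v.
Proof.
elim=> {X Y u v} //=.
- by move=> X Y u v w _ -> _ ->.
- by move=> X Y Z u u' v v' _ -> _ ->.
- by move=> X Y u u' v v' _ -> _ ->.
- by move=> X Y a u u' _ ->.
- by move=> *; rewrite compA.
- by move=> *; rewrite fmor_id comp1m.
- by move=> *; rewrite fmor_id compm1.
- by move=> *; rewrite compDl.
- by move=> *; rewrite compDr.
- by move=> *; rewrite compZl.
- by move=> *; rewrite compZr.
- by move=> *; rewrite addrA.
- by move=> *; rewrite addrC.
- by move=> *; rewrite fmor0 add0r.
- by move=> *; rewrite fmor0 scaleN1r addNr.
- by move=> *; rewrite scalerA.
- by move=> *; rewrite scale1r.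
- by move=> *; rewrite scalerDr.
- by move=> *; rewrite scalerDl.
- by move=> *; rewrite fmor_comp.
- by move=> *; rewrite fmorD.
- by move=> *; rewrite fmorZ.
- by move=> X Y f fW; case: cid => g [/= ->]; rewrite fmor_id.
- by move=> X Y f fW; case: cid => g [/= _ ->]; rewrite fmor_id.
Qed.

Let L := localization W.

Definition lext_mor (X Y : L) (x : @mor k L X Y) : mor (F X) (F Y) := wint (repr x).

Lemma lext_morE X Y (u : word W X Y) : lext_mor (lclass u) = wint u.
Proof. exact/wint_eq/reprP. Qed.

Definition lext : lfunctor L E.
Proof.
refine (@LFunctor k L E (fun X => F X) lext_mor _ _ _ _).
- by move=> X; rewrite [idm X]/= lext_morE /= fmor_id.
- move=> X Y Z; elim/lclassW=> u; elim/lclassW=> v.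
  by rewrite [_ @o _ in LHS]lcompE !lext_morE.
- move=> X Y; elim/lclassW=> u; elim/lclassW=> v.
  by rewrite laddrE !lext_morE.
- move=> X Y a; elim/lclassW=> u.
  by rewrite lscalerE !lext_morE.
Defined.

Lemma lextE (X Y : D) (f : mor X Y) : fmor lext (lmap W f : @mor k L X Y) = fmor F f.
Proof. exact: lext_morE. Qed.

End Extension.

(** * Right fractions for a class [W] modulo an ideal [J], to be the quasi-isomorphisms and the
    null-homotopic maps *)

Section Fractions.
Variables (k : fieldType) (D : klin_cat k).
Variable W J : forall X Y : D, mor X Y -> Prop.
Hypothesis W_id : forall X, W (idm X).
Hypothesis W_comp : forall (X Y Z : D) (g : mor Y Z) (f : mor X Y),
  W g -> W f -> W (g @o f).
Hypothesis J0 : forall X Y : D, J (0 : mor X Y).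
Hypothesis JD : forall (X Y : D) (f g : mor X Y), J f -> J g -> J (f + g).
Hypothesis JZ : forall (X Y : D) a (f : mor X Y), J f -> J (a *: f).
Hypothesis J_compl : forall (X Y Z : D) (g : mor Y Z) (f : mor X Y), J f -> J (g @o f).
Hypothesis J_compr : forall (X Y Z : D) (g : mor Y Z) (f : mor X Y), J g -> J (g @o f).
Hypothesis ore : forall (X Y Z : D) (f : mor X Y) (s : mor Z Y), W s ->
  exists P (t : mor P X) (g : mor P Z), W t /\ J (f @o t - s @o g).
Hypothesis cancel : forall (X Y Z : D) (s : mor Y Z) (f : mor X Y), W s ->
  J (s @o f) -> exists P (t : mor P X), W t /\ J (f @o t).

Let L := localization W.
Local Notation "[ f ]" := (lmap W f : @mor k L _ _).

Hypothesis J_lmap : forall (X Y : D) (f : mor X Y), J f -> [f] = 0.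

Lemma lmap_comp (X Y Z : D) (g : mor Y Z) (f : mor X Y) : [g @o f] = [g] @o [f].
Proof. by rewrite /= lcompE; apply/lclassP; exact: weq_mapM. Qed.

Lemma lmapD (X Y : D) (f g : mor X Y) : [f + g] = [f] + [g].
Proof. by rewrite laddrE; apply/lclassP; exact: weq_mapD. Qed.

Lemma lmapZ (X Y : D) a (f : mor X Y) : [a *: f] = a *: [f].
Proof. by rewrite lscalerE; apply/lclassP; exact: weq_mapZ. Qed.

Lemma lmap_iso (X Y : D) (f : mor X Y) : W f -> is_iso [f].
Proof.
move=> fW; exists (lclass (winv fW) : @mor k L Y X); split.
- by rewrite /= lcompE; apply/lclassP; exact: weq_invl.
- by rewrite /= lcompE; apply/lclassP; exact: weq_invr.
Qed.

Lemma J_lmap_eq (X Y : D) (f g : mor X Y) : J (f - g) -> [f] = [g].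
Proof.
move=> /J_lmap; rewrite -scaleN1r lmapD lmapZ scaleN1r => /eqP.
by rewrite subr_eq0 => /eqP.
Qed.

(** By induction on words: composites and sums call for a common domain, which the Ore condition
    provides modulo [J], and [J] dies in the localization. *)
Lemma roof_ex (X Y : D) (x : @mor k L X Y) :
  exists P (s : mor P X) (f : mor P Y), W s /\ x @o [s] = [f].
Proof.
elim/lclassW: x; elim=> {X Y}.
- move=> X Y f; exists X, (idm X), f; split=> //.
  by rewrite -lmap_comp compm1.
- move=> X Y f fW; exists X, f, (idm X); split=> //.
  by rewrite /= lcompE; apply/lclassP; exact: weq_invl.
- move=> X Y Z u [P [s [f [sW us]]]] v [Q [t [g [tW vt]]]].
  have [R [r [h [rW gr]]]] := ore g sW.
  exists R, (t @o r), (f @o h); split; first exact: W_comp.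
  rewrite !lmap_comp -us -(lcompE u v) compA.
  rewrite -[lcomp _ _]/((lclass u : @mor k L _ _) @o (lclass v : @mor k L _ _)).
  by rewrite -(compA _ (lclass v : @mor k L _ _)) vt -!compA -!lmap_comp (J_lmap_eq gr).
- move=> X Y u [P [s [f [sW us]]]] v [Q [t [g [tW vt]]]].
  have [R [r [h [rW sr]]]] := ore s tW.
  exists R, (s @o r), (f @o r + g @o h); split; first exact: W_comp.
  rewrite lmapD !lmap_comp -us -vt -(laddrE u v) compDl -!compA.
  by rewrite -!lmap_comp (J_lmap_eq sr).
- move=> X Y a u [P [s [f [sW us]]]]; exists P, s, (a *: f); split=> //.
  by rewrite lmapZ -us -lscalerE compZl.
Qed.

(** The candidate for the kernel of the localization, confirmed by [lmap_eq0]. It is a two-sided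
    ideal; stability under precomposition rests on the Ore condition. *)
Definition lnull (X Y : D) (f : mor X Y) : Prop :=
  exists P (t : mor P X), W t /\ J (f @o t).

Lemma lnull_J (X Y : D) (f : mor X Y) : J f -> lnull f.
Proof. by move=> fJ; exists X, (idm X); rewrite compm1. Qed.

Lemma lnull0 (X Y : D) : lnull (0 : mor X Y).
Proof. exact/lnull_J/J0. Qed.

Lemma lnullZ (X Y : D) a (f : mor X Y) : lnull f -> lnull (a *: f).
Proof. by move=> [P [t [tW fJ]]]; exists P, t; rewrite compZl; split=> //; exact: JZ. Qed.

Lemma lnull_compl (X Y Z : D) (g : mor Y Z) (f : mor X Y) : lnull f -> lnull (g @o f).
Proof.
by move=> [P [t [tW fJ]]]; exists P, t; rewrite -compA; split=> //; exact: J_compl.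
Qed.

Lemma lnull_compr (X Y Z : D) (g : mor Y Z) (f : mor X Y) : lnull g -> lnull (g @o f).
Proof.
move=> [P [t [tW gJ]]]; have [Q [r [h [rW fr]]]] := ore f tW.
exists Q, r; split=> //; rewrite -compA.
have -> : f @o r = t @o h + (f @o r - t @o h) by rewrite addrC subrK.
by rewrite compDr compA; apply: JD; [exact: J_compr | exact: J_compl].
Qed.

Lemma lnull_loc (X Y P : D) (f : mor X Y) (t : mor P X) : W t -> lnull (f @o t) -> lnull f.
Proof.
move=> tW [Q [r [rW fJ]]]; exists Q, (t @o r); split; first exact: W_comp.
by rewrite compA.
Qed.

Lemma lnullD (X Y : D) (f g : mor X Y) : lnull f -> lnull g -> lnull (f + g).
Proof.
move=> [P [t [tW fJ]]] gn; apply: (lnull_loc tW).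
have [Q [r [rW gJ]]] := lnull_compr t gn.
by exists Q, r; split=> //; rewrite !compDl; apply: JD => //; exact: J_compr.
Qed.

Lemma lnull_cancel (X Y Z : D) (s : mor Y Z) (f : mor X Y) :
  W s -> lnull (s @o f) -> lnull f.
Proof.
move=> sW [P [t [tW sf]]]; apply: (lnull_loc tW).
by apply: (cancel sW); rewrite compA.
Qed.

Definition lequiv (X Y : D) (f g : mor X Y) : Prop := lnull (f - g).
Local Notation "f ~~ g" := (lequiv f g) (at level 70).

Lemma lrefl (X Y : D) (f : mor X Y) : f ~~ f.
Proof. by rewrite /lequiv subrr; exact: lnull0. Qed.

Lemma lsym (X Y : D) (f g : mor X Y) : f ~~ g -> g ~~ f.
Proof. by rewrite /lequiv => /(lnullZ (-1)); rewrite scaleN1r opprB. Qed.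

Lemma ltrans (X Y : D) (f g h : mor X Y) : f ~~ g -> g ~~ h -> f ~~ h.
Proof. by rewrite /lequiv => fg gh; rewrite -(subrK g f) -addrA; exact: lnullD. Qed.

Lemma laddc (X Y : D) (f g f' g' : mor X Y) : f ~~ f' -> g ~~ g' -> f + g ~~ f' + g'.
Proof. by rewrite /lequiv => a b; rewrite opprD addrACA; exact: lnullD. Qed.

Lemma lscalec (X Y : D) a (f f' : mor X Y) : f ~~ f' -> a *: f ~~ a *: f'.
Proof. by rewrite /lequiv -scalerBr; exact: lnullZ. Qed.

Lemma lcompc (X Y Z : D) (g g' : mor Y Z) (f f' : mor X Y) :
  g ~~ g' -> f ~~ f' -> g @o f ~~ g' @o f'.
Proof.
move=> gg ff; apply: (@ltrans _ _ _ (g @o f')).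
  by rewrite /lequiv -compBr; exact: lnull_compl.
by rewrite /lequiv -compBl; exact: lnull_compr.
Qed.

Lemma lloc (X Y P : D) (f g : mor X Y) (t : mor P X) : W t -> f @o t ~~ g @o t -> f ~~ g.
Proof. by move=> tW; rewrite /lequiv -compBl; exact: lnull_loc. Qed.

Lemma lore (X Y Z : D) (f : mor X Y) (s : mor Z Y) : W s ->
  exists P (t : mor P X) (g : mor P Z), W t /\ f @o t ~~ s @o g.
Proof. by move=> /(ore f) [P [t [g [tW J']]]]; exists P, t, g; split=> //; exact: lnull_J. Qed.

(* [gam u w x] says that the value of the word [u] at the generalised element
   [w] is [x]; this graph model of the localization detects [lnull]. *)
Fixpoint gam (X Y : D) (u : word W X Y) : forall V : D, mor V X -> mor V Y -> Prop :=
  match u in word _ X Y return forall V : D, mor V X -> mor V Y -> Prop with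
  | wmap _ _ f => fun V w x => f @o w ~~ x
  | winv _ _ f _ => fun V w x => f @o x ~~ w
  | wcomp _ _ _ u v => fun V w z => exists P (t : mor P V) y,
      [/\ W t, gam v (w @o t) y & gam u y (z @o t)]
  | wadd _ _ u v => fun V w x => exists P (t : mor P V) y z,
      [/\ W t, gam u (w @o t) y, gam v (w @o t) z & x @o t ~~ y + z]
  | wscale _ _ a u => fun V w x => exists P (t : mor P V) y,
      [/\ W t, gam u (w @o t) y & x @o t ~~ a *: y]
  end.

Lemma gam_cong (X Y : D) (u : word W X Y) V (w w' : mor V X) (x x' : mor V Y) :
  w ~~ w' -> x ~~ x' -> gam u w x -> gam u w' x'.
Proof.
elim: u V w w' x x' => {X Y} /=.
- move=> X Y f V w w' x x' ww xx fw.
  apply: ltrans xx; apply: ltrans fw; apply: lcompc; first exact: lrefl.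
  exact: lsym.
- move=> X Y f _ V w w' x x' ww xx fw.
  apply: ltrans ww; apply: ltrans fw; apply: lcompc; first exact: lrefl.
  exact: lsym.
- move=> X Y Z u IHu v IHv V w w' x x' ww xx [P [t [y [tW gv gu]]]].
  exists P, t, y; split=> //.
    by apply: IHv gv; [apply: lcompc => //|]; exact: lrefl.
  by apply: IHu gu; [|apply: lcompc => //]; exact: lrefl.
- move=> X Y u IHu v IHv V w w' x x' ww xx [P [t [y [z [tW gu gv e]]]]].
  exists P, t, y, z; split=> //.
  + by apply: IHu gu; [apply: lcompc => //|]; exact: lrefl.
  + by apply: IHv gv; [apply: lcompc => //|]; exact: lrefl.
  + by apply: ltrans e; apply: lcompc; [exact: lsym|exact: lrefl].
- move=> X Y a u IHu V w w' x x' ww xx [P [t [y [tW gu e]]]].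
  exists P, t, y; split=> //.
  + by apply: IHu gu; [apply: lcompc => //|]; exact: lrefl.
  + by apply: ltrans e; apply: lcompc; [exact: lsym|exact: lrefl].
Qed.

Lemma gam_congl (X Y : D) (u : word W X Y) V (w w' : mor V X) (x : mor V Y) :
  w ~~ w' -> gam u w x -> gam u w' x.
Proof. by move=> ww; apply: gam_cong => //; exact: lrefl. Qed.

Lemma gam_congr (X Y : D) (u : word W X Y) V (w : mor V X) (x x' : mor V Y) :
  x ~~ x' -> gam u w x -> gam u w x'.
Proof. by move=> xx; apply: gam_cong => //; exact: lrefl. Qed.

Lemma gam_pre (X Y : D) (u : word W X Y) V P (w : mor V X) (x : mor V Y) (g : mor P V) :
  gam u w x -> gam u (w @o g) (x @o g).
Proof.
elim: u V P w x g => {X Y} /=.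
- by move=> X Y f V P w x g fw; rewrite compA; apply: lcompc => //; exact: lrefl.
- by move=> X Y f _ V P w x g fw; rewrite compA; apply: lcompc => //; exact: lrefl.
- move=> X Y Z u IHu v IHv V P w x g [Q [t [y [tW gv gu]]]].
  have [R [r [h [rW e]]]] := lore g tW.
  exists R, r, (y @o h); split=> //.
    apply: gam_congl (IHv _ _ _ _ h gv); rewrite -!compA; apply: lcompc; first exact: lrefl.
    exact: lsym.
  apply: gam_congr (IHu _ _ _ _ h gu); rewrite -!compA; apply: lcompc; first exact: lrefl.
  exact: lsym.
- move=> X Y u IHu v IHv V P w x g [Q [t [y [z [tW gu gv f]]]]].
  have [R [r [h [rW e]]]] := lore g tW.
  exists R, r, (y @o h), (z @o h); split=> //.
  + apply: gam_congl (IHu _ _ _ _ h gu); rewrite -!compA; apply: lcompc; first exact: lrefl.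
    exact: lsym.
  + apply: gam_congl (IHv _ _ _ _ h gv); rewrite -!compA; apply: lcompc; first exact: lrefl.
    exact: lsym.
  + rewrite -compDl; apply: (@ltrans _ _ _ (x @o t @o h)).
      by rewrite -!compA; apply: lcompc => //; exact: lrefl.
    by apply: lcompc => //; exact: lrefl.
- move=> X Y a u IHu V P w x g [Q [t [y [tW gu f]]]].
  have [R [r [h [rW e]]]] := lore g tW.
  exists R, r, (y @o h); split=> //.
  + apply: gam_congl (IHu _ _ _ _ h gu); rewrite -!compA; apply: lcompc; first exact: lrefl.
    exact: lsym.
  + rewrite -compZl; apply: (@ltrans _ _ _ (x @o t @o h)).
      by rewrite -!compA; apply: lcompc => //; exact: lrefl.
    by apply: lcompc => //; exact: lrefl.
Qed.

(** With [gam_uniq] this makes [gam u] the graph of a function: values exist after a change of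
    domain in [W] and are unique modulo [lnull]. *)
Lemma gam_total (X Y : D) (u : word W X Y) V (w : mor V X) :
  exists P (t : mor P V) x, W t /\ gam u (w @o t) x.
Proof.
elim: u V w => {X Y} /=.
- by move=> X Y f V w; exists V, (idm V), (f @o w); rewrite compm1; split=> //; exact: lrefl.
- move=> X Y f fW V w; have [P [t [g [tW e]]]] := lore w fW.
  by exists P, t, g; split=> //; exact: lsym.
- move=> X Y Z u IHu v IHv V w; have [P [t [y [tW gv]]]] := IHv V w.
  have [Q [r [z [rW gu]]]] := IHu P y.
  exists Q, (t @o r), z; split; first exact: W_comp.
  exists Q, (idm Q), (y @o r); rewrite !compm1; split=> //.
  by rewrite compA; exact: gam_pre.
- move=> X Y u IHu v IHv V w; have [P [t [y [tW gu]]]] := IHu V w.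
  have [Q [r [z [rW gv]]]] := IHv P (w @o t).
  exists Q, (t @o r), (y @o r + z); split; first exact: W_comp.
  exists Q, (idm Q), (y @o r), z; rewrite !compm1 !compA; split=> //; last exact: lrefl.
  exact: gam_pre.
- move=> X Y a u IHu V w; have [P [t [y [tW gu]]]] := IHu V w.
  exists P, t, (a *: y); split=> //; exists P, (idm P), y; rewrite !compm1; split=> //.
  exact: lrefl.
Qed.

Lemma gam_uniq (X Y : D) (u : word W X Y) V (w w' : mor V X) (x x' : mor V Y) :
  w ~~ w' -> gam u w x -> gam u w' x' -> x ~~ x'.
Proof.
elim: u V w w' x x' => {X Y} /=.
- move=> X Y f V w w' x x' ww fx fx'; apply: ltrans fx'.
  apply: ltrans (lsym fx) _; apply: lcompc => //; exact: lrefl.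
(* For a formal inverse, uniqueness of the value is left cancellation of [f]. *)
- move=> X Y f fW V w w' x x' ww fx fx'; apply: (lnull_cancel fW).
  by rewrite compBr; apply: ltrans fx _; apply: ltrans ww _; exact: lsym.
- move=> X Y Z u IHu v IHv V w w' x x' ww [P [t [y [tW gv gu]]]] [Q [r [z [rW gv' gu']]]].
  have [R [p [q [pW e]]]] := lore t rW.
  apply: (lloc (W_comp tW pW)).
  have yz : y @o p ~~ z @o q.
    apply: IHv (gam_pre p gv) (gam_pre q gv'); rewrite -!compA; exact: lcompc.
  have := IHu _ _ _ _ _ yz (gam_pre p gu) (gam_pre q gu').
  rewrite -!compA => f; apply: ltrans f _; apply: lcompc; [exact: lrefl|exact: lsym].
- move=> X Y u IHu v IHv V w w' x x' ww.
  move=> [P [t [y [z [tW gu gv f]]]]] [Q [r [y' [z' [rW gu' gv' f']]]]].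
  have [R [p [q [pW e]]]] := lore t rW.
  apply: (lloc (W_comp tW pW)).
  have yy : y @o p ~~ y' @o q.
    apply: IHu (gam_pre p gu) (gam_pre q gu'); rewrite -!compA; exact: lcompc.
  have zz : z @o p ~~ z' @o q.
    apply: IHv (gam_pre p gv) (gam_pre q gv'); rewrite -!compA; exact: lcompc.
  apply: (@ltrans _ _ _ ((y + z) @o p)).
    by rewrite compA; apply: lcompc => //; exact: lrefl.
  rewrite compDl; apply: ltrans (laddc yy zz) _; rewrite -compDl.
  apply: (@ltrans _ _ _ (x' @o r @o q)).
    by apply: lcompc; [exact: lsym|exact: lrefl].
  by rewrite -compA; apply: lcompc; [exact: lrefl|exact: lsym].
- move=> X Y a u IHu V w w' x x' ww.
  move=> [P [t [y [tW gu f]]]] [Q [r [y' [rW gu' f']]]].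
  have [R [p [q [pW e]]]] := lore t rW.
  apply: (lloc (W_comp tW pW)).
  have yy : y @o p ~~ y' @o q.
    apply: IHu (gam_pre p gu) (gam_pre q gu'); rewrite -!compA; exact: lcompc.
  apply: (@ltrans _ _ _ ((a *: y) @o p)).
    by rewrite compA; apply: lcompc => //; exact: lrefl.
  rewrite compZl; apply: ltrans (lscalec a yy) _; rewrite -compZl.
  apply: (@ltrans _ _ _ (x' @o r @o q)).
    by apply: lcompc; [exact: lsym|exact: lrefl].
  by rewrite -compA; apply: lcompc; [exact: lrefl|exact: lsym].
Qed.

Lemma gam_compI (X Y Z : D) (u : word W Y Z) (v : word W X Y) V (w : mor V X) y z :
  gam v w y -> gam u y z -> gam (wcomp u v) w z.
Proof. by move=> gv gu; exists V, (idm V), y; rewrite !compm1. Qed.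

Lemma gam_addI (X Y : D) (u v : word W X Y) V (w : mor V X) y z :
  gam u w y -> gam v w z -> gam (wadd u v) w (y + z).
Proof.
by move=> gv gu; exists V, (idm V), y, z; rewrite !compm1; split=> //; exact: lrefl.
Qed.

Lemma gam_scaleI (X Y : D) a (u : word W X Y) V (w : mor V X) y :
  gam u w y -> gam (wscale a u) w (a *: y).
Proof. by move=> gu; exists V, (idm V), y; rewrite !compm1; split=> //; exact: lrefl. Qed.

Lemma gam_mapI (X Y : D) (f : mor X Y) V (w : mor V X) : gam (wmap W f) w (f @o w).
Proof. exact: lrefl. Qed.

Lemma gam_scale (X Y : D) a (u : word W X Y) V (w : mor V X) x :
  gam u w x -> gam u (a *: w) (a *: x).
Proof.
elim: u V w x => {X Y} /=.
- by move=> X Y f V w x e; rewrite compZr; exact: lscalec.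
- by move=> X Y f _ V w x e; rewrite compZr; exact: lscalec.
- move=> X Y Z u IHu v IHv V w x [P [t [y [tW gv gu]]]].
  by exists P, t, (a *: y); rewrite !compZl; split=> //; [exact: IHv|exact: IHu].
- move=> X Y u IHu v IHv V w x [P [t [y [z [tW gu gv e]]]]].
  exists P, t, (a *: y), (a *: z); rewrite !compZl -scalerDr; split=> //;
    [exact: IHu|exact: IHv|exact: lscalec].
- move=> X Y b u IHu V w x [P [t [y [tW gu e]]]].
  exists P, t, (a *: y); rewrite !compZl scalerA mulrC -scalerA; split=> //;
    [exact: IHu|exact: lscalec].
Qed.

Lemma gam_add (X Y : D) (u : word W X Y) V (w w' : mor V X) x x' :
  gam u w x -> gam u w' x' -> gam u (w + w') (x + x').
Proof.
elim: u V w w' x x' => {X Y} /=.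
- by move=> X Y f V w w' x x' e e'; rewrite compDr; exact: laddc.
- by move=> X Y f _ V w w' x x' e e'; rewrite compDr; exact: laddc.
- move=> X Y Z u IHu v IHv V w w' x x'.
  move=> [P [t [y [tW gv gu]]]] [Q [r [y' [rW gv' gu']]]].
  have [R [p [q [pW /lsym e]]]] := lore t rW.
  exists R, (t @o p), (y @o p + y' @o q); rewrite !compDl; split; first exact: W_comp.
    apply: IHv; first by rewrite compA; exact: gam_pre.
    apply: gam_congl (gam_pre q gv'); rewrite -compA; apply: lcompc => //; exact: lrefl.
  apply: IHu; first by rewrite compA; exact: gam_pre.
  apply: gam_congr (gam_pre q gu'); rewrite -compA; apply: lcompc => //; exact: lrefl.
- move=> X Y u IHu v IHv V w w' x x'.
  move=> [P [t [y [z [tW gu gv f]]]]] [Q [r [y' [z' [rW gu' gv' f']]]]].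
  have [R [p [q [pW e]]]] := lore t rW; have e' := lsym e.
  exists R, (t @o p), (y @o p + y' @o q), (z @o p + z' @o q); rewrite !compDl.
  split; first exact: W_comp.
  + apply: IHu; first by rewrite compA; exact: gam_pre.
    apply: gam_congl (gam_pre q gu'); rewrite -compA; apply: lcompc => //; exact: lrefl.
  + apply: IHv; first by rewrite compA; exact: gam_pre.
    apply: gam_congl (gam_pre q gv'); rewrite -compA; apply: lcompc => //; exact: lrefl.
  + rewrite addrACA -(compDl y z) -(compDl y' z'); apply: laddc.
      by rewrite compA; apply: lcompc => //; exact: lrefl.
    apply: (@ltrans _ _ _ (x' @o (r @o q))); first by apply: lcompc => //; exact: lrefl.
    by rewrite compA; apply: lcompc => //; exact: lrefl.
- move=> X Y a u IHu V w w' x x'.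
  move=> [P [t [y [tW gu f]]]] [Q [r [y' [rW gu' f']]]].
  have [R [p [q [pW e]]]] := lore t rW; have e' := lsym e.
  exists R, (t @o p), (y @o p + y' @o q); rewrite !compDl.
  split; first exact: W_comp.
  + apply: IHu; first by rewrite compA; exact: gam_pre.
    apply: gam_congl (gam_pre q gu'); rewrite -compA; apply: lcompc => //; exact: lrefl.
  + rewrite scalerDr -!compZl; apply: laddc.
      by rewrite compA; apply: lcompc => //; exact: lrefl.
    apply: (@ltrans _ _ _ (x' @o (r @o q))); first by apply: lcompc => //; exact: lrefl.
    by rewrite compA; apply: lcompc => //; exact: lrefl.
Qed.

(** Asking for one common value, rather than for equality of the two relations, reduces each axiom
    of [weq] to exhibiting a value. *)
Lemma weq_gam (X Y : D) (u v : word W X Y) : weq u v ->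
  forall V (w : mor V X), exists P (t : mor P V) x,
    [/\ W t, gam u (w @o t) x & gam v (w @o t) x].
Proof.
pose tot := gam_total.
elim=> {X Y u v}.
- by move=> X Y u V w; have [P [t [x [tW g]]]] := tot _ _ u V w; exists P, t, x.
- by move=> X Y u v _ IH V w; have [P [t [x [tW g g']]]] := IH V w; exists P, t, x.
(* Transitivity: the two values of the middle word agree by [gam_uniq]. *)
- move=> X Y u v w' _ IH1 _ IH2 V w.
  have [P [t [x [tW g1 g2]]]] := IH1 V w.
  have [Q [r [y [rW g3 g4]]]] := IH2 P (w @o t).
  exists Q, (t @o r), y; rewrite compA; split=> //; first exact: W_comp.
  apply: gam_congr (gam_pre r g1); apply: gam_uniq (gam_pre r g2) g3; exact: lrefl.
- move=> X Y Z u u' v v' _ IHu _ IHv V w.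
  have [P [t [y [tW g1 g2]]]] := IHv V w.
  have [Q [r [z [rW g3 g4]]]] := IHu P y.
  exists Q, (t @o r), z; rewrite compA; split; first exact: W_comp.
    exact: gam_compI (gam_pre r g1) g3.
  exact: gam_compI (gam_pre r g2) g4.
- move=> X Y u u' v v' _ IHu _ IHv V w.
  have [P [t [y [tW g1 g2]]]] := IHu V w.
  have [Q [r [z [rW g3 g4]]]] := IHv P (w @o t).
  exists Q, (t @o r), (y @o r + z); rewrite compA; split; first exact: W_comp.
    exact: gam_addI (gam_pre r g1) g3.
  exact: gam_addI (gam_pre r g2) g4.
- move=> X Y a u u' _ IH V w; have [P [t [x [tW g g']]]] := IH V w.
  by exists P, t, (a *: x); split=> //; exact: gam_scaleI.
- move=> X Y Z T u v w' V w.
  have [P [t [x [tW g1]]]] := tot _ _ w' V w.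
  have [Q [r [y [rW g2]]]] := tot _ _ v P x.
  have [R [p [z [pW g3]]]] := tot _ _ u Q y.
  exists R, (t @o (r @o p)), z; split; first by do !apply: W_comp.
    rewrite !compA; apply: gam_compI g3; apply: gam_compI (gam_pre p g2).
    by apply: gam_pre; exact: gam_pre.
  rewrite !compA; apply: gam_compI (gam_compI (gam_pre p g2) g3).
  by apply: gam_pre; exact: gam_pre.
- move=> X Y u V w; have [P [t [x [tW g]]]] := tot _ _ u V w; exists P, t, x; split=> //.
  by apply: gam_compI g _; rewrite /= comp1m; exact: lrefl.
- move=> X Y u V w; have [P [t [x [tW g]]]] := tot _ _ u V w; exists P, t, x; split=> //.
  by apply: gam_compI g; rewrite /= comp1m; exact: lrefl.
- move=> X Y Z u u' v V w.
  have [P [t [x [tW g1]]]] := tot _ _ v V w.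
  have [Q [r [y [rW g2]]]] := tot _ _ u P x.
  have [R [p [z [pW g3]]]] := tot _ _ u' Q (x @o r).
  have g1' := gam_pre p (gam_pre r g1); have g2' := gam_pre p g2.
  exists R, (t @o (r @o p)), (y @o p + z); rewrite !compA.
  split; first by do !apply: W_comp.
    exact: gam_compI g1' (gam_addI g2' g3).
  exact: gam_addI (gam_compI g1' g2') (gam_compI g1' g3).
- move=> X Y Z u v v' V w.
  have [P [t [x [tW g1]]]] := tot _ _ v V w.
  have [P' [t' [x' [tW' g1']]]] := tot _ _ v' P (w @o t).
  have [Q [r [y [rW g2]]]] := tot _ _ u P' (x @o t').
  have [R [p [z [pW g3]]]] := tot _ _ u Q (x' @o r).
  have h1 := gam_pre p (gam_pre r (gam_pre t' g1)); have h2 := gam_pre p (gam_pre r g1').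
  have h3 := gam_pre p g2.
  exists R, (t @o (t' @o (r @o p))), (y @o p + z); rewrite !compA.
  split; first by do !apply: W_comp.
    exact: gam_compI (gam_addI h1 h2) (gam_add h3 g3).
  exact: gam_addI (gam_compI h1 h3) (gam_compI h2 g3).
- move=> X Y Z a u v V w.
  have [P [t [x [tW g1]]]] := tot _ _ v V w.
  have [Q [r [y [rW g2]]]] := tot _ _ u P x.
  exists Q, (t @o r), (a *: y); rewrite !compA; split; first exact: W_comp.
    exact: gam_compI (gam_pre r g1) (gam_scaleI a g2).
  exact: gam_scaleI (gam_compI (gam_pre r g1) g2).
- move=> X Y Z a u v V w.
  have [P [t [x [tW g1]]]] := tot _ _ v V w.
  have [Q [r [y [rW g2]]]] := tot _ _ u P x.
  exists Q, (t @o r), (a *: y); rewrite !compA; split; first exact: W_comp.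
    exact: gam_compI (gam_scaleI a (gam_pre r g1)) (gam_scale a g2).
  exact: gam_scaleI (gam_compI (gam_pre r g1) g2).
- move=> X Y u v w' V w.
  have [P [t [x [tW g1]]]] := tot _ _ u V w.
  have [Q [r [y [rW g2]]]] := tot _ _ v P (w @o t).
  have [R [p [z [pW g3]]]] := tot _ _ w' Q (w @o t @o r).
  have h1 := gam_pre p (gam_pre r g1); have h2 := gam_pre p g2.
  exists R, (t @o (r @o p)), (x @o r @o p + (y @o p + z)); rewrite !compA.
  split; first by do !apply: W_comp.
    exact: gam_addI h1 (gam_addI h2 g3).
  by rewrite addrA; exact: gam_addI (gam_addI h1 h2) g3.
- move=> X Y u v V w.
  have [P [t [x [tW g1]]]] := tot _ _ u V w.
  have [Q [r [y [rW g2]]]] := tot _ _ v P (w @o t).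
  have h1 := gam_pre r g1.
  exists Q, (t @o r), (x @o r + y); rewrite !compA; split; first exact: W_comp.
    exact: gam_addI h1 g2.
  by rewrite addrC; exact: gam_addI g2 h1.
- move=> X Y u V w; have [P [t [x [tW g]]]] := tot _ _ u V w; exists P, t, x; split=> //.
  have := gam_addI (gam_mapI 0 (w @o t)) g.
  by rewrite comp0m add0r.
- move=> X Y u V w; have [P [t [x [tW g]]]] := tot _ _ u V w.
  exists P, t, 0; split=> //; last by rewrite /= comp0m; exact: lrefl.
  by have := gam_addI (gam_scaleI (-1) g) g; rewrite scaleN1r addNr.
- move=> X Y a b u V w; have [P [t [x [tW g]]]] := tot _ _ u V w.
  exists P, t, (a *: (b *: x)); split=> //; first exact/gam_scaleI/gam_scaleI.
  by rewrite scalerA; exact: gam_scaleI.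
- move=> X Y u V w; have [P [t [x [tW g]]]] := tot _ _ u V w.
  by exists P, t, x; split=> //; have := gam_scaleI 1 g; rewrite scale1r.
- move=> X Y a u v V w.
  have [P [t [x [tW g1]]]] := tot _ _ u V w.
  have [Q [r [y [rW g2]]]] := tot _ _ v P (w @o t).
  have h1 := gam_pre r g1.
  exists Q, (t @o r), (a *: (x @o r + y)); rewrite !compA; split; first exact: W_comp.
    exact: gam_scaleI (gam_addI h1 g2).
  by rewrite scalerDr; exact: gam_addI (gam_scaleI a h1) (gam_scaleI a g2).
- move=> X Y a b u V w; have [P [t [x [tW g]]]] := tot _ _ u V w.
  exists P, t, ((a + b) *: x); split=> //; first exact: gam_scaleI.
  by rewrite scalerDl; apply: gam_addI; exact: gam_scaleI.
- move=> X Y Z g f V w; exists V, (idm V), (g @o (f @o w)); rewrite compm1.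
  split=> //; first by rewrite /= compA; exact: lrefl.
  exact: gam_compI (gam_mapI f w) (gam_mapI g _).
- move=> X Y f g V w; exists V, (idm V), ((f + g) @o w); rewrite compm1.
  split=> //; first exact: gam_mapI.
  by rewrite compDl; exact: gam_addI (gam_mapI f w) (gam_mapI g w).
- move=> X Y a f V w; exists V, (idm V), (a *: f @o w); rewrite compm1.
  split=> //; first exact: gam_mapI.
  by rewrite compZl; exact: gam_scaleI (gam_mapI f w).
- move=> X Y f fW V w; exists V, (idm V), w; rewrite compm1; split=> //.
    by apply: gam_compI (gam_mapI f w) _; exact: lrefl.
  by rewrite /= comp1m; exact: lrefl.
- move=> X Y f fW V w; have [P [t [x [tW g]]]] := tot _ _ (winv fW) V w.
  exists P, t, (w @o t); split=> //.
    exact: (@gam_compI _ _ _ (wmap W f) (winv fW) _ _ x _ g g).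
  by rewrite /= comp1m; exact: lrefl.
Qed.

(** Evaluated at the identity, the words of [f] and of 0 have a common value, which is both [f t]
    and 0 modulo [lnull]. *)
Lemma lmap_eq0 (X Y : D) (f : mor X Y) : [f] = 0 ->
  exists P (t : mor P X), W t /\ J (f @o t).
Proof.
move=> /lclassP /weq_gam /(_ X (idm X)) [P [t [x [tW]]]] /=.
rewrite comp1m comp0m => fx x0.
by apply: (lnull_loc tW); move: (ltrans fx (lsym x0)); rewrite /lequiv subr0.
Qed.

End Fractions.

(** * Exact triangles in the derived category *)

Section ExactTriangles.
Variables (k : fieldType) (T : klin_cat k) (C : abelian_cat k).
Variables (S : lfunctor T T) (H : int -> lfunctor T C).

(** What a distinguished triangle yields at one vertex: exactness under [Hom] in either variable and
    under each cohomology functor. *)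
Record hexact (X Y Z : T) (f : mor X Y) (g : mor Y Z) : Prop := HExact {
  hex0 : g @o f = 0;
  hex_lift : forall W (b : mor W Y), g @o b = 0 -> exists a, b = f @o a;
  hex_ext : forall W (b : mor Y W), b @o f = 0 -> exists a, b = a @o g;
  hex_coh : forall i, lexact (fmor (H i) f) (fmor (H i) g)
}.

(* The axioms of a triangulated category are replaced by exactness: no map is
   required to extend to a morphism of triangles. *)
Record extri (X Y Z : T) (f : mor X Y) (g : mor Y Z) (h : mor Z (S X)) : Prop :=
  Extri {
    tri1 : hexact f g;
    tri2 : hexact g h;
    tri3 : hexact h (fmor S f)
  }.

Lemma hexact_conj (X Y Z X' Y' Z' : T) (f : mor X Y) (g : mor Y Z)
    (f' : mor X' Y') (g' : mor Y' Z') (a : mor X X') (b : mor Y Y') (c : mor Z Z') :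
  is_iso a -> is_iso b -> is_iso c -> b @o f = f' @o a -> c @o g = g' @o b ->
  hexact f g -> hexact f' g'.
Proof.
move=> ai bi ci e1 e2 [gf lift ext coh].
have [a' [a'a aa']] := ai; have [b' [b'b bb']] := bi; have [c' [c'c cc']] := ci.
have e1' : b' @o f' = f @o a'.
  by apply: (iso_cancelr ai); rewrite -!compA a'a -e1 compm1 compA b'b comp1m.
have e2' : c' @o g' = g @o b'.
  by apply: (iso_cancelr bi); rewrite -!compA b'b -e2 compm1 compA c'c comp1m.
split.
- by apply: (iso_cancelr ai); rewrite comp0m -compA -e1 compA -e2 -compA gf compm0.
- move=> W y gy; have [x xE] : exists x, b' @o y = f @o x.
    by apply: lift; rewrite compA -e2' -compA gy compm0.
  by exists (a @o x); rewrite compA -e1 -compA -xE compA bb' comp1m.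
- move=> W y yf; have [x xE] : exists x, y @o b = x @o g.
    by apply: ext; rewrite -compA e1 compA yf comp0m.
  by exists (x @o c'); rewrite -compA e2' compA -xE -compA bb' compm1.
- move=> i; apply: lexact_conj (coh i).
  + exact: fmor_iso ai.
  + exact: fmor_iso bi.
  + exact: fmor_iso ci.
  + by rewrite -!fmor_comp e1.
  + by rewrite -!fmor_comp e2.
Qed.

(** A morphism of the derived category is a roof, and a cone exists only for its numerator; the
    denominator is absorbed here. *)
Lemma extri_source (X X' Y Z : T) (s : mor X' X) (f : mor X Y) (f' : mor X' Y) (g : mor Y Z)
    (h : mor Z (S X')) :
  is_iso s -> f @o s = f' -> extri f' g h -> extri f g (fmor S s @o h).
Proof.
move=> si e [t1 t2 t3].
have Si := fmor_iso S si; have id1 := @is_iso_id _ T.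
split.
- by apply: hexact_conj t1;
    [exact: si|exact: id1|exact: id1|rewrite comp1m e|rewrite comp1m compm1].
- by apply: hexact_conj t2;
    [exact: id1|exact: id1|exact: Si|rewrite comp1m compm1|rewrite compm1].
- apply: hexact_conj t3; [exact: id1|exact: Si|exact: id1|by rewrite compm1|].
  by rewrite comp1m -fmor_comp e.
Qed.

End ExactTriangles.

Arguments extri {k T C} S H {X Y Z} f g h : rename.

(** * Functors and triangles on the bounded derived category *)

Section DbTheory.
Variables (k : fieldType) (C : abelian_cat k).
Implicit Types X Y Z V : bcomplex C.

Definition qmap X Y (f : chain_map X Y) : @mor k (Db C) X Y :=
  lmap (D := chain_cat C) (@quasi_iso k C) f.

Lemma qmap_id X : qmap (chain_id X) = idm (X : Db C).
Proof. by []. Qed.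

Lemma qmapC X Y Z (g : chain_map Y Z) (f : chain_map X Y) :
  qmap (chain_comp g f) = qmap g @o qmap f.
Proof. exact: (@lmap_comp _ (chain_cat C)). Qed.

Lemma qmapD X Y (f g : chain_map X Y) : qmap (f + g) = qmap f + qmap g.
Proof. exact: (@lmapD _ (chain_cat C)). Qed.

Lemma qmapZ X Y a (f : chain_map X Y) : qmap (a *: f) = a *: qmap f.
Proof. exact: (@lmapZ _ (chain_cat C)). Qed.

Lemma qmapB X Y (f g : chain_map X Y) : qmap (f - g) = qmap f - qmap g.
Proof. by rewrite -scaleN1r qmapD qmapZ scaleN1r. Qed.

Lemma qmap_iso X Y (f : chain_map X Y) : quasi_iso f -> is_iso (qmap f).
Proof. exact: (@lmap_iso _ (chain_cat C)). Qed.

(** The zero endomorphism of an acyclic complex is a quasi-isomorphism, so zero becomes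
    invertible. *)
Lemma acyclic_zero X : acyclic X -> is_zero_ob (X : Db C).
Proof.
move=> X0; apply/zero_obP.
have [g [g0 _]] := qmap_iso (acyclic_quasi_iso (0 : chain_map X X) X0 X0).
have q0 : qmap (0 : chain_map X X) = 0 by rewrite -(scale0r 0) qmapZ scale0r.
by rewrite -g0 q0 compm0.
Qed.

(** A null-homotopic map extends over the cone of the identity, which is acyclic and hence a zero
    object. *)
Lemma qmap_null X Y (f : chain_map X Y) : null f -> qmap f = 0.
Proof.
move=> fn; have [|x <-] := @cone_extend _ _ _ _ Y (chain_id X) f.
  by move: fn; congr null; apply: chain_mapP => i /=; rewrite compm1.
have [N0 _] := acyclic_zero (cone_acyclic (@quasi_iso_id _ _ X)).
by rewrite qmapC (N0 _ (qmap (cone_in _))) compm0.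
Qed.

Lemma qmap_eq X Y (f g : chain_map X Y) : null (f - g) -> qmap f = qmap g.
Proof. by move=> /qmap_null; rewrite qmapB => /eqP; rewrite subr_eq0 => /eqP. Qed.

Lemma roof X Y (x : @mor k (Db C) X Y) :
  exists (P : bcomplex C) (s : chain_map P X) (f : chain_map P Y),
    quasi_iso s /\ x @o qmap s = qmap f.
Proof.
apply: (@roof_ex _ (chain_cat C) (@quasi_iso k C) (@null k C)).
- exact: quasi_iso_id.
- exact: quasi_iso_comp.
- exact: chain_ore.
- exact: qmap_null.
Qed.

Lemma qmap_eq0 X Y (f : chain_map X Y) : qmap f = 0 ->
  exists P (t : chain_map P X), quasi_iso t /\ null (chain_comp f t).
Proof.
apply: (@lmap_eq0 _ (chain_cat C) (@quasi_iso k C) (@null k C)).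
- exact: quasi_iso_id.
- exact: quasi_iso_comp.
- exact: null0.
- exact: nullD.
- exact: nullZ.
- exact: null_compl.
- exact: null_compr.
- exact: chain_ore.
- exact: chain_cancel.
Qed.

Definition chain_shift (s : int) : lfunctor (chain_cat C) (Db C).
Proof.
refine (@LFunctor k (chain_cat C) (Db C) (fun X => cshift X s)
  (fun X Y f => qmap (cshift_map f s)) _ _ _ _).
- by move=> X; rewrite -qmap_id; congr qmap; exact: chain_mapP.
- by move=> X Y Z g f; rewrite -qmapC; congr qmap; exact: chain_mapP.
- by move=> X Y f g; rewrite -qmapD; congr qmap; exact: chain_mapP.
- by move=> X Y a f; rewrite -qmapZ; congr qmap; exact: chain_mapP.
Defined.

Lemma chain_shift_qis s (X Y : chain_cat C) (f : mor X Y) :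
  quasi_iso f -> is_iso (fmor (chain_shift s) f).
Proof. by move=> fq; apply: qmap_iso; exact: quasi_iso_shift. Qed.

Definition shiftF (s : int) : lfunctor (Db C) (Db C) :=
  @lext k (chain_cat C) (Db C) (@quasi_iso k C) (chain_shift s) (@chain_shift_qis s).

Lemma shiftFE s X Y (f : chain_map X Y) :
  fmor (shiftF s) (qmap f) = qmap (cshift_map f s).
Proof. exact: (@lextE _ (chain_cat C) _ _ _ (@chain_shift_qis s)). Qed.

Definition chain_coh (i : int) : lfunctor (chain_cat C) C.
Proof.
refine (@LFunctor k (chain_cat C) C (fun X => coh X i)
  (fun X Y f => coh_map f i) _ _ _ _).
- by move=> X; exact: coh_map_id.
- by move=> X Y Z g f; exact: coh_map_comp.
- by move=> X Y f g; exact: coh_mapD.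
- by move=> X Y a f; exact: coh_mapZ.
Defined.

Lemma chain_coh_qis i (X Y : chain_cat C) (f : mor X Y) :
  quasi_iso f -> is_iso (fmor (chain_coh i) f).
Proof. exact. Qed.

Definition cohF (i : int) : lfunctor (Db C) C :=
  @lext k (chain_cat C) C (@quasi_iso k C) (chain_coh i) (@chain_coh_qis i).

Lemma cohFE i X Y (f : chain_map X Y) : fmor (cohF i) (qmap f) = coh_map f i.
Proof. exact: (@lextE _ (chain_cat C) _ _ _ (@chain_coh_qis i)). Qed.

(** Naturality for chain maps suffices, since every morphism becomes one after composition with an
    isomorphism. *)
Lemma nat_ext (E : klin_cat k) (F G : lfunctor (Db C) E) (n : forall X, mor (F X) (G X)) :
  (forall X Y (f : chain_map X Y), fmor G (qmap f) @o n X = n Y @o fmor F (qmap f)) ->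
  forall (X Y : Db C) (x : mor X Y), fmor G x @o n X = n Y @o fmor F x.
Proof.
move=> nat X Y x; have [P [s [f [sq e]]]] := roof x.
apply: (iso_cancelr (fmor_iso F (qmap_iso sq))).
by rewrite -!compA -nat -fmor_comp e compA -fmor_comp e nat.
Qed.

Definition comp_functor (E E' : klin_cat k) (G : lfunctor E E') (F : lfunctor (Db C) E) :
  lfunctor (Db C) E'.
Proof.
refine (@LFunctor k (Db C) E' (fun X => G (F X)) (fun X Y f => fmor G (fmor F f)) _ _ _ _).
- by move=> X; rewrite !fmor_id.
- by move=> X Y Z g f; rewrite !fmor_comp.
- by move=> X Y f g; rewrite !fmorD.
- by move=> X Y a f; rewrite !fmorZ.
Defined.

Lemma comp_functorE (E E' : klin_cat k) (G : lfunctor E E') (F : lfunctor (Db C) E)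
  (X Y : Db C) (x : mor X Y) : fmor (comp_functor G F) x = fmor G (fmor F x).
Proof. by []. Qed.

Definition id_functor : lfunctor (Db C) (Db C).
Proof. by refine (@LFunctor k (Db C) (Db C) (fun X => X) (fun X Y f => f) _ _ _ _). Defined.

Lemma shiftF_add (s t u : int) : s + t = u ->
  exists n : forall X, mor (shiftF t (shiftF s X)) (shiftF u X),
    (forall X, is_iso (n X)) /\
    forall (X Y : Db C) (x : mor X Y),
      fmor (shiftF u) x @o n X = n Y @o fmor (shiftF t) (fmor (shiftF s) x).
Proof.
move=> <-; exists (fun X => qmap (shift_add X s t)); split.
  move=> X; apply: qmap_iso.
  exact: quasi_iso_chain_iso (shift_addK X s t) (shift_addVK X s t).
apply: (@nat_ext _ (comp_functor (shiftF t) (shiftF s)) (shiftF (s + t))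
         (fun X => qmap (shift_add X s t))) => X Y f.
by rewrite comp_functorE !shiftFE -!qmapC shift_add_nat.
Qed.

Lemma shiftF_zero (s : int) : s = 0 ->
  exists n : forall X : Db C, mor (shiftF s X) X,
    (forall X, is_iso (n X)) /\
    forall (X Y : Db C) (x : mor X Y), x @o n X = n Y @o fmor (shiftF s) x.
Proof.
move=> ->; exists (fun X => qmap (shift_zero X)); split.
  move=> X; apply: qmap_iso.
  exact: quasi_iso_chain_iso (shift_zeroK X) (shift_zeroVK X).
apply: (@nat_ext _ (shiftF 0) id_functor (fun X => qmap (shift_zero X))) => X Y f.
by rewrite shiftFE -!qmapC -shift_zero_nat qmapC.
Qed.

Lemma shiftF_inv (s t : int) : s + t = 0 ->
  exists n : forall X : Db C, mor (shiftF t (shiftF s X)) X,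
    (forall X, is_iso (n X)) /\
    forall (X Y : Db C) (x : mor X Y),
      x @o n X = n Y @o fmor (shiftF t) (fmor (shiftF s) x).
Proof.
move=> /shiftF_add [n [ni nn]]; have [m [mi mn]] := shiftF_zero (erefl 0).
exists (fun X => m X @o n X); split=> [X|X Y x]; first exact: is_iso_comp.
by rewrite compA mn -compA nn compA.
Qed.

Lemma shiftF_faithful s (X Y : Db C) (x : mor X Y) : fmor (shiftF s) x = 0 -> x = 0.
Proof.
have [n [ni nn]] := shiftF_inv (subrr s).
move=> x0; apply: (iso_cancelr (ni X)).
by rewrite nn x0 fmor0 compm0 comp0m.
Qed.

Lemma shiftF_full s (X Y : Db C) (y : mor (shiftF s X) (shiftF s Y)) :
  exists x : mor X Y, fmor (shiftF s) x = y.
Proof.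
have [n [ni nn]] := shiftF_inv (subrr s).
have [m [mn nm]] := ni X.
exists (n Y @o fmor (shiftF (- s)) y @o m).
apply/eqP; rewrite -subr_eq0; apply/eqP/(@shiftF_faithful (- s)).
rewrite fmorB; apply/eqP; rewrite subr_eq0; apply/eqP/(iso_cancell (ni Y)).
by rewrite -nn -compA mn compm1.
Qed.

Lemma cohF_shift s i (X Y : Db C) (x : mor X Y) :
  fmor (cohF (i + s)) x @o coh_shift X s i =
  coh_shift Y s i @o fmor (cohF i) (fmor (shiftF s) x).
Proof.
apply: (@nat_ext _ (comp_functor (cohF i) (shiftF s)) (cohF (i + s))
         (fun X => coh_shift X s i)) => {X Y x} X Y f.
by rewrite comp_functorE !shiftFE !cohFE coh_shift_nat.
Qed.

Let hex := hexact cohF.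

Lemma cone_hexact X Y (f : chain_map X Y) : hex (qmap f) (qmap (cone_in f)).
Proof.
split.
- by rewrite -qmapC qmap_null //; exact: cone_in_null.
- move=> V b gb; have [P [s [b' [sq e]]]] := roof b.
  have [Q [t [tq n]]] : exists P' (t : chain_map P' P),
      quasi_iso t /\ null (chain_comp (chain_comp (cone_in f) b') t).
    by apply: qmap_eq0; rewrite qmapC -e compA gb comp0m.
  have [|x /qmap_eq xE] := @cone_lift _ _ _ _ _ f (chain_comp b' t).
    by rewrite chain_compA.
  have [r [sr rs]] := is_iso_comp (qmap_iso sq) (qmap_iso tq).
  exists (qmap x @o r); rewrite compA -qmapC -xE qmapC -e.
  by rewrite -compA -(compA b) (compA (qmap s)) rs compm1.
(* The denominator [s] of [b] sits over [Y], so [f] itself has to be replaced: Ore gives [g] over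
   [f], and after a further change of domain [b' g r] is null. Then [b'] extends over the cone of
   [g r], which is quasi-isomorphic to the cone of [f]. *)
- move=> V b bf; have [P [s [b' [sq e]]]] := roof b.
  have [Q [t [g [tq n]]]] := chain_ore f sq.
  have [R [r [rq n']]] : exists P' (t : chain_map P' Q),
      quasi_iso t /\ null (chain_comp (chain_comp b' g) t).
    apply: qmap_eq0; rewrite qmapC -e -compA -qmapC -(qmap_eq n) qmapC compA.
    by rewrite bf comp0m.
  have [|x xE] := @cone_extend _ _ _ _ V (chain_comp g r) b'.
    by rewrite chain_compA.
  have n2 : null (chain_comp s (chain_comp g r) - chain_comp f (chain_comp t r)).
    have := null_compr r (nullN n); congr null; apply: chain_mapP => i.
    by rewrite chainCE chainNE !chainBE !chainCE opprB compBl !compA.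
  have [m [m1 m2]] := cone_map_ex n2.
  have mq := cone_map_quasi_iso n2 m1 m2 (quasi_iso_comp tq rq) sq.
  have [m' [m'm mm']] := qmap_iso mq.
  exists (qmap x @o m'); apply: (iso_cancelr (qmap_iso sq)).
  rewrite e -!compA -qmapC -m1 qmapC (compA m') m'm comp1m -qmapC xE //.
- by move=> i; rewrite !cohFE; exact: cone_lexact.
Qed.

Lemma cone_hexact_out X Y (f : chain_map X Y) : hex (qmap (cone_in f)) (qmap (cone_out f)).
Proof.
apply: hexact_conj (cone_hexact (cone_in f));
  [exact: is_iso_id|exact: is_iso_id|exact/qmap_iso/cone_rot_quasi_iso|..].
  by rewrite comp1m compm1.
by rewrite compm1 -qmapC cone_rot_in.
Qed.

Lemma cone_extri X Y (f : chain_map X Y) :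
  extri (shiftF 1) cohF (qmap f) (qmap (cone_in f)) (qmap (cone_out f)).
Proof.
split; [exact: cone_hexact|exact: cone_hexact_out|].
have m1 : (-1 : k) != 0 by rewrite oppr_eq0 oner_eq0.
apply: hexact_conj (cone_hexact_out (cone_in f));
  [exact: is_iso_id|exact/qmap_iso/cone_rot_quasi_iso|exact: is_iso_scale m1 (is_iso_id _)|..].
  by rewrite compm1 -qmapC cone_rot_in.
rewrite compZl comp1m scaleN1r shiftFE -qmapC; apply/eqP.
by rewrite eq_sym -addr_eq0 -qmapD qmap_null //; exact: cone_rot_out.
Qed.

Lemma Db_extri_ex (X Y : Db C) (f : mor X Y) :
  exists (Z : Db C) (g : mor Y Z) (h : mor Z (shiftF 1 X)), extri (shiftF 1) cohF f g h.
Proof.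
have [P [s [f' [sq e]]]] := roof f.
exists (cone f' : Db C), (qmap (cone_in f')), (fmor (shiftF 1) (qmap s) @o qmap (cone_out f')).
by apply: extri_source e (cone_extri f'); exact: qmap_iso.
Qed.

End DbTheory.

(** * Truncations and maps between shifts of an object *)

Section LinearIso.
Variable k : fieldType.
Implicit Types U V : lmodType k.

Lemma linear_ex U V (f : U -> V) :
  (forall a u v, f (a *: u + v) = a *: f u + f v) -> exists F : {linear U -> V}, F =1 f.
Proof.
move=> fP.
pose F : {linear U -> V} := HB.pack f (GRing.isLinear.Build k U V *:%R f fP).
by exists F.
Qed.

Definition liniso U V : Prop := exists f : {linear U -> V}, bijective f.

Lemma liniso_ex U V (f : U -> V) (g : V -> U) :
  (forall a u v, f (a *: u + v) = a *: f u + f v) -> cancel f g -> cancel g f -> liniso U V.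
Proof.
by move=> /linear_ex [F FE] fg gf; exists F, g => x; rewrite ?FE // fg.
Qed.

Lemma liniso_inj_surj U V (f : U -> V) :
  (forall a u v, f (a *: u + v) = a *: f u + f v) ->
  (forall u, f u = 0 -> u = 0) -> (forall v, exists u, f u = v) -> liniso U V.
Proof.
move=> fl fi fs; have [g gE] := choice fs; apply: (liniso_ex fl) (gE) => u.
apply/eqP; rewrite -subr_eq0 addrC -scaleN1r; apply/eqP/fi.
by rewrite fl gE scaleN1r addNr.
Qed.

Lemma liniso_sym U V : liniso U V -> liniso V U.
Proof.
move=> [f [g fg gf]]; apply: (liniso_ex _ gf fg) => a u v.
by rewrite -{1}(gf u) -{1}(gf v) -linearP fg.
Qed.

Lemma liniso_trans U V W : liniso U V -> liniso V W -> liniso U W.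
Proof.
move=> [f fb] [g gb]; have [h hE] : exists h : {linear U -> W}, h =1 g \o f.
  by apply: linear_ex => a u v /=; rewrite !linearP.
by exists h; apply: (eq_bij (bij_comp gb fb)) => x; rewrite hE.
Qed.

Lemma iso_kpow_liniso U V r : liniso U V -> iso_kpow U r -> iso_kpow V r.
Proof. by move=> /liniso_sym; exact: liniso_trans. Qed.

Lemma iso_kpow0 V : iso_kpow V 0 <-> forall v : V, v = 0.
Proof.
split=> [[f fb] v|V0].
  by apply: (bij_inj fb); apply/rowP; case.
apply: (@liniso_ex V 'rV[k]_0 (fun=> 0) (fun=> 0)) => [a u v|u|u].
- by rewrite scaler0 addr0.
- exact/esym/V0.
- by apply/rowP; case.
Qed.

Definition spans V (e : V) : Prop := e != 0 /\ forall v, exists a, v = a *: e.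

Lemma iso_kpow1 V : iso_kpow V 1 <-> exists e : V, spans e.
Proof.
split=> [[f [g fg gf]]|[e [e0 eP]]].
  have fi : injective f := can_inj fg.
  exists (g (const_mx 1)); split=> [|v].
    apply/eqP => /(congr1 f); rewrite gf linear0 => /matrixP /(_ 0 0) /eqP.
    by rewrite !mxE oner_eq0.
  exists (f v 0 0); apply: fi; rewrite linearZ /= gf; apply/rowP => i.
  by rewrite !mxE mulr1 [i]ord1.
have [c cE] := choice eP.
have ci a : c (a *: e) = a.
  have /eqP := cE (a *: e).
  by rewrite -subr_eq0 -scalerBl scaler_eq0 (negbTE e0) orbF subr_eq0 => /eqP <-.
apply: (@liniso_ex V 'rV[k]_1 (fun v => const_mx (c v)) (fun w => w 0 0 *: e)).
- move=> a u v; apply/rowP => i; rewrite !mxE.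
  by rewrite {1}(cE u) {1}(cE v) scalerA -scalerDl ci.
- by move=> v; rewrite mxE -cE.
- by move=> w; apply/rowP => i; rewrite mxE ci [i]ord1.
Qed.

End LinearIso.

Section LinearIsoHom.
Variable k : fieldType.

Lemma liniso_hom (T : klin_cat k) (X X' Y Y' : T) :
  isomorphic X X' -> isomorphic Y Y' -> liniso (mor X Y) (mor X' Y').
Proof.
move=> [u [u' [u'u uu']]] [v [v' [v'v vv']]].
apply: (@liniso_ex _ _ _ (fun f => v @o f @o u') (fun g => v' @o g @o u)).
- by move=> a f g; rewrite compDr compDl compZr compZl.
- by move=> f; rewrite !compA v'v comp1m -compA u'u compm1.
- by move=> f; rewrite !compA vv' comp1m -compA uu' compm1.
Qed.

Lemma liniso_fmor (T E : klin_cat k) (F : lfunctor T E) (X Y : T) :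
  (forall x : mor X Y, fmor F x = 0 -> x = 0) ->
  (forall y : mor (F X) (F Y), exists x : mor X Y, fmor F x = y) ->
  liniso (mor X Y) (mor (F X) (F Y)).
Proof.
move=> Ff Fs; apply: (liniso_inj_surj _ Ff Fs) => a u v.
by rewrite fmorD fmorZ.
Qed.

End LinearIsoHom.

Section Concentrated.
Variables (k : fieldType) (C : abelian_cat k).
Implicit Types (A V : C) (X Y : bcomplex C).

(** [conc A j] is an [if] on [j == 0]. [cin] and [cout] replace casts: mutually inverse at 0, zero
    maps elsewhere. *)
Definition cin A (j : int) : mor A (conc A j) :=
  match j == 0 as b return mor A (if b then A else zob C) with
  | true => idm A | false => 0 end.

Definition cout A (j : int) : mor (conc A j) A :=
  match j == 0 as b return mor (if b then A else zob C) A with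
  | true => idm A | false => 0 end.

Lemma cout_cin A j : j = 0 -> cout A j @o cin A j = idm A.
Proof. by move=> ->; rewrite /cout /cin /= comp1m. Qed.

Lemma cin_cout A j : cin A j @o cout A j = idm (conc A j).
Proof.
rewrite /cin /cout /=; case: (j == 0); first exact: comp1m.
by rewrite comp0m; apply/esym/zero_obP/zobP.
Qed.

Lemma cout_neq A j : j <> 0 -> cout A j = 0.
Proof. by rewrite /cout /=; case: eqP. Qed.

Lemma conc_zero A j : j <> 0 -> is_zero_ob (conc A j).
Proof. by rewrite /=; case: eqP => // _ _; exact: zobP. Qed.

Lemma coh_dif0 X i : (forall i j, dif X i j = 0) -> is_iso (@cls _ _ X i (X i) (idm _)).
Proof.
move=> X0; have cc V (z : mor V (X i)) : cocyc z by move=> j; rewrite X0 comp0m.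
apply: is_isoP => [V x|V y].
  rewrite -cls_comp // comp1m => /(cls_eq0 (cc _ _)) [W [e [a [y [ee]]]]].
  by rewrite X0 comp0m => /esym /(epi0 ee).
have [W [e [z [ee zc zy]]]] := cls_surj y.
by exists W, e, z; split=> //; rewrite -cls_comp ?comp1m.
Qed.

Lemma cshift_conc_dif A s i j : dif (cshift (conc A) s) i j = 0.
Proof. exact: scaler0. Qed.

Lemma coh_conc A s i : i + s = 0 -> isomorphic (coh (cshift (conc A) s) i) A.
Proof.
move=> is0; apply: (@isomorphic_trans _ _ _ (conc A (i + s))).
  apply: isomorphic_sym; eexists; apply: coh_dif0; exact: cshift_conc_dif.
exists (cout A (i + s)), (cin A (i + s)); split; first exact: cin_cout.
exact: cout_cin.
Qed.

Lemma coh_conc_zero A s i : i + s <> 0 -> is_zero_ob (coh (cshift (conc A) s) i).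
Proof.
move=> is0; apply: (@zero_ob_iso _ _ _ (conc A (i + s))); last exact: conc_zero.
apply: isomorphic_sym; eexists; apply: coh_dif0; exact: cshift_conc_dif.
Qed.

Lemma conc_map_subproof A (u : mor A A) i j :
  (cin A j @o u @o cout A j) @o dif (conc A) i j
    = dif (conc A) i j @o (cin A i @o u @o cout A i).
Proof. by rewrite /= comp0m compm0. Qed.
Definition conc_map A (u : mor A A) : chain_map (conc A) (conc A) :=
  @ChainMap k C (conc A) (conc A) (fun i => cin A i @o u @o cout A i)
    (conc_map_subproof u).

End Concentrated.

(** * Canonical truncation *)

Section Truncation.
Variables (k : fieldType) (C : abelian_cat k) (X : bcomplex C) (m : int).

(* The canonical truncation in degrees at most [m], cut out degreewise as a
   kernel: [x] in degree [i] must vanish if [m < i] and be a cocycle if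
   [m <= i]. *)
Definition trunc_eq (i : int) : mor (X i) (bip (X i) (X (i + 1))) :=
  bpair (if m < i then idm (X i) else 0) (if m <= i then dif X i (i + 1) else 0).

Definition trunc_ob (i : int) : C := kerob (trunc_eq i).
Definition trunc_m (i : int) : mor (trunc_ob i) (X i) := kerm (trunc_eq i).

Lemma trunc_mono i : is_mono (trunc_m i).
Proof. exact: kerm_mono. Qed.

Lemma trunc_m0 i : m < i -> trunc_m i = 0.
Proof.
move=> mi; have := congr1 (fun u => bp1 _ _ @o u) (kerP (trunc_eq i)).1.
by rewrite compA bp1_pair mi comp1m compm0.
Qed.

Lemma trunc_cocyc i : m <= i -> cocyc (trunc_m i).
Proof.
move=> mi; apply: (@cocycP _ _ _ _ (i + 1)) => //.
have := congr1 (fun u => bp2 _ _ @o u) (kerP (trunc_eq i)).1.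
by rewrite compA bp2_pair mi compm0.
Qed.

Lemma trunc_lift i V (x : mor V (X i)) : (m < i -> x = 0) -> (m <= i -> cocyc x) ->
  exists x', trunc_m i @o x' = x.
Proof.
move=> h1 h2; have [|x' [e _]] := (kerP (trunc_eq i)).2 V x; last by exists x'.
apply: bpair_ext; rewrite compA compm0 ?bp1_pair ?bp2_pair.
  by case: ifP => [/h1 ->|_]; rewrite ?compm0 ?comp0m.
by case: ifP => [/h2 xc|_]; rewrite ?xc ?comp0m.
Qed.

Lemma trunc_dif_ex i j : exists d : mor (trunc_ob i) (trunc_ob j),
  trunc_m j @o d = dif X i j @o trunc_m i.
Proof.
apply: trunc_lift => [mj|_]; last exact: cocyc_dif.
have [ji|/eqP ne] := eqVneq j (i + 1); last by rewrite diff_shape // comp0m.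
by apply: trunc_cocyc; lia.
Qed.

Definition trunc_dif i j := projT1 (cid (trunc_dif_ex i j)).

Lemma trunc_difE i j : trunc_m j @o trunc_dif i j = dif X i j @o trunc_m i.
Proof. exact: projT2 (cid (trunc_dif_ex i j)). Qed.

Lemma trunc_shape i j : j <> i + 1 -> trunc_dif i j = 0.
Proof.
by move=> ne; apply: (mono0 (@trunc_mono j)); rewrite trunc_difE diff_shape // comp0m.
Qed.

Lemma trunc_difK i j l : trunc_dif j l @o trunc_dif i j = 0.
Proof.
apply: (mono0 (@trunc_mono l)).
by rewrite compA trunc_difE -compA trunc_difE compA diffK comp0m.
Qed.

Lemma trunc_bounded : exists a b : int, forall i : int,
  (i < a) || (b < i) -> is_zero_ob (trunc_ob i).
Proof.
have [a [b abP]] := cbounded X; exists a, b => i /abP [X0 _].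
by apply/zero_obP/(@trunc_mono i); rewrite (X0 _ (_ @o idm _)) compm0.
Qed.

Definition trunc : bcomplex C := BComplex trunc_shape trunc_difK trunc_bounded.

Lemma trunc_in_subproof i j : trunc_m j @o dif trunc i j = dif X i j @o trunc_m i.
Proof. exact: trunc_difE. Qed.
Definition trunc_in : chain_map trunc X :=
  @ChainMap k C trunc X trunc_m trunc_in_subproof.

(** Up to degree [m] the truncation has the cocycles and boundaries of [X]; above [m] both
    cohomologies vanish. *)
Lemma trunc_in_quasi_iso : (forall i, m < i -> is_zero_ob (coh X i)) -> quasi_iso trunc_in.
Proof.
move=> X0; apply: quasi_isoP => [i V z zc|i V x xc].
  have [im|mi] := Order.TotalTheory.leP i m.
    have [|_|z' z'E] := @trunc_lift i V z _ _; [lia|done|].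
    exists V, (idm V), z'; split; first exact: epi_id.
      by move=> j; apply: (@trunc_mono j); rewrite compA trunc_difE -compA z'E zc compm0.
    exists V, (idm V), i, 0; split; first exact: epi_id.
    by rewrite compm0 /= z'E !compm1 subrr.
  have [W [e [a [y [ee yz]]]]] := (coh_zeroP X i).1 (X0 i mi) _ _ zc.
  exists W, e, 0; split=> //; first by move=> j; rewrite compm0.
  exists W, (idm W), a, y; split; first exact: epi_id.
  by rewrite compm0 subr0 compm1.
have [im|mi] := Order.TotalTheory.leP i m; last first.
  move=> _; exists V, (idm V), i, 0; split; first exact: epi_id.
  by apply: (@trunc_mono i); rewrite (trunc_m0 mi) !comp0m.
move=> [W [e [a [y [ee yz]]]]]; exists W, e, a.
have [ia|/eqP ne] := eqVneq i (a + 1).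
  have [||y' y'E] := @trunc_lift a W y; [lia|lia|].
  exists y'; split=> //; apply: (@trunc_mono i).
  by rewrite compA trunc_difE -compA y'E yz /= compA.
exists 0; split=> //; rewrite compm0; apply: (@trunc_mono i).
by rewrite compm0 compA -yz diff_shape // comp0m.
Qed.

End Truncation.

Section TopMap.
Variables (k : fieldType) (C : abelian_cat k) (A : C).

(** Truncate the apex of a roof for [x] to degrees at most 0, so that all its elements of degree 0
    are cocycles. As the denominator is bijective on cohomology, its component [a] to [A] is epi,
    with kernel consisting of local boundaries. The numerator kills boundaries, so it factors
    through [a], and the factor is [u]. *)
Lemma conc_hom_full (x : @mor k (Db C) (conc A) (conc A)) :
  exists u, x = qmap (conc_map u).
Proof.
have [W [s0 [f0 [s0q e0]]]] := roof x.
have WF i : 0 < i -> is_zero_ob (coh W i).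
  move=> i0; apply: (@zero_ob_iso _ _ _ (coh (conc A) i)).
    by exists (coh_map s0 i); exact: s0q.
  have X0 i' j : dif (conc A) i' j = 0 by [].
  apply: (@zero_ob_iso _ _ _ (conc A i)); last by apply: conc_zero; lia.
  by apply: isomorphic_sym; eexists; apply: coh_dif0.
pose U := trunc W 0; pose io := trunc_in W 0.
have ioq : quasi_iso io by exact: trunc_in_quasi_iso.
pose s := chain_comp s0 io; pose f := chain_comp f0 io.
have sq : quasi_iso s by exact: quasi_iso_comp.
have e : x @o qmap s = qmap f by rewrite !qmapC compA e0.
pose a := cout A 0 @o s 0; pose b := cout A 0 @o f 0.
have Uc V (z : mor V (U 0)) : cocyc z.
  move=> j; apply: (@trunc_mono _ _ W 0 j).
  by rewrite compA trunc_difE trunc_cocyc // !comp0m compm0.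
have ae : is_epi a.
  have cc : cocyc (cin A 0) by move=> j; rewrite comp0m.
  have [V [d [y [de yc [V' [d' [i [w [de' wE]]]]]]]]] := quasi_iso_surj sq cc.
  rewrite comp0m in wE.
  have : is_epi (a @o (y @o d')).
    suff -> : a @o (y @o d') = d @o d' by exact: epi_comp.
    have := congr1 (fun t => cout A 0 @o t) wE.
    rewrite compm0 compBl compBr !compA cout_cin // comp1m => /esym /eqP.
    by rewrite subr_eq0 => /eqP ->; rewrite /a !compA.
  exact: epi_compl.
(* [a] is the cokernel of [g], and [g] is locally a boundary because [s] kills it. *)
have [Z [g [ag0 gP]]] := epi_cokernel ae.
have fg0 : f 0 @o g = 0.
  have sg : s 0 @o g = 0.
    by have := congr1 (fun t => cin A 0 @o t) ag0; rewrite /a !compA cin_cout comp1m compm0.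
  have [|V [d [i [y [de yE]]]]] := quasi_iso_inj sq (Uc _ g).
    by exists Z, (idm Z), 0, 0; split; [exact: epi_id|rewrite sg comp0m compm0].
  by apply: (epi0 de); rewrite -compA -yE compA cmapP /= !comp0m.
have [|u [ua _]] := gP _ b; first by rewrite /b -compA fg0 compm0.
exists u; apply: (iso_cancelr (qmap_iso sq)); rewrite e -qmapC; congr qmap.
apply: chain_mapP => i; rewrite chainCE -[f i]comp1m -cin_cout -!compA.
congr (_ @o _); have [->|/eqP i0] := eqVneq i 0; first exact: esym ua.
by rewrite cout_neq // !comp0m compm0.
Qed.

Lemma conc_hom_faithful (u : mor A A) : qmap (conc_map u) = 0 -> u = 0.
Proof.
move=> /(congr1 (fmor (cohF C 0))); rewrite cohFE fmor0 => e.
have X0 i j : dif (conc A) i j = 0 by [].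
have cc V (z : mor V (conc A 0)) : cocyc z by move=> j; rewrite comp0m.
have := congr1 (fun t => t @o cls (cin A 0)) e.
rewrite comp0m coh_map_cls //= -[_ @o cin A 0]comp1m cls_comp // -(compm0 _ (cls (idm _))).
move=> /(iso_cancell (coh_dif0 0 X0)) /(congr1 (fun t => cout A 0 @o t)).
by rewrite compm0 !compA cout_cin // comp1m -compA cout_cin // compm1.
Qed.

Lemma conc_hom_liniso : liniso (mor A A) (@mor k (Db C) (conc A) (conc A)).
Proof.
apply: (@liniso_inj_surj _ _ _ (fun u => qmap (conc_map u))).
- move=> a u v; rewrite -qmapZ -qmapD; congr qmap; apply: chain_mapP => i /=.
  by rewrite compDr compDl compZr compZl.
- exact: conc_hom_faithful.
- by move=> x; have [u ->] := conc_hom_full x; exists u.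
Qed.

(** After truncation every element of degree [m] is a cocycle, so taking its class and applying [r]
    is a chain map to [A] placed in degree [m]. The isomorphism [t] identifies the cohomology of
    that complex with [A]. *)
Lemma top_map (B : Db C) (m : int) (r : mor (coh B m) A) :
  (forall i, m < i -> is_zero_ob (coh B i)) ->
  exists (p : mor B (cshift (conc A) (- m) : Db C))
         (t : mor A (coh (cshift (conc A) (- m)) m)),
    is_iso t /\ fmor (cohF C m) p = t @o r.
Proof.
move=> B0; pose U := trunc B m; pose io := trunc_in B m.
have ioq : quasi_iso io by exact: trunc_in_quasi_iso.
pose Q := cshift (conc A) (- m).
have Q0 := @cshift_conc_dif _ _ A (- m).
have uc : cocyc (trunc_m B m m) by exact: trunc_cocyc.
have [pi piE] : exists pi : chain_map U Q, forall i,
    pi i = cin A (i - m) @o r @o cls (trunc_m B m m) @o tr U i m.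
  apply: chain_map_ex => i j ij; rewrite Q0 comp0m.
  have [<-|/eqP jm] := eqVneq m j; last by rewrite tr_neq 1?eq_sym ?compm0 ?comp0m // => /esym.
  have cd : cls (trunc_m B m m) @o dif U i m = 0.
    by rewrite -[LHS](cls_comp (trunc_dif B m i m) uc) trunc_difE cls_dif.
  rewrite tr_id compm1; apply: etrans (esym (compA _ _ _)) _.
  exact: etrans (congr1 (fun t => cin A (m - m) @o r @o t) cd) (compm0 _ _).
pose th := @cls _ _ Q m A (cin A (m - m)).
have cc V (z : mor V (Q m)) : cocyc z by move=> j; rewrite Q0 comp0m.
have thi : is_iso th.
  have -> : th = @cls _ _ Q m (Q m) (idm _) @o cin A (m - m).
    by rewrite -(@cls_comp _ _ Q m (Q m) A (idm _) (cin A (m - m)) (cc _ _)) comp1m.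
  apply: is_iso_comp; first exact: coh_dif0.
  exists (cout A (m - m)); split; last exact: cin_cout.
  by apply: cout_cin; rewrite subrr.
have [j [jio ioj]] := qmap_iso ioq.
exists (qmap pi @o j), th; split=> //.
apply: (iso_cancelr (fmor_iso (cohF C m) (qmap_iso ioq))).
rewrite -fmor_comp -compA jio compm1 !cohFE.
apply: coh_ext => V z zc; rewrite coh_map_cls // piE tr_id compm1.
rewrite -(compA th) -!compA coh_map_cls //= -(cls_comp z uc).
by rewrite /th -cls_comp.
Qed.

End TopMap.

(** * Direct sums and cones *)

Section Spans.
Variables (k : fieldType) (V : lmodType k).

Lemma spans_neq0 (e v : V) : spans e -> v != 0 -> spans v.
Proof.
move=> [e0 eP] v0; split=> // w; have [a va] := eP v; have [b ->] := eP w.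
have a0 : a != 0 by apply: contra_neq v0 => a0; rewrite va a0 scale0r.
by exists (b / a); rewrite va scalerA divfK.
Qed.

Lemma iso_kpow1_spans (v : V) : iso_kpow V 1 -> v != 0 -> spans v.
Proof. by move=> /iso_kpow1 [e eP]; exact: spans_neq0 eP. Qed.

End Spans.

Section WeakTR3.
Variables (k : fieldType) (T : klin_cat k) (C : abelian_cat k).
Variables (S : lfunctor T T) (H : int -> lfunctor T C).
Hypothesis S_full : forall (X Y : T) (y : mor (S X) (S Y)), exists x, fmor S x = y.

Local Notation extri := (extri S H).

Lemma extri_scale (X Y Z : T) (f : mor X Y) (g : mor Y Z) (h : mor Z (S X)) a :
  a != 0 -> extri f g h -> extri (a *: f) g h.
Proof.
move=> a0 [t1 t2 t3]; have id1 := @is_iso_id _ T.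
have av0 : a^-1 != 0 by rewrite invr_eq0.
split=> //.
- apply: hexact_conj t1; [exact: is_iso_scale av0 (id1 X)|exact: id1|exact: id1|..].
    by rewrite compZl compZr compm1 comp1m scalerA mulfV // scale1r.
  by rewrite comp1m compm1.
- apply: hexact_conj t3; [exact: id1|exact: id1|exact: is_iso_scale a0 (id1 _)|..].
    by rewrite comp1m compm1.
  by rewrite fmorZ !compZl comp1m compm1.
Qed.

Lemma extri_zero (X Y Z : T) (f : mor X Y) (g : mor Y Z) (h : mor Z (S X)) :
  is_zero_ob Y -> extri f g h -> is_iso h.
Proof.
move=> Y0 [t1 t2 t3]; have [a ha] : exists a, idm (S X) = h @o a.
  apply: (hex_lift t3); rewrite compm1; exact: ((fob_zero S Y0).1).
exists a; split=> //.
have [b] : exists b, a @o h - idm Z = g @o b.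
  by apply: (hex_lift t2); rewrite compBr compA -ha comp1m compm1 subrr.
by rewrite (Y0.2 _ g) comp0m => /eqP; rewrite subr_eq0 => /eqP.
Qed.

(* Substitute for the completion of morphisms of triangles: when the
   endomorphisms of [X] are scalars, exactness alone completes a map of
   triangles up to non-zero scalars. *)
Lemma weak_tr3 (X Y Z Y' Z' : T) (f : mor X Y) (g : mor Y Z) (h : mor Z (S X))
    (f' : mor X Y') (g' : mor Y' Z') (h' : mor Z' (S X)) (b : mor Y Y') :
  (forall x : mor X X, exists a, x = a *: idm X) ->
  extri f g h -> extri f' g' h' -> b @o f = f' ->
  exists (c : mor Z Z') (l m : k), [/\ l != 0, m != 0, c @o g = m *: (g' @o b)
    & h' @o c = l *: h].
Proof.
move=> Xs [t1 t2 t3] [t1' t2' t3'] bf.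
have [c1 c1E] : exists c, g' @o b = c @o g.
  by apply: (hex_ext t1); rewrite -compA bf (hex0 t1').
have [o oE] : exists o, h' @o c1 = o @o h.
  by apply: (hex_ext t2); rewrite -compA -c1E compA (hex0 t2') comp0m.
have [y yo] := S_full o; have [l lE] := Xs y.
have {}oE : h' @o c1 = l *: h.
  by rewrite oE -yo lE fmorZ fmor_id compZl comp1m.
(* [c1] makes the left square commute exactly and the right one up to [l]; it fails only for
   [l = 0]. *)
have [l0|l0] := eqVneq l 0; last first.
  by exists c1, l, 1; rewrite scale1r oner_neq0; split.
have {l0 lE}oE : h' @o c1 = 0 by rewrite oE l0 scale0r.
(* For [l = 0] start from the right square: [c2] satisfies it exactly, and subtracting [g' w] makes
   the left square hold up to [m]. *)
have [c2 c2E] : exists c, h = h' @o c.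
  by apply: (hex_lift t3'); rewrite -bf fmor_comp -compA (hex0 t3) compm0.
have [z zE] : exists z, c2 @o g = g' @o z.
  by apply: (hex_lift t2'); rewrite compA -c2E (hex0 t2).
have [x xE] : exists x, z @o f = f' @o x.
  by apply: (hex_lift t1'); rewrite compA -zE -compA (hex0 t1) compm0.
have [m mE] := Xs x.
have [w wE] : exists w, z - m *: b = w @o g.
  apply: (hex_ext t1).
  by rewrite compBl compZl bf xE mE compZr compm1 subrr.
pose c3 := c2 - g' @o w.
have c3g : c3 @o g = m *: (g' @o b).
  by rewrite compBl zE -compA -wE compBr opprB addrC subrK compZr.
have c3h : h' @o c3 = h.
  by rewrite compBr -c2E compA (hex0 t2') comp0m subr0.
have [m0|m0] := eqVneq m 0; last first.
  by exists c3, 1, m; rewrite oner_neq0 scale1r; split.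
(* With [l = m = 0], each of the two maps is zero where the other is right, so their sum satisfies
   both squares. *)
exists (c1 + c3), 1, 1; rewrite !scale1r oner_neq0; split=> //.
  by rewrite compDl c3g m0 scale0r addr0.
by rewrite compDr oE c3h add0r.
Qed.

Section SplitOff.
Variables (X Y K B' B : T) (f : mor X Y) (v : mor Y K) (h : mor K (S X))
  (phi : mor X B') (w : mor B' B) (q : mor B (S X)).
Variables (I : finType) (E : I -> T) (i0 : mor Y B') (p0 : mor B' Y)
  (i : forall j, mor (E j) B') (p : forall j, mor B' (E j)).

(** [phi] is [f] followed by a split inclusion. Comparing the triangles in both directions gives
    [c : K -> B] and [d : B -> K], whose composite [M = d c] is invertible though not the identity;
    so [K] is a summand of [B], and the [E j] make up the rest. *)
Lemma split_off :
  (forall x : mor X X, exists a, x = a *: idm X) ->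
  extri f v h -> extri phi w q ->
  p0 @o i0 = idm Y -> (forall j, p j @o i0 = 0) -> (forall j, p0 @o i j = 0) ->
  (forall j, p j @o i j = idm _) -> (forall j l, j <> l -> p l @o i j = 0) ->
  i0 @o p0 + \sum_j i j @o p j = idm B' ->
  p0 @o phi = f -> (forall j, p j @o phi = 0) ->
  is_dsum (fun x : unit + I => match x with inl _ => K | inr j => E j end) B.
Proof.
move=> Xs tK tB p0i0 pi0 p0i pii pij s p0f pf.
have i0f : i0 @o f = phi.
  rewrite -[RHS]comp1m -s compDl comp_suml big1 => [|j _].
    by rewrite addr0 -compA p0f.
  by rewrite -compA pf compm0.
have [c [l [m [l0 m0 cv qc]]]] := weak_tr3 Xs tK tB i0f.
have [d [l' [m' [l'0 m'0 dw hd]]]] := weak_tr3 Xs tB tK p0f.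
pose M := d @o c; pose al := m * m'; pose be := l * l'.
have al0 : al != 0 by rewrite mulf_neq0.
have be0 : be != 0 by rewrite mulf_neq0.
have Mv : M @o v = al *: v.
  rewrite /M -compA cv compZr compA dw compZl -compA p0i0 compm1.
  by rewrite scalerA.
have hM : h @o M = be *: h.
  by rewrite /M compA hd compZl qc scalerA mulrC.
have [n nE] : exists n, M - al *: idm K = n @o h.
  by apply: (hex_ext (tri2 tK)); rewrite compBl Mv compZl comp1m subrr.
(* [M - al] kills [v], so it factors through [h], and [h (M - be) = 0]. Hence [M] is a root of a
   quadratic polynomial with non-zero constant term [al * be], from which the inverse [N] is read
   off. *)
have MM : (M - al *: idm K) @o (M - be *: idm K) = 0.
  by rewrite nE -compA compBr hM compZr compm1 subrr compm0.
pose N := (al * be)^-1 *: ((al + be) *: idm K - M).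
have ab0 : al * be != 0 by rewrite mulf_neq0.
have NM : N @o M = idm K.
  have MM' : (al + be) *: M - M @o M = (al * be) *: idm K.
    move: MM; rewrite compBl !compBr !compZr !compZl !comp1m compm1 scalerA.
    rewrite scalerDl; move/eqP; rewrite subr_eq0 => /eqP /(canRL (subrK _)) ->.
    by rewrite opprD opprB [LHS]addrC [X in _ + X]addrC addrA !subrK mulrC.
  by rewrite /N compZl compBl compZl comp1m MM' scalerA mulVf // scale1r.
have Nv : N @o v = al^-1 *: v.
  rewrite /N compZl compBl compZl comp1m Mv -scalerBl [al + _]addrC addrK.
  by rewrite scalerA invfM -mulrA mulVf // mulr1.
have hN : h @o N = be^-1 *: h.
  rewrite /N compZr compBr compZr compm1 hM -scalerBl addrK.
  by rewrite scalerA invfM mulrAC mulVf // mul1r.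
pose pK := N @o d.
have pKc : pK @o c = idm K by rewrite /pK -compA; exact: NM.
have pKw : pK @o w = m^-1 *: (v @o p0).
  rewrite /pK -compA dw compZr compA Nv compZl scalerA.
  by rewrite /al invfM mulrCA mulfV // mulr1.
have hpK : h @o pK = l^-1 *: q.
  rewrite /pK compA hN compZl hd scalerA.
  by rewrite /be invfM -mulrA mulVf // mulr1.
(* [p j] extends along [w] because it kills [phi]; a multiple of [y q] is then subtracted to make
   the extension vanish on [c]. *)
have ext j : exists z : mor B (E j), z @o w = p j /\ z @o c = 0.
  have [z zE] := hex_ext (tri1 tB) (pf j).
  have [y yE] : exists y, z @o c = y @o h.
    by apply: (hex_ext (tri2 tK)); rewrite -compA cv compZr compA -zE pi0 scaler0.
  exists (z - l^-1 *: (y @o q)); split.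
    by rewrite compBl compZl -compA (hex0 (tri2 tB)) compm0 scaler0 subr0 zE.
  by rewrite compBl yE compZl -compA qc compZr scalerA mulVf // scale1r subrr.
pose pj j := projT1 (cid (ext j)).
have pjw j : pj j @o w = p j by case: (projT2 (cid (ext j))).
have pjc j : pj j @o c = 0 by case: (projT2 (cid (ext j))).
exists (fun x => match x return mor (match x with inl _ => K | inr j => E j end) B
          with inl _ => c | inr j => w @o i j end),
       (fun x => match x return mor B (match x with inl _ => K | inr j => E j end)
          with inl _ => pK | inr j => pj j end).
split.
- by case=> [u|j]; [exact: pKc|rewrite compA pjw pii].
- case=> [[]|j] [[]|j'] ne //.
  + by rewrite compA pKw compZl -compA p0i compm0 scaler0.
  + by rewrite compA pjw pij // => jj; apply: ne; rewrite jj.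
rewrite big_sumType /= (eq_bigl (fun x => x == tt)); last by case.
rewrite big_pred1_eq.
(* The defect [idm B - e] kills [w], so it equals [z q]; it also kills [c], so [z h = 0]; and [q] is
   a multiple of [h pK]. *)
set e := _ + _; apply/eqP; rewrite eq_sym -subr_eq0; apply/eqP.
have [z zE] : exists z, idm B - e = z @o q.
  apply: (hex_ext (tri2 tB)); rewrite compBl comp1m compDl comp_suml -compA pKw.
  rewrite compZr compA cv compZl scalerA mulVf // scale1r.
  have -> : \sum_j w @o i j @o pj j @o w = w @o (\sum_j i j @o p j).
    by rewrite comp_sumr; apply: eq_bigr => j _; rewrite -!compA pjw.
  by rewrite -!compA -compDr s compm1 subrr.
have zh : z @o h = 0.
  have : (idm B - e) @o c = 0.
    rewrite compBl comp1m compDl comp_suml -compA pKc compm1.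
    rewrite big1 ?addr0 ?subrr // => j _.
    by rewrite -!compA pjc !compm0.
  rewrite zE -compA qc compZr => /eqP; rewrite scaler_eq0 (negbTE l0) => /eqP.
  exact.
rewrite zE; have : l *: (z @o (h @o pK)) = 0 by rewrite compA zh comp0m scaler0.
by rewrite hpK compZr scalerA mulfV // scale1r.
Qed.

End SplitOff.

(* Gaussian elimination: all components of [phi] but one are cleared by an
   automorphism of the direct sum. *)
Lemma attach_dsum (X K B' B : T) (I : finType) (F : I -> T)
    (inj : forall j, mor (F j) B') (prj : forall j, mor B' (F j)) (j0 : I)
    (g : forall j, mor (F j0) (F j)) (phi : mor X B') (w : mor B' B) (q : mor B (S X))
    (v : mor (F j0) K) (h : mor K (S X)) :
  (forall x : mor X X, exists a, x = a *: idm X) ->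
  (forall j, prj j @o inj j = idm (F j)) ->
  (forall j l, j <> l -> prj l @o inj j = 0) ->
  \sum_j inj j @o prj j = idm B' ->
  (forall j, j != j0 -> prj j @o phi = g j @o (prj j0 @o phi)) ->
  extri (prj j0 @o phi) v h -> extri phi w q ->
  is_dsum (fun x : unit + {j | j \in predC1 j0} =>
             match x with inl _ => K | inr j => F (val j) end) B.
Proof.
move=> Xs pii pij s gP tK tB.
pose J := {j | j \in predC1 j0}.
have neJ (j : J) : val j <> j0 by apply/eqP; have := valP j; rewrite inE.
have pj0 (j : J) : prj j0 @o inj (val j) = 0 by apply: pij.
have p0j (j : J) : prj (val j) @o inj j0 = 0 by apply: pij => /esym/neJ.
have pJ (j l : J) : j <> l -> prj (val l) @o inj (val j) = 0.
  by move=> jl; apply: pij => /val_inj.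
have sJ : inj j0 @o prj j0 + \sum_(j : J) inj (val j) @o prj (val j) = idm B'.
  rewrite -s (bigD1 j0) //=; congr (_ + _).
  by rewrite -(big_sub (predC1 j0) (fun j => inj j @o prj j)).
(* The base change: [F j0] is embedded as the graph of the [g j], and each other projection is
   corrected by [g j] times the one at [j0], which makes it kill [phi]. *)
apply: (@split_off X (F j0) K B' B (prj j0 @o phi) v h phi w q J (fun j => F (val j))
  (inj j0 + \sum_(j : J) inj (val j) @o g (val j)) (prj j0)
  (fun j => inj (val j)) (fun j => prj (val j) - g (val j) @o prj j0)) => //.
- rewrite compDr pii comp_sumr big1 ?addr0 // => j _.
  by rewrite compA pj0 comp0m.
- move=> j; rewrite compBl !compDr -!compA pii p0j compm1 add0r comp_sumr.
  rewrite (bigD1 j) //= compA pii comp1m big1 => [|l /eqP lj]; last first.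
    by rewrite compA pJ // comp0m.
  rewrite (comp_sumr _ (prj j0)) big1 => [|l _]; last by rewrite compA pj0 comp0m.
  by rewrite compm0 !addr0 subrr.
- by move=> j; rewrite compBl pii -compA pj0 compm0 subr0.
- by move=> j l jl; rewrite compBl pJ // -compA pj0 compm0 subr0.
- rewrite -[RHS]sJ compDl -addrA; congr (_ + _).
  rewrite comp_suml -big_split /=; apply: eq_bigr => j _.
  by rewrite compBr compA addrC subrK.
- by move=> j; rewrite compBl gP ?compA ?subrr //; apply/eqP/neJ.
Qed.

(** For rotating triangles backwards: a full and faithful shift compatible with cohomology reflects
    exactness. *)
Lemma hexact_shift (hsn : forall i X, mor (H i (S X)) (H (i + 1) X)) :
  (forall i X, is_iso (hsn i X)) ->
  (forall i X Y (x : mor X Y),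
     fmor (H (i + 1)) x @o hsn i X = hsn i Y @o fmor (H i) (fmor S x)) ->
  (forall (X Y : T) (x : mor X Y), fmor S x = 0 -> x = 0) ->
  forall (X Y Z : T) (f : mor X Y) (g : mor Y Z),
  hexact H (fmor S f) (fmor S g) -> hexact H f g.
Proof.
move=> hi hn Sf X Y Z f g [gf lift ext coh]; split.
- by apply: Sf; rewrite fmor_comp.
- move=> W b gb; have [a'] : exists a', fmor S b = fmor S f @o a'.
    by apply: lift; rewrite -fmor_comp gb fmor0.
  have [a <-] := S_full a'; rewrite -fmor_comp => e; exists a.
  by apply/eqP; rewrite -subr_eq0; apply/eqP/Sf; rewrite fmorB e subrr.
- move=> W b gb; have [a'] : exists a', fmor S b = a' @o fmor S g.
    by apply: ext; rewrite -fmor_comp gb fmor0.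
  have [a <-] := S_full a'; rewrite -fmor_comp => e; exists a.
  by apply/eqP; rewrite -subr_eq0; apply/eqP/Sf; rewrite fmorB e subrr.
move=> i; have [j <-] : exists j : int, j + 1 = i by exists (i - 1); rewrite subrK.
by apply: lexact_conj (coh j); [exact: hi|exact: hi|exact: hi|rewrite hn|rewrite hn].
Qed.

End WeakTR3.

(** * Classification by strings *)

Section Classification.
Variables (k : fieldType) (T : klin_cat k) (C : abelian_cat k).
Variables (S : lfunctor T T) (H : int -> lfunctor T C).
Hypothesis S_full : forall (X Y : T) (y : mor (S X) (S Y)), exists x, fmor S x = y.
Hypothesis S_faithful : forall (X Y : T) (x : mor X Y), fmor S x = 0 -> x = 0.
Hypothesis S_ess : forall X : T, exists Y : T, isomorphic (S Y) X.
Variable hs : forall i X, mor (H i (S X)) (H (i + 1) X).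
Hypothesis hs_iso : forall i X, is_iso (hs i X).
Hypothesis hs_nat : forall i (X Y : T) (x : mor X Y),
  fmor (H (i + 1)) x @o hs i X = hs i Y @o fmor (H i) (fmor S x).
Local Notation extri := (extri S H).
Hypothesis extri_ex : forall (X Y : T) (f : mor X Y),
  exists (Z : T) (g : mor Y Z) (h : mor Z (S X)), extri f g h.
Hypothesis H_zero : forall X : T, (forall i, is_zero_ob (H i X)) -> is_zero_ob X.
Hypothesis H_bounded : forall X : T, exists l u : int, forall i,
  (i < l) || (u < i) -> is_zero_ob (H i X).
Variable (A : C) (a : int -> T).
Hypothesis A0 : idm A != 0.
Hypothesis Sa : forall u v, u = v + 1 -> isomorphic (S (a u)) (a v).
Hypothesis hom_a : forall s t : int,
  iso_kpow (mor (a s) (a t)) ((s == t) + (s == t + 2)%R)%N.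
Hypothesis Ha : forall t, isomorphic (H t (a t)) A.
Hypothesis Ha0 : forall t i, i <> t -> is_zero_ob (H i (a t)).
Hypothesis top : forall (B : T) (m : int) (r : mor (H m B) A),
  (forall i, m < i -> is_zero_ob (H i B)) ->
  exists (p : mor B (a m)) (t : mor A (H m (a m))), is_iso t /\ fmor (H m) p = t @o r.

Lemma HS0 i X : is_zero_ob (H (i + 1) X) -> is_zero_ob (H i (S X)).
Proof. by apply: zero_ob_iso; exists (hs i X); exact: hs_iso. Qed.

Lemma hom_a0 s t : s <> t -> s <> t + 2 -> forall x : mor (a s) (a t), x = 0.
Proof.
move=> /eqP /negbTE st /eqP /negbTE st2; apply/iso_kpow0.
by have := hom_a s t; rewrite st st2.
Qed.

Lemma a_id0 t : idm (a t) != 0.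
Proof.
apply/eqP => e; have : iso_kpow (mor (a t) (a t)) 1.
  by have := hom_a t t; rewrite eqxx (_ : t == t + 2 = false) //; lia.
move=> /iso_kpow1 [x [/eqP x0 _]]; apply: x0.
by rewrite -[x]comp1m e comp0m.
Qed.

Lemma a_scalar t (x : mor (a t) (a t)) : exists c, x = c *: idm (a t).
Proof.
have h : iso_kpow (mor (a t) (a t)) 1.
  by have := hom_a t t; rewrite eqxx (_ : t == t + 2 = false) //; lia.
by have [_] := iso_kpow1_spans h (a_id0 t); apply.
Qed.

(** A string together with its map [q] to the top cell and a map [c] spanning the line to which the
    next cell is attached. The invariant [q c <> 0] lets [c] be detected on the top cell alone, and
    so makes maps over [a t] injective on this line. *)
Record cell (n : nat) (t : int) (G : T) (q : mor G (a t)) (c : mor (a (t + 2)) G) : Prop :=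
  Cell {
    cell_hom : forall s : int,
      iso_kpow (mor (a s) G) ((s == t - n%:Z)%R + (s == t + 2)%R)%N;
    cell_qc : q @o c <> 0;
    cell_coh : forall i : int, t - n%:Z <= i <= t -> isomorphic (H i G) A;
    cell_coh0 : forall i : int, ~~ (t - n%:Z <= i <= t) -> is_zero_ob (H i G)
  }.

Lemma cell_span n t G q c (cl : @cell n t G q c) u (x y : mor (a u) G) :
  u = t + 2 -> x <> 0 -> exists l, y = l *: x.
Proof.
move=> ut; subst u => /eqP x0; have h : iso_kpow (mor (a (t + 2)) G) 1.
  by have := cell_hom cl (t + 2); rewrite eqxx (_ : t + 2 == t - n%:Z = false) //; lia.
by have [_] := iso_kpow1_spans h x0; apply.
Qed.

Lemma cell_hom0 n t G q c (cl : @cell n t G q c) s (x : mor (a s) G) :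
  s <> t - n%:Z -> s <> t + 2 -> x = 0.
Proof.
move=> /eqP /negbTE st /eqP /negbTE st2; move: x; apply/iso_kpow0.
by have := cell_hom cl s; rewrite st st2.
Qed.

Lemma cell_c0 n t G q c (cl : @cell n t G q c) : c <> 0.
Proof. by move=> c0; apply: (cell_qc cl); rewrite c0 compm0. Qed.

Lemma sig_ex t : exists sg : mor (S (a (t - 1 + 2))) (a t), is_iso sg.
Proof. by apply: Sa; lia. Qed.

Definition sig t : mor (S (a (t - 1 + 2))) (a t) := projT1 (cid (sig_ex t)).
Lemma sig_iso t : is_iso (sig t). Proof. exact: projT2 (cid (sig_ex t)). Qed.

(** The degree [t - 1 + 2] is left unreduced because [c] belongs to a string with top degree
    [t - 1]; [sig] absorbs the difference between the shifted cell and [a t]. *)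
Definition attached t (G : T) (c : mor (a (t - 1 + 2)) G) (G' : T) (q' : mor G' (a t)) :=
  exists (g : mor G G') (h : mor G' (S (a (t - 1 + 2)))),
    extri c g h /\ q' = sig t @o h.

(** The exact sequence of [Hom (a s, -)] on [a u -> G -> Z -> S (a u)], with [u = t + 1]. Maps from
    [a s] to [S (a u)] occur for [s = t] and [s = t + 2]; the former are multiples of the identity
    and do not lift to [Z] since [c <> 0], the latter lift. *)
Lemma cell_next n t G q c : @cell n (t - 1) G q c ->
  exists (G' : T) (q' : mor G' (a t)) (c' : mor (a (t + 2)) G'),
    cell n.+1 q' c' /\ attached c q'.
Proof.
move=> cl; have [Z [g [h tr]]] := extri_ex c.
pose u := t - 1 + 2; have ut : u = t + 1 by rewrite /u; lia.
have [t1 t2 t3] := tr.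
have hom_Su s (x : mor (a s) Z) : exists (y : mor (a (s + 1)) (a u))
    (r : mor (S (a (s + 1))) (a s)),
    [/\ is_iso r, (h @o x) @o r = fmor S y & c @o y = 0].
  have [r ri] := Sa (erefl (s + 1)).
  have [y yE] := S_full ((h @o x) @o r).
  exists y, r; split=> //; apply: S_faithful.
  by rewrite fmor_comp yE !compA (hex0 t3) !comp0m.
(* [h x] desuspends to some [y] with [c y = 0]. If [s + 1 = u], then [y] is a scalar and [c <> 0]
   makes it zero. *)
have h_inj s (x : mor (a s) Z) : s <> t + 2 -> h @o x = 0.
  move=> st; have [y [r [ri yE cy]]] := hom_Su s x.
  suff y0 : y = 0 by apply: (iso_cancelr ri); rewrite yE y0 fmor0 comp0m.
  have [su|/eqP su] := eqVneq (s + 1) u; last by apply: hom_a0; lia.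
  move: y cy {yE}; rewrite su => y cy; have [l yl] := a_scalar y.
  move: cy; rewrite yl compZr compm1 => /eqP; rewrite scaler_eq0.
  by case/orP => [/eqP ->|/eqP /(cell_c0 cl) //]; rewrite scale0r.
have low s (x : mor (a s) Z) : s <> t + 2 -> exists b, x = g @o b.
  by move=> st; apply: (hex_lift t2); exact: h_inj.
have kill s (x : mor (a s) Z) : s <> t - n.+1%:Z -> s <> t + 2 -> x = 0.
  move=> s1 s2; have [b ->] := low _ x s2.
  have [su|/eqP su] := eqVneq s u; last first.
    by rewrite (cell_hom0 cl b) ?compm0 //; lia.
  subst s; have [l ->] := cell_span cl b (erefl _) (cell_c0 cl).
  by rewrite compZr (hex0 t1) scaler0.
(* The bottom class of [G] survives: nothing maps from this degree to [a u]. *)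
have bot : exists e : mor (a (t - n.+1%:Z)) Z, spans e.
  have st : t - n.+1%:Z <> t + 2 by lia.
  have : iso_kpow (mor (a (t - n.+1%:Z)) G) 1.
    have := cell_hom cl (t - n.+1%:Z).
    have -> : (t - n.+1%:Z == t - 1 - n%:Z) = true by lia.
    by have -> : (t - n.+1%:Z == t - 1 + 2) = false by lia.
  move=> /iso_kpow1 [b0 [b00 b0P]]; exists (g @o b0); split.
    apply: contra_neq b00 => gb; have [y yE] := hex_lift t1 gb.
    by rewrite yE (hom_a0 _ _ y) ?compm0 //; lia.
  move=> x; have [b ->] := low _ x st; have [l ->] := b0P b.
  by exists l; rewrite compZr.
(* The new class: the generator [ep] of [Hom (a (u + 2), a u)] is killed by [c] for degree reasons,
   so its suspension lifts through [h], uniquely because [a (t + 2)] has no maps to [G]. *)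
have [e [es qe]] : exists e : mor (a (t + 2)) Z, spans e /\ (sig t @o h) @o e <> 0.
  have u3 : t + 2 + 1 = u + 2 by lia.
  have : iso_kpow (mor (a (t + 2 + 1)) (a u)) 1.
    by have := hom_a (t + 2 + 1) u; rewrite u3 eqxx (_ : u + 2 == u = false) //; lia.
  move=> /iso_kpow1 [ep [ep0 epP]].
  have [r ri] := Sa (erefl (t + 2 + 1)); have [r' [r'r rr']] := ri.
  have cep : c @o ep = 0 by apply: (cell_hom0 cl); lia.
  have [e eE] : exists e, fmor S ep @o r' = h @o e.
    by apply: (hex_lift t3); rewrite compA -fmor_comp cep fmor0 comp0m.
  have he0 : h @o e <> 0.
    move=> he; move/eqP: ep0; apply; apply: S_faithful.
    by apply: (iso_cancelr (ex_intro _ r (conj rr' r'r))); rewrite eE he comp0m.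
  have ginj (b : mor (a (t + 2)) G) : b = 0 by apply: (cell_hom0 cl); lia.
  exists e; split; last first.
    move=> se; apply: he0; apply: (iso_cancell (sig_iso t)).
    by rewrite compA se compm0.
  split; first by apply/eqP => e0; apply: he0; rewrite e0 compm0.
  move=> x; have [y' y'E] := S_full ((h @o x) @o r); have [l lE] := epP y'.
  exists l; apply/eqP; rewrite -subr_eq0; apply/eqP.
  have hx : h @o x = l *: (h @o e).
    by rewrite -eE -[LHS]compm1 -rr' compA -y'E lE fmorZ compZl.
  have [b ->] : exists b, x - l *: e = g @o b.
    by apply: (hex_lift t2); rewrite compBr compZr hx subrr.
  by rewrite (ginj b) compm0.
exists Z, (sig t @o h), e; split; last by exists g, h.
(* [S (a u)] has cohomology in degree [t] only, just above the degrees of [G], so no connecting map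
   interferes. *)
have Hu i : i <> u -> is_zero_ob (H i (a u)) by move=> /Ha0.
have HSu i : i <> t -> is_zero_ob (H i (S (a u))) by move=> it; apply/HS0/Ha0; lia.
have HSu' : isomorphic (H t (S (a u))) A.
  apply: isomorphic_trans (Ha u); rewrite ut.
  by exists (hs t (a (t + 1))); exact: hs_iso.
have HG i : i <> t -> i <> t + 1 -> isomorphic (H i G) (H i Z).
  move=> it iu; exists (fmor (H i) g); apply: mono_epi_iso.
    apply: lexact_mono (hex_coh t1 i) _.
    by have /Hu [_ z] : i <> u by lia; exact: z.
  by apply: lexact_epi (hex_coh t2 i) _; have [z _] := HSu i it; exact: z.
have HGt i : t - 1 < i -> is_zero_ob (H i G).
  by move=> it; apply: (cell_coh0 cl); lia.
have Hmono i : t - 1 < i -> is_mono (fmor (H i) h).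
  by move=> it; apply: lexact_mono (hex_coh t2 i) _; exact: (HGt i it).2.
split.
- move=> s; have [->|/eqP s1] := eqVneq s (t - n.+1%:Z).
    by rewrite (_ : _ == t + 2 = false); [exact/iso_kpow1|lia].
  have [->|/eqP s2] := eqVneq s (t + 2); first by apply/iso_kpow1; exists e.
  by apply/iso_kpow0 => x; exact: kill.
- exact: qe.
- move=> i it; have [->|/eqP ne] := eqVneq i t.
    apply: isomorphic_trans HSu'; exists (fmor (H t) h); apply: mono_epi_iso.
      by apply: Hmono; lia.
    have /HS0 [z _] : is_zero_ob (H (t + 1) G) by apply: HGt; lia.
    by apply: lexact_epi (hex_coh t3 t) _; exact: z.
  apply: (@isomorphic_trans _ _ _ (H i G)); last by apply: (cell_coh cl); lia.
  by apply: isomorphic_sym; apply: HG; lia.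
- move=> i it; have [->|/eqP ne] := eqVneq i (t + 1).
    apply/zero_obP/(Hmono (t + 1)); first by lia.
    by rewrite compm1 compm0; have /HSu [z _] : t + 1 <> t by lia; exact: z.
  apply: (@zero_ob_iso _ _ _ (H i G)); last by apply: (cell_coh0 cl); lia.
  by apply: isomorphic_sym; apply: HG; lia.
Qed.

(** All top degrees are handled at once, because a string of the next length with top [t] is built
    on one with top [t - 1]. *)
Record level (n : nat) := Level {
  lG : int -> T;
  lq : forall t, mor (lG t) (a t);
  lc : forall t, mor (a (t + 2)) (lG t);
  lP : forall t, cell n (lq t) (lc t)
}.

(** The level is later extracted by choice, which hides its construction; the inverse of [lq] is
    therefore recorded here. *)
Lemma level0_ex : exists L : level 0, exists r : forall t, mor (a t) (lG L t),
  forall t, lq L t @o r t = idm (a t) /\ r t @o lq L t = idm (lG L t).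
Proof.
have ce t : exists e : mor (a (t + 2)) (a t), e != 0.
  have : iso_kpow (mor (a (t + 2)) (a t)) 1.
    by have := hom_a (t + 2) t; rewrite eqxx (_ : t + 2 == t = false) //; lia.
  by move=> /iso_kpow1 [e [e0 _]]; exists e.
pose c t := projT1 (cid (ce t)).
have cl t : cell 0 (idm (a t)) (c t).
  split.
  - by move=> s; rewrite subr0.
  - by rewrite comp1m; apply/eqP; exact: projT2 (cid (ce t)).
  - by move=> i it; have -> : i = t by lia.
  - by move=> i it; apply: Ha0; lia.
by exists (Level cl), (fun t => idm (a t)) => t; rewrite comp1m.
Qed.

Lemma level_next_ex n (L : level n) :
  exists L' : level n.+1, forall t, attached (lc L (t - 1)) (lq L' t).
Proof.
have nx t : exists x : {G' : T & (mor G' (a t) * mor (a (t + 2)) G')%type},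
    cell n.+1 (projT2 x).1 (projT2 x).2 /\ attached (lc L (t - 1)) (projT2 x).1.
  have [G' [q' [c' h]]] := cell_next (lP L (t - 1)).
  by exists (existT _ G' (q', c')).
pose x t := projT1 (cid (nx t)).
have xP t : cell n.+1 (projT2 (x t)).1 (projT2 (x t)).2 by have [] := projT2 (cid (nx t)).
by exists (Level xP) => t; have [] := projT2 (cid (nx t)).
Qed.

Fixpoint tower n : level n :=
  match n with
  | 0%N => projT1 (cid level0_ex)
  | n.+1 => projT1 (cid (level_next_ex (tower n)))
  end.

Definition G n t : T := lG (tower n) t.

Lemma tower_attached n t : attached (lc (tower n) (t - 1)) (lq (tower n.+1) t).
Proof. exact: (projT2 (cid (level_next_ex (tower n)))). Qed.

Lemma G_attach n t t' u (x : mor (a u) (G n t')) : t' = t - 1 -> u = t' + 2 -> x <> 0 ->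
  exists (g : mor (G n t') (G n.+1 t)) (h : mor (G n.+1 t) (S (a u))), extri x g h.
Proof.
move=> tt ut; subst t' u => x0.
have [g [h [tr _]]] := tower_attached n t.
exists g, h; have cl := lP (tower n) (t - 1).
have [l xl] := cell_span cl x (erefl _) (cell_c0 cl).
rewrite xl; apply: extri_scale => //; apply: contra_notN x0 => /eqP l0.
by rewrite xl l0 scale0r.
Qed.

(** By induction the map of shorter strings with top [t - 1] sends one attaching map to a non-zero
    multiple of the other. Hence [h'] is killed by the suspended attaching map of the shorter
    string, and lifts through [h]; the lift is over [a t] by construction. *)
Lemma tower_map n t : exists p : mor (G n.+1 t) (G n t),
  lq (tower n) t @o p = lq (tower n.+1) t.
Proof.
elim: n t => [|n IH] t.
  have /= [r rP] := projT2 (cid level0_ex).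
  by exists (r t @o lq (tower 1) t); rewrite compA (rP t).1 comp1m.
have [p pE] := IH (t - 1).
have [g [h [tr qE]]] := tower_attached n t.
have [g' [h' [tr' qE']]] := tower_attached n.+1 t.
have cl := lP (tower n) (t - 1); have cl' := lP (tower n.+1) (t - 1).
have pc : p @o lc (tower n.+1) (t - 1) <> 0.
  by move=> pc; apply: (cell_qc cl'); rewrite -pE -compA pc compm0.
have [l lE] := cell_span cl (lc (tower n) (t - 1)) (erefl _) pc.
have [p' p'E] : exists p', h' = h @o p'.
  apply: (hex_lift (tri3 tr)).
  by rewrite lE fmorZ fmor_comp compZl -compA (hex0 (tri3 tr')) compm0 scaler0.
by exists p'; rewrite qE qE' p'E compA.
Qed.

(** Compose the tower maps. The composite is over [a t], so it cannot kill the class that [q]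
    detects. *)
Lemma G_map n m t t' : (m <= n)%N -> t = t' ->
  exists p : mor (G n t) (G m t'), forall u (x : mor (a u) (G n t)),
    u = t + 2 -> x <> 0 -> p @o x <> 0.
Proof.
move=> mn <-; have [p pE] : exists p : mor (G n t) (G m t),
    lq (tower m) t @o p = lq (tower n) t.
  elim: n mn => [|n IH]; first by rewrite leqn0 => /eqP ->; exists (idm _); rewrite compm1.
  rewrite leq_eqVlt => /orP [/eqP ->|/IH [p pE]]; first by exists (idm _); rewrite compm1.
  have [p' p'E] := tower_map n t.
  by exists (p @o p'); rewrite compA pE.
exists p => u x ut; subst u => x0 px; have cl := lP (tower n) t.
have [l lE] := cell_span cl (lc (tower n) t) (erefl _) x0.
by apply: (cell_qc cl); rewrite lE compZr -pE -compA px compm0 scaler0.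
Qed.

Lemma G_coh n t i : t - n%:Z <= i <= t -> isomorphic (H i (G n t)) A.
Proof. exact: cell_coh (lP (tower n) t) i. Qed.

Lemma G_coh0 n t i : ~~ (t - n%:Z <= i <= t) -> is_zero_ob (H i (G n t)).
Proof. exact: cell_coh0 (lP (tower n) t) i. Qed.

Lemma G_hom n t s : iso_kpow (mor (a s) (G n t)) ((s == t - n%:Z)%R + (s == t + 2)%R)%N.
Proof. exact: cell_hom (lP (tower n) t) s. Qed.

(** Realise a projection of [H m B] to one copy of [A] by a map [B -> a m]; its third vertex,
    desuspended, is [B'], and the triangle is rotated backwards. *)
Lemma peel (B : T) m d u : u = m + 1 ->
  (forall i, m < i -> is_zero_ob (H i B)) -> is_power A d.+1 (H m B) ->
  exists (B' : T) (phi : mor (a u) B') (w : mor B' B) (q : mor B (S (a u))),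
    [/\ extri phi w q, is_power A d (H m B'),
        forall i, m < i -> is_zero_ob (H i B')
      & forall i, i < m -> isomorphic (H i B') (H i B)].
Proof.
move=> um B0 /kernel_power [r rs rk].
have [p [th [thi pE]]] := top r B0.
have [Z [v [z [t1 t2 t3]]]] := extri_ex p.
have [B' [ze zei]] := S_ess Z; have [sg sgi] := Sa um.
have [ze' [ze'ze zeze']] := zei; have [sg' [sg'sg sgsg']] := sgi.
have ze'i : is_iso ze' by exists ze.
have sg'i : is_iso sg' by exists sg.
have [phi phiE] := S_full (ze' @o v @o sg).
have [w wE] := S_full (z @o ze).
pose q := sg' @o p; have id1 := @is_iso_id _ T.
have tr : extri phi w q.
  split.
  - apply: (hexact_shift S_full hs_iso hs_nat S_faithful).
    apply: hexact_conj t2; [exact: sg'i|exact: ze'i|exact: id1|..].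
      by rewrite phiE -compA sgsg' compm1.
    by rewrite comp1m wE -compA zeze' compm1.
  - apply: (hexact_shift S_full hs_iso hs_nat S_faithful).
    apply: hexact_conj t3; [exact: ze'i|exact: id1|exact: fmor_iso sg'i|..].
      by rewrite comp1m wE -compA zeze' compm1.
    by rewrite compm1 /q fmor_comp.
  - apply: hexact_conj t1; [exact: id1|exact: sg'i|exact: ze'i|by rewrite compm1|].
    by rewrite phiE -!compA sgsg' compm1.
exists B', phi, w, q; have [T1 T2 T3] := tr.
have Hu i : i <> u -> is_zero_ob (H i (a u)) by move=> /Ha0.
have Hw_mono i : i <> u -> is_mono (fmor (H i) w).
  by move=> iu; apply: lexact_mono (hex_coh T1 i) _; exact: (Hu i iu).2.
have Hw_epi i : i <> m -> is_epi (fmor (H i) w).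
  move=> im; have /HS0 [y _] : is_zero_ob (H (i + 1) (a u)) by apply: Hu; lia.
  by apply: lexact_epi (hex_coh T2 i) _; exact: y.
have Hw i : i <> u -> i <> m -> isomorphic (H i B') (H i B).
  by move=> iu im; exists (fmor (H i) w); apply: mono_epi_iso; [exact: Hw_mono|exact: Hw_epi].
have qE : fmor (H m) q = (fmor (H m) sg' @o th) @o r by rewrite fmor_comp pE compA.
have sti : is_iso (fmor (H m) sg' @o th).
  by apply: is_iso_comp => //; exact: fmor_iso.
split=> //.
- apply: (rk _ (fmor (H m) w)).
  have [|e0 eP] := lexact_kernel (hex_coh T2 m); first by apply: Hw_mono; lia.
  rewrite qE in e0 eP; split.
    by apply: (iso_cancell sti); rewrite compA e0 compm0.
  by move=> V y ry; apply: eP; rewrite -compA ry compm0.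
(* Only degree [u = m + 1] is delicate. There [phi] is zero on cohomology, because [q] is epi on
   [H m], and also epi, because [H u B = 0]. *)
- move=> i im; have [iu|/eqP iu] := eqVneq i u; last first.
    by apply: zero_ob_iso (B0 i im); apply: Hw => //; lia.
  have re : is_epi r.
    by move=> V x y e; have [s sE] := rs (idm A); rewrite -[x]compm1 -[y]compm1 -sE !compA e.
  have qe : is_epi (fmor (H m) q) by rewrite qE; apply: epi_comp => //; exact: iso_epi.
  have Sphi : fmor (H m) (fmor S phi) = 0 by apply: (epi0 qe); exact: (hex_coh T3 m).1.
  have phi0 : fmor (H (m + 1)) phi = 0.
    by apply: (iso_cancelr (hs_iso m (a u))); rewrite hs_nat Sphi compm0 comp0m.
  have pe : is_epi (fmor (H (m + 1)) phi).
    have [y _] : is_zero_ob (H (m + 1) B) by apply: B0; lia.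
    by apply: lexact_epi (hex_coh T1 (m + 1)) _; exact: y.
  rewrite iu um; apply/zero_obP/pe; rewrite comp1m comp0m //.
- by move=> i im; apply: Hw; lia.
Qed.

Definition decomposes (B : T) : Prop :=
  exists (I : finType) (n : I -> nat) (t : I -> int), is_dsum (fun i => G (n i) (t i)) B.

Lemma decompose_step (B B' : T) m u (phi : mor (a u) B') (w : mor B' B) (q : mor B (S (a u))) :
  u = m + 1 -> extri phi w q -> (forall i, m < i -> is_zero_ob (H i B')) ->
  decomposes B' -> decomposes B.
Proof.
move=> um tr B'0 [I [n [t [inj [prj [pii pij s]]]]]].
(* A summand with bottom degree [u = m + 1] would contradict the vanishing of the cohomology of [B']
   above [m]; so [phi] reaches a string only through its class in degree [t i + 2]. *)
have bot i : t i - (n i)%:Z <> u.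
  move=> tn; have : is_zero_ob (H u (G (n i) (t i))).
    apply: zero_ob_retract (B'0 u _); last by lia.
    by rewrite -[RHS]fmor_id -(pii i) fmor_comp.
  move=> /(zero_ob_iso (isomorphic_sym (G_coh _))) h.
  by move/eqP: A0; apply; apply/zero_obP/h; lia.
have ti i : prj i @o phi <> 0 -> t i = m - 1.
  move=> pp; have [|/eqP tu] := eqVneq u (t i + 2); first by lia.
  by case: pp; apply: (cell_hom0 (lP (tower (n i)) (t i))) => //; exact/nesym/bot.
have [[i0 pi0]|none] := pselect (exists i, prj i @o phi <> 0); last first.
  have phi0 : phi = 0.
    rewrite -[phi]comp1m -s comp_suml big1 // => i _; rewrite -compA.
    have [->|/eqP ne] := eqVneq (prj i @o phi) 0; first exact: compm0.
    by case: none; exists i.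
  (* For [phi = 0] the new cell splits off. This is [split_off] with [Y] a zero object, obtained as
     the third vertex of an identity. *)
  have [O [O1 [O2 tO]]] := extri_ex (idm (a u)).
  have O0 : is_zero_ob O.
    have O10 : O1 = 0 by rewrite -[O1]compm1 (hex0 (tri1 tO)).
    have O20 : O2 = 0.
      by rewrite -[O2]comp1m -(fmor_id S (a u)) (hex0 (tri3 tO)).
    apply/zero_obP; have [b ->] : exists b, idm O = O1 @o b.
      by apply: (hex_lift (tri2 tO)); rewrite O20 comp0m.
    by rewrite O10 comp0m.
  have [K [v [h tK]]] := extri_ex (0 : mor (a u) O).
  have hi := extri_zero O0 tK.
  have dB : is_dsum (fun x : unit + I =>
      match x with inl _ => K | inr j => G (n j) (t j) end) B.
    apply: (split_off S_full (i0 := 0) (p0 := 0) (i := inj) (p := prj) (@a_scalar u) tK tr).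
    - by rewrite comp0m; symmetry; apply/zero_obP.
    - by move=> j; rewrite compm0.
    - by move=> j; rewrite comp0m.
    - exact: pii.
    - exact: pij.
    - by rewrite comp0m add0r.
    - by rewrite comp0m.
    - by move=> j; rewrite phi0 compm0.
  exists (unit + I)%type, (fun x => match x with inl _ => 0%N | inr j => n j end),
    (fun x => match x with inl _ => m | inr j => t j end).
  apply: dsum_transport (isomorphic_refl _) dB => -[x|j]; last exact: isomorphic_refl.
  apply: (@isomorphic_trans _ _ _ (S (a u))); first by exists h.
  apply: (@isomorphic_trans _ _ _ (a m)); first exact: Sa.
  have [r rP] := projT2 (cid level0_ex).
  by exists (r m), (lq (tower 0) m); split; [exact: (rP m).1|exact: (rP m).2].
pose P i := `[< prj i @o phi <> 0 >].
have Pi0 : P i0 by apply/asboolP.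
case: (@arg_maxnP _ i0 P n Pi0) => j0 /asboolP pj0 jmax.
have tj0 := ti j0 pj0.
have ut : u = t j0 + 2 by lia.
have [v [h tK]] := G_attach (t := m) tj0 ut pj0.
(* As [n j0] is maximal, [G_map] applies, and [Hom (a u, G (n j) (t j))] being a line, a scalar
   matches the two components. *)
have gex j : exists g : mor (G (n j0) (t j0)) (G (n j) (t j)),
    j != j0 -> prj j @o phi = g @o (prj j0 @o phi).
  have [->|/eqP pj] := eqVneq (prj j @o phi) 0; first by exists 0; rewrite comp0m.
  have tj := ti j pj; have tt : t j0 = t j by rewrite tj tj0.
  have [|p pP] := @G_map (n j0) (n j) _ _ _ tt; first exact/jmax/asboolP.
  have [|l lE] := cell_span (lP (tower (n j)) (t j)) (prj j @o phi) _ (pP u _ ut pj0).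
    by rewrite -tt.
  by exists (l *: p); rewrite compZl -lE.
have dB := attach_dsum S_full (@a_scalar u) pii pij s
  (fun j => projT2 (cid (gex j))) tK tr.
exists (unit + {j | j \in predC1 j0})%type,
  (fun x => match x with inl _ => (n j0).+1 | inr j => n (val j) end),
  (fun x => match x with inl _ => m | inr j => t (val j) end).
by apply: dsum_transport (isomorphic_refl _) dB => -[x|j]; exact: isomorphic_refl.
Qed.

(** Induction on the number [w] of degrees allowed from [l] upwards, and inside it on the
    multiplicity [e] of [A] in the highest of them, which [peel] lowers by one. *)
Lemma classify (B : T) :
  (exists d : int -> nat, forall i, is_power A (d i) (H i B)) -> decomposes B.
Proof.
move=> [d dP]; have [l [u luP]] := H_bounded B.
have d0 i : i < l -> d i = 0%N.
  move=> il; have Bi : is_zero_ob (H i B) by apply: luP; rewrite il.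
  by case: (d i) (dP i) => // e /(power_gt0_nonzero A0).
suff main (w e : nat) (X : T) (c : int -> nat) :
    (forall i, is_power A (c i) (H i X)) -> (forall i, i < l -> c i = 0%N) ->
    (forall i, l + w%:Z <= i -> is_zero_ob (H i X)) -> c (l + w%:Z - 1) = e ->
    decomposes X.
  have [w wE] : exists w : nat, u < l + w%:Z.
    by exists `|u - l|.+1%N; lia.
  by apply: (main w _ B d) => // i li; apply: luP; apply/orP; right; lia.
elim: w e X c => [|w IHw] e X c cP cl X0 ce.
  have X00 : is_zero_ob X.
    apply: H_zero => i; have [il|li] := Order.TotalTheory.ltP i l; last first.
      by apply: X0; lia.
    by have := cP i; rewrite cl // => /power0.
  exists void, (fun=> 0%N), (fun=> 0); apply: dsum_card0 X00.
  exact: card_void.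
have [m mE] : exists m, m = l + w%:Z by exists (l + w%:Z).
have {ce}ce : c m = e by rewrite -ce mE; congr c; lia.
elim: e X c cP cl X0 ce => [|e IHe] X c cP cl X0 ce.
  apply: (IHw (c (l + w%:Z - 1)) X c) => // i li.
  have [->|/eqP im] := eqVneq i m; last by apply: X0; lia.
  by have := cP m; rewrite ce => /power0.
have Xm i : m < i -> is_zero_ob (H i X) by move=> mi; apply: X0; lia.
have Xe : is_power A e.+1 (H m X) by rewrite -ce.
have [B' [phi [x [q [tr B'm B'0 B'i]]]]] := peel (erefl (m + 1)) Xm Xe.
apply: (decompose_step (erefl (m + 1)) tr B'0).
apply: (IHe B' (fun i => if i == m then e else if i < m then c i else 0%N)).
- move=> i; have [->//|im] := eqVneq i m.
  case: ifP => im'; last by apply/power0/B'0; lia.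
  by apply: power_iso (isomorphic_sym (B'i _ im')) (cP i).
- by move=> i il; rewrite cl // if_same; case: eqP => //; lia.
- by move=> i li; apply: B'0; lia.
- by rewrite eqxx.
Qed.

(** Decompose [X]. Each summand receives maps from two degrees, [t - m] and [t + 2], which must be
    [b] and [b + n + 2] in this order; this fixes [m] and [t]. Two summands would make
    [Hom (a b, X)] at least two-dimensional. *)
Lemma string_unique (X : T) (n : nat) (b : int) :
  (exists d : int -> nat, forall i, is_power A (d i) (H i X)) ->
  ~ is_zero_ob X ->
  (forall s, iso_kpow (mor (a s) X) ((s == b) + (s == b + n.+2%:Z)%R)%N) ->
  isomorphic (G n (b + n%:Z)) X.
Proof.
move=> /classify [I [m [t ds]]] X0 Xh.
have [inj [prj [pii pij s]]] := ds.
have nz i v (x : mor (a v) (G (m i) (t i))) : x <> 0 -> v = b \/ v = b + n.+2%:Z.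
  move=> x0; have [|/eqP vb] := eqVneq v b; first by left.
  have [|/eqP vn] := eqVneq v (b + n.+2%:Z); first by right.
  have : forall y : mor (a v) X, y = 0.
    by apply/iso_kpow0; have := Xh v; case: eqP => //; case: eqP.
  move=> /(_ (inj i @o x)) ix; case: x0.
  by rewrite -[x]comp1m -pii -compA ix compm0.
have low i : exists x : mor (a (t i - (m i)%:Z)) (G (m i) (t i)), x <> 0.
  have : iso_kpow (mor (a (t i - (m i)%:Z)) (G (m i) (t i))) 1.
    have := G_hom (m i) (t i) (t i - (m i)%:Z).
    by rewrite eqxx (_ : _ == _ + 2 = false) //; lia.
  by move=> /iso_kpow1 [x [/eqP x0 _]]; exists x.
have high i : exists x : mor (a (t i + 2)) (G (m i) (t i)), x <> 0.
  have : iso_kpow (mor (a (t i + 2)) (G (m i) (t i))) 1.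
    have := G_hom (m i) (t i) (t i + 2).
    by rewrite eqxx (_ : _ == t i - _ = false) //; lia.
  by move=> /iso_kpow1 [x [/eqP x0 _]]; exists x.
have mt i : m i = n /\ t i = b + n%:Z.
  have [x x0] := low i; have [y y0] := high i.
  by have := nz _ _ _ x0; have := nz _ _ _ y0; lia.
have [i0 _] : exists i : I, True.
  have [[i]|no] := pselect (exists i : I, True); first by exists i.
  case: X0; apply: dsum_zero ds _ => i; case: no; by exists i.
have one i : i = i0.
  apply/eqP; apply: contra_notT X0 => /eqP ne.
  have [x x0] := low i; have [y y0] := low i0.
  have e : t i - (m i)%:Z = t i0 - (m i0)%:Z.
    by have [-> ->] := mt i; have [-> ->] := mt i0.
  move: x x0; rewrite e => x x0.
  have : iso_kpow (mor (a (t i0 - (m i0)%:Z)) X) 1.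
    have := Xh (t i0 - (m i0)%:Z); have [-> ->] := mt i0.
    have -> : (b + n%:Z - n%:Z == b) = true by lia.
    by have -> : (b + n%:Z - n%:Z == b + n.+2%:Z) = false by lia.
  have ix : inj i @o x != 0.
    by apply/eqP => ix; apply: x0; rewrite -[x]comp1m -pii -compA ix compm0.
  move=> /iso_kpow1_spans /(_ ix) [_ /(_ (inj i0 @o y)) [l lE]].
  case: y0; rewrite -[y]comp1m -pii -compA lE compZr compA pij //.
  by rewrite comp0m scaler0.
have [mi ti] := mt i0.
by apply: isomorphic_trans (dsum_card1 one ds); rewrite mi ti; exact: isomorphic_refl.
Qed.

End Classification.

(** * The derived category of an abelian category *)

Section Spherical.
Variables (k : fieldType) (C : abelian_cat k) (A : C).
Hypothesis hHom : iso_kpow (mor A A) 1.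
Hypothesis hExt2 : iso_kpow (Ext 2 A A) 1.
Hypothesis hExt : forall i : int, i <> 0 -> i <> 2 -> iso_kpow (Ext i A A) 0.

Definition sA (t : int) : Db C := cshift (conc A) (- t).

Lemma sA_id_neq0 : idm A != 0.
Proof.
apply/eqP => e; have [x [/eqP x0 _]] := (iso_kpow1 _).1 hHom.
by apply: x0; rewrite -[x]comp1m e comp0m.
Qed.

Lemma isomorphic_shift_add (X : Db C) s t u : s + t = u ->
  isomorphic (cshift (cshift X s) t : Db C) (cshift X u : Db C).
Proof. by move=> /(shiftF_add C) [n [ni _]]; exists (n X); exact: ni. Qed.

Lemma isomorphic_shift_zero (X : Db C) s : s = 0 -> isomorphic (cshift X s : Db C) X.
Proof. by move=> /(shiftF_zero C) [n [ni _]]; exists (n X); exact: ni. Qed.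

(** Shift by [s], a full and faithful operation, and identify [A[-s][s]] with [A]. *)
Lemma sA_hom (X : Db C) s : liniso (mor (sA s) X) (RHom (conc A) X s).
Proof.
apply: liniso_trans.
  exact: (liniso_fmor (@shiftF_faithful _ C s _ _) (@shiftF_full _ C s _ _)).
apply: liniso_hom; last exact: isomorphic_refl.
apply: (@isomorphic_trans _ (Db C) _ (cshift (conc A) 0)).
  by apply: isomorphic_shift_add; rewrite addNr.
exact: isomorphic_shift_zero.
Qed.

Lemma Ext_power i : iso_kpow (Ext i A A) ((i == 0) + (i == 2))%N.
Proof.
have [->|/eqP i0] := eqVneq i 0.
  apply: iso_kpow_liniso hHom; apply: liniso_trans (conc_hom_liniso A) _.
  apply: (@liniso_hom _ (Db C)); first exact: isomorphic_refl.
  exact/isomorphic_sym/isomorphic_shift_zero.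
have [->|/eqP i2] := eqVneq i 2; first exact: hExt2.
exact: hExt.
Qed.

Lemma sA_sA s t : iso_kpow (mor (sA s) (sA t)) ((s == t) + (s == t + 2)%R)%N.
Proof.
have -> : ((s == t) + (s == t + 2)%R = (s - t == 0)%R + (s - t == 2)%R)%N.
  by congr (nat_of_bool _ + nat_of_bool _)%N; lia.
apply: iso_kpow_liniso (Ext_power (s - t)); apply: liniso_sym.
apply: liniso_trans (sA_hom _ _) _.
apply: (@liniso_hom _ (Db C)); first exact: isomorphic_refl.
by apply: isomorphic_shift_add; rewrite addrC.
Qed.

Lemma sA_shift u v : u = v + 1 -> isomorphic (shiftF C 1 (sA u)) (sA v).
Proof. by move=> uv; apply: isomorphic_shift_add; rewrite uv opprD subrK. Qed.

Lemma sA_coh t : isomorphic (cohF C t (sA t)) A.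
Proof. by apply: coh_conc; rewrite subrr. Qed.

Lemma sA_coh0 t i : i <> t -> is_zero_ob (cohF C i (sA t)).
Proof. by move=> it; apply: coh_conc_zero; lia. Qed.

Lemma shiftF_ess (X : Db C) : exists Y : Db C, isomorphic (shiftF C 1 Y) X.
Proof.
by have [n [ni _]] := shiftF_inv C (addNr 1); exists (shiftF C (-1) X), (n X).
Qed.

Lemma coh_bounded (X : Db C) : exists l u : int, forall i,
  (i < l) || (u < i) -> is_zero_ob (cohF C i X).
Proof.
have [l [u luP]] := cbounded X; exists l, u => i /luP [Xi _].
apply/coh_zeroP => V z _; exists V, (idm V), i, 0.
by rewrite compm0 (Xi _ z) comp0m; split=> //; exact: epi_id.
Qed.

Definition sG : nat -> int -> Db C :=
  @G k (Db C) C (shiftF C 1) (cohF C) (@shiftF_full _ C 1) (@shiftF_faithful _ C 1)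
    (fun i X => coh_shift X 1 i) (fun i X => coh_shift_iso X 1 i)
    (@Db_extri_ex _ C) A sA sA_id_neq0 sA_shift sA_sA sA_coh sA_coh0.

Lemma sG_coh n t i : t - n%:Z <= i <= t -> isomorphic (coh (sG n t) i) A.
Proof. exact: (G_coh (H := cohF C)). Qed.

Lemma sG_coh0 n t i : ~~ (t - n%:Z <= i <= t) -> is_zero_ob (coh (sG n t) i).
Proof. exact: (G_coh0 (H := cohF C)). Qed.

Lemma sG_hom n t s : iso_kpow (mor (sA s) (sG n t)) ((s == t - n%:Z)%R + (s == t + 2)%R)%N.
Proof. exact: (G_hom (H := cohF C)). Qed.

Lemma sG_classify (B : Db C) : gen_by A B ->
  exists (I : finType) (n : I -> nat) (t : I -> int), is_dsum (fun i => sG (n i) (t i)) B.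
Proof.
apply: (classify (H := cohF C)); [exact: shiftF_ess|exact: (fun i => @cohF_shift _ C 1 i)|
  exact: acyclic_zero|exact: coh_bounded|exact: top_map].
Qed.

Lemma sG_unique (X : Db C) n b : gen_by A X -> ~ is_zero_ob X ->
  (forall s, iso_kpow (mor (sA s) X) ((s == b) + (s == b + n.+2%:Z)%R)%N) ->
  isomorphic (sG n (b + n%:Z)) X.
Proof.
apply: (string_unique (H := cohF C)); [exact: shiftF_ess|exact: (fun i => @cohF_shift _ C 1 i)|
  exact: acyclic_zero|exact: coh_bounded|exact: top_map].
Qed.

Lemma sG_An n : is_An A n (sG n n).
Proof.
split=> [i ib|i ib|i].
- by apply: sG_coh; lia.
- by apply: sG_coh0; lia.
- apply: iso_kpow_liniso (sA_hom _ i) _.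
  have := sG_hom n n i; congr (iso_kpow _ (nat_of_bool _ + nat_of_bool _)%N); lia.
Qed.

(** [Y[n - t]] has its cohomology in degrees [t - n] to [t], so [string_unique] applies with
    [b = t - n = - s]. *)
Lemma An_shift n (Y : Db C) (s t : int) : is_An A n Y -> s = n%:Z - t ->
  isomorphic (sG n t) (cshift Y s).
Proof.
move=> [Y1 Y0 Yh] st; have -> : t = - s + n%:Z by lia.
have cohs i : isomorphic (coh (cshift Y s) i) (coh Y (i + s)).
  by exists (coh_shift Y s i); exact: coh_shift_iso.
apply: sG_unique.
- exists (fun i => nat_of_bool (0 <= i + s <= n%:Z)) => i.
  case: (boolP (0 <= i + s <= n%:Z)) => is_ /=.
    by apply/power1/isomorphic_sym/(isomorphic_trans (cohs i))/Y1.
  by apply/power0/(zero_ob_iso (cohs i))/Y0.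
- move=> /(fob_zero (cohF C (- s))) /(zero_ob_iso (isomorphic_sym (cohs _))).
  move=> /(zero_ob_iso (isomorphic_sym (Y1 _ _))) h; move/eqP: sA_id_neq0; apply.
  by apply/zero_obP/h; lia.
- move=> s'; apply: iso_kpow_liniso (liniso_sym (sA_hom _ _)) _.
  have -> : ((s' == - s)%R + (s' == - s + n.+2%:Z)%R =
             (s + s' == 0)%R + (s + s' == n.+2%:Z)%R)%N.
    by congr (nat_of_bool _ + nat_of_bool _)%N; lia.
  apply: iso_kpow_liniso (Yh (s + s')).
  apply: (@liniso_hom _ (Db C)); first exact: isomorphic_refl.
  by apply: isomorphic_sym; exact: isomorphic_shift_add.
Qed.

Lemma An_unique n (Y : Db C) : is_An A n Y -> isomorphic (sG n n) Y.
Proof.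
move=> YA; apply: (@isomorphic_trans _ (Db C) _ (cshift Y 0)).
  by apply: An_shift YA _; rewrite subrr.
exact: isomorphic_shift_zero.
Qed.

(* The isomorphism class of an object only depends on the list of its
   summands. *)
Lemma gen_by_countable : countable [set iso_class X | X in gen_by A].
Proof.
pose F (l : seq (nat * int)) : set (Db C) := [set Y | is_dsum
  (fun i : 'I_(size l) => sG (nth (0%N, 0) l i).1 (nth (0%N, 0) l i).2) Y].
apply: (@sub_countable _ _ _ (range F)); last first.
  by apply: sub_countable (card_image_le F _) (countableP _).
apply: subset_card_le => _ [X /sG_classify [I [n [t XI]]] <-].
pose l := [seq (n i, t i) | i <- enum I].
have sz : size l = #|I| by rewrite size_map cardE.
pose f (i : 'I_(size l)) : I := enum_val (cast_ord sz i).
have fb : bijective f.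
  exists (fun i => cast_ord (esym sz) (enum_rank i)) => i.
    by rewrite /f enum_valK cast_ordK.
  by rewrite /f cast_ordKV enum_rankK.
have lE (i : 'I_(size l)) : nth (0%N, 0) l i = (n (f i), t (f i)).
  have ii : (i < #|I|)%N by rewrite -sz.
  rewrite (nth_map (f i)) -?cardE // /f.
  by rewrite /enum_val (set_nth_default (enum_default (cast_ord sz i))) // -cardE.
have FX : F l X.
  apply: dsum_transport (isomorphic_refl X) (dsum_reindex fb XI) => i.
  by rewrite lE; exact: isomorphic_refl.
exists l => //; apply/seteqP; split=> Y /= XY.
  exact: dsum_unique FX XY.
by apply: dsum_transport XY FX => i; exact: isomorphic_refl.
Qed.

End Spherical.

Theorem proposition3p5 (k : fieldType) (C : abelian_cat k) (A : C)
  (hHom : iso_kpow (mor A A) 1)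
  (hExt2 : iso_kpow (Ext 2 A A) 1)
  (hExt : forall i : int, i <> 0 -> i <> 2 -> iso_kpow (Ext i A A) 0) :
  (* A_n exists and is unique up to isomorphism *)
  (forall n : nat, exists2 X : Db C, is_An A n X &
     forall Y : Db C, is_An A n Y -> isomorphic X Y) /\
  (* every B in D^b(C)<A> is a finite direct sum of objects A_n^d[s] *)
  (forall An : nat -> Db C, (forall n, is_An A n (An n)) ->
     forall B : Db C, gen_by A B ->
     exists (I : finType) (n : I -> nat) (d : I -> nat) (s : I -> int)
            (P : I -> Db C),
       [/\ forall i, (0 < d i)%N,
           forall i, is_power (An (n i)) (d i) (P i)
         & is_dsum (fun i => cshift (P i) (s i) : Db C) B]) /\
  countable [set iso_class X | X in gen_by A].
Proof.
split; [|split].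
- move=> n; exists (sG hHom hExt2 hExt n n); first exact: sG_An.
  by move=> Y; exact: An_unique.
- move=> An AnP B /(sG_classify hHom hExt2 hExt) [I [n [t BI]]].
  (* Repeated summands stay separate members of the family, so all multiplicities are 1; the shift
     comes from [G n t = A_n[n - t]]. *)
  exists I, n, (fun=> 1%N), (fun i => (n i)%:Z - t i), (fun i => An (n i)); split=> //.
  + by move=> i; apply: power1; exact: isomorphic_refl.
  + apply: dsum_transport (isomorphic_refl _) BI => i; exact: An_shift.
- exact: gen_by_countable.
Qed.
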